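(* Let $(\mathbf{P},\mathbf{F})\sim SMBS(\mathbf{m},\mathbf{c},\mathbf{F_0})$ and, conditionally on $(\mathbf{P},\mathbf{F})$, let $S=(S_t)_{t\ge 0}\sim SM(\mathbf{P},\mathbf{F})$ (started at the fixed state $l_0$). Let $t>0$ be a fixed integer. Then the posterior distribution of $(\mathbf{P},\mathbf{F})$ given $S_{0:t}=i_{0:t}$ is $SMBS(\mathbf{m_*},\mathbf{c_*},\mathbf{F_*})$, where $\mathbf{m_*}=(m_*^i)_{i\in E}$, $\mathbf{c_*}=(c_*^i)_{i\in E}$, $\mathbf{F_*}=(F_*^i)_{i\in E}$ are as follows (with $M^{i,j}(t)$, $N^{i,t}$ and $l(t)$ computed from the observed path $S_{0:t}=i_{0:t}$): 1. For all $i\in E$, $m_*^i$ is the measure on $E$ with $m_*^i(\{j\})=m^i(\{j\})+M^{i,j}(t)$ for $j\in E$, $j\ne i$ (and $m_*^i(\{i\})=0$). 2. For all $i\in E$ with $i\neq i_t$, $F_*^i$ and $c_*^i$ are determined, for each integer $u>0$, by $$F^{i}_*((u,+\infty)) = \prod_{s=1}^u \left[ 1-\frac{c^i(s)F_0^i(\{s\})+N^{i,t}(\{s\})}{c^i(s)F_0^i([s,+\infty))+N^{i,t}([s,+\infty))} \right],$$ $$c^{i}_*(u) = \frac{c^i(u)F_0^i((u,+\infty))+N^{i,t}((u,+\infty))}{F^i_*((u,+\infty))}.$$ 3. For $i=i_t$, $F_*^i$ and $c_*^i$ are determined, for each integer $u>0$, by $$F_*^{i}((u,+\infty)) = \prod_{s=1}^u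 \left[ 1-\frac{c^i(s)F_0^i(\{s\})+N^{i,t}(\{s\})}{c^i(s)F_0^i([s,+\infty))+N^{i,t}([s,+\infty))+I\{l(t)\geq s\}} \right],$$ $$c^{i}_*(u) = \frac{c^i(u)F_0^i((u,+\infty))+N^{i,t}((u,+\infty))+I\{l(t)\geq u\}}{F^i_*((u,+\infty))}.$$
   Context: $E$ is a non-empty finite or countably infinite set, with a fixed element $l_0\in E$. $I\{\cdot\}$ denotes an indicator. $x_{a:b}=(x_a,\dots,x_b)$ if $a\le b$, and the empty sequence if $a>b$. A non-decreasing function on the integers and its associated measure are denoted by the same symbol; e.g. $F(x)=F((-\infty,x])$, and $(a,b]$ denotes a set of integers. Empty sums are $0$ and empty products are $1$. Semi-Markov processes. A characteristic couple is a pair $(\mathbf{P},\mathbf{F})$ where $\mathbf{P}=(P^{i,j})_{i,j\in E}$ is a transition matrix on $E$ with $P^{i,i}=0$ for all $i$, and $\mathbf{F}=(F^i)_{i\in E}$ is a collection of probability distributions on the positive integers. The $i$-th row of $\mathbf{P}$ is identified with the probability measure $P^i(\{j\})=P^{i,j}$ on $E$. A Markov renewal process starting at $l_0$ with characteristic couple $(\mathbf{P},\mathbf{F})$ is a process $(L_n,T_n)_{n\ge 0}$ with $L_0=l_0$ a.s. and $$\mathbb{P}(L_{n+1}=j,T_n\le t\mid L_n=i,L_{0:n-1},T_{0:n-1},(\mathbf{P},\mathbf{F}))=F^i(t)P^{i,j}$$ for all $n\ge0$, $t\ge1$, $i,j\in E$. With $\tau_0=0$, $\tau_{n+1}=\sum_{h=0}^nT_h$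 and $N(t)=\sum_{n\ge1}I\{\tau_n\le t\}$, the process $S_t=L_{N(t)}$, $t=0,1,2,\dots$, is the associated semi-Markov process, written $S\sim SM(\mathbf{P},\mathbf{F})$. Beta-Stacy process. Given $c(t)>0$ for all integers $t>0$ and a probability distribution $F_0$ with support on the positive integers, a random distribution $F$ is $BS(c,F_0)$ if there are independent random variables $(U_t)_{t\ge1}$ with $U_t\sim Beta(c(t)F_0(\{t\}),c(t)F_0((t,+\infty)))$ and $F((t,+\infty))=\prod_{k=1}^t(1-U_k)$ for all integers $t\ge0$. It is assumed that $F_0((t,+\infty))>0$ for all $t\ge 0$, and $Beta(0,b)$ with $b>0$ is read as the point mass at $0$. Dirichlet process. For a measure $m$ on $E$ with $0<m(E)<\infty$, a random probability measure $P$ on $E$ is $Dir(m)$ if $(P(A_1),\dots,P(A_n))\sim Dirichlet(m(A_1),\dots,m(A_n))$ for every finite partition $A_1,\dots,A_n$ of $E$ (coordinates with zero parameter are a.s. $0$). Semi-Markov beta-Stacy process. For each $i\in E$ let $m^i$ be a measure on $E$ with $0<m^i(E)<\infty$ and $m^i(\{i\})=0$, let $c^i(t)>0$ for all integers $t>0$, and let $F_0^i$ be a distribution with support on the positive integers; put $\mathbf{m}=(m^i)_{i\in E}$, $\mathbf{c}=(c^i)_{i\in E}$, $\mathbf{F_0}=(F_0^i)_{i\in E}$. A random characteristic couple satisfies $(\mathbf{P},\mathbf{F})\sim SMBS(\mathbf{m},\mathbf{c},\mathbf{F_0})$ if: $\mathbf{P}$ and $\mathbf{F}$ are independent; the rows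 $P^i$, $i\in E$, are independent; the $F^i$, $i\in E$, are independent; $P^i\sim Dir(m^i)$ for all $i$; and $F^i\sim BS(c^i,F_0^i)$ for all $i$. Path statistics of $S_{0:t}$. $l(t)=\max\{k\in\{0,\dots,t\}:S_t=S_{t-1}=\cdots=S_{t-k}\}$. For $i\ne j$, $M^{i,j}(t)=\sum_{k=1}^tI\{S_{k-1}=i,S_k=j\}$. $N^{i,t}(l)=\sum_{k=0}^{N(t)-1}I\{T_k\le l,L_k=i\}$ is the number of completed (uncensored) visits to $i$ in $S_{0:t}$ of length at most $l$; as a measure, $N^{i,t}(A)$ is the number of completed visits to $i$ in $S_{0:t}$ with length in $A$. The path $i_{0:t}\in E^{t+1}$ is one for which $\{S_{0:t}=i_{0:t}\}$ has positive probability. *)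

(* Defs.v *)
From HB Require Import structures.
From mathcomp Require Import all_boot all_order all_algebra.
From mathcomp Require Import all_classical all_reals all_analysis.
From mathcomp Require Import measurable_realfun.

Set Implicit Arguments.
Unset Strict Implicit.
Unset Printing Implicit Defensive.

Import Order.TTheory GRing.Theory Num.Theory.
Import numFieldNormedType.Exports.

Local Open Scope classical_set_scope.
Local Open Scope ring_scope.

Section independence.
Context d (Omega : measurableType d) (R : realType).
Variable Pr : probability Omega R.

Definition independent (G H : set (set Omega)) :=
  forall A B, G A -> H B -> Pr (A `&` B) = (Pr A * Pr B)%E.

Definition mutually_independent (I : eqType) (D : set I)
    (G : I -> set (set Omega)) :=
  forall (s : seq I) (A : I -> set Omega), uniq s -> [set` s] `<=` D ->
    (forall i, i \in s -> G i (A i)) ->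
    Pr (\bigcap_(i in [set` s]) A i) = (\prod_(i <- s) fine (Pr (A i)))%:E.

Definition sigma_var d' (Y : measurableType d') (X : Omega -> Y) :
  set (set Omega) := [set X @^-1` B | B in measurable].

(* A random probability measure is a probability kernel [k] from [Omega]; the
   sigma-algebra it generates is the one of all the variables [k ^~ A]. *)
Definition sigma_kernel d' (Y : measurableType d') (k : R.-pker Omega ~> Y) :
    set (set Omega) :=
  <<s \bigcup_(A in measurable) sigma_var (k ^~ A) >>.

Definition sigma_kernels (I : Type) d' (Y : measurableType d')
    (k : I -> R.-pker Omega ~> Y) : set (set Omega) :=
  <<s \bigcup_i sigma_kernel (k i) >>.

End independence.

Section laws.
Context (R : realType).
Let leb := @lebesgue_measure R.

Definition density_law (D : set R) (f : R -> R) (A : set R) : \bar R :=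
  ((\int[leb]_(x in A `&` D) f x) / (\int[leb]_(x in D) f x))%:E.

Definition beta_law (a b : R) : set R -> \bar R :=
  if a == 0 then \d_(0 : R)
  else density_law `]0, 1[ (fun x => x `^ (a - 1) * (1 - x) `^ (b - 1)).

Definition gamma_law (a : R) : set R -> \bar R :=
  if a == 0 then \d_(0 : R)
  else density_law `]0, +oo[ (fun x => x `^ (a - 1) * expR (- x)).

Definition has_law d (Omega : measurableType d) (Pr : probability Omega R)
    (X : Omega -> R) (mu : set R -> \bar R) :=
  forall B, measurable B -> Pr (X @^-1` B) = mu B.

Context d (Omega : measurableType d) (Pr : probability Omega R).

(* Ferguson's definition: Dirichlet(a_1, ..., a_n), with a_j >= 0 not all zero,
   is the law of (Z_1, ..., Z_n) / (Z_1 + ... + Z_n) for independent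
   Z_j ~ Gamma(a_j, 1), where Gamma(0, 1) is the point mass at 0. *)
Definition has_dirichlet_law n (X : Omega -> n.-tuple R) (a : 'I_n -> R) :=
  exists (d' : measure_display) (Omega' : measurableType d')
         (Pr' : probability Omega' R) (Z : 'I_n -> {RV Pr' >-> R}),
  [/\ mutually_independent Pr' setT (fun j => sigma_var (Z j)),
      forall j, has_law Pr' (Z j) (gamma_law (a j)) &
      forall B : set (n.-tuple R), measurable B ->
        Pr (X @^-1` B) =
        Pr' ((fun w => [tuple Z j w / \sum_(k < n) Z k w | j < n]) @^-1` B)].

Definition dirichlet_process dE (E : measurableType dE)
    (P : R.-pker Omega ~> E) (m : set E -> \bar R) :=
  forall n (A : 'I_n -> set E), (forall j, measurable (A j)) ->
    trivIset setT A -> \bigcup_j A j = setT ->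
    has_dirichlet_law (fun w => [tuple fine (P w (A j)) | j < n])
                      (fun j => fine (m (A j))).

Definition beta_stacy (F : R.-pker Omega ~> nat) (c : nat -> R)
    (F0 : probability nat R) :=
  exists U : nat -> {RV Pr >-> R},
  [/\ mutually_independent Pr [set t | (0 < t)%N] (fun t => sigma_var (U t)),
      forall t, (0 < t)%N ->
        has_law Pr (U t) (beta_law (c t * fine (F0 [set t]))
                                   (c t * fine (F0 [set k | (t < k)%N]))) &
      {ae Pr, forall w, forall t,
        F w [set k | (t < k)%N] = (\prod_(1 <= k < t.+1) (1 - U k w))%:E}].

End laws.

Section smbs.
Context (R : realType) dE (E : measurableType dE).

Definition smbs_params (m : E -> {measure set E -> \bar R}) (c : E -> nat -> R)
    (F0 : E -> probability nat R) :=
  forall i,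
  [/\ (0 < m i setT < +oo)%E /\ m i [set i] = 0%E,
      forall t, (0 < t)%N -> 0 < c i t,
      F0 i [set 0%N] = 0%E &
      forall t, (0 < F0 i [set k | (t < k)%N])%E].

Context d (Omega : measurableType d) (Pr : probability Omega R).
Variables (P : E -> R.-pker Omega ~> E) (F : E -> R.-pker Omega ~> nat).

Definition characteristic_couple :=
  forall w i, P i w [set i] = 0%E /\ F i w [set 0%N] = 0%E.

Definition smbs (m : E -> {measure set E -> \bar R}) (c : E -> nat -> R)
    (F0 : E -> probability nat R) :=
  [/\ characteristic_couple,
      independent Pr (sigma_kernels P) (sigma_kernels F),
      mutually_independent Pr setT (fun i => sigma_kernel (P i)) /\
      mutually_independent Pr setT (fun i => sigma_kernel (F i)),
      forall i, dirichlet_process Pr (P i) (m i) &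
      forall i, beta_stacy Pr (F i) (c i) (F0 i)].

(* sigma-algebra of L_{0:n}, T_{0:n-1} and (P, F) *)
Definition renewal_history (L : nat -> Omega -> E) (T : nat -> Omega -> nat)
    (n : nat) : set (set Omega) :=
  <<s (\bigcup_(k in [set k | (k <= n)%N]) sigma_var (L k))
      `|` (\bigcup_(k in [set k | (k < n)%N]) sigma_var (T k))
      `|` (sigma_kernels P `|` sigma_kernels F) >>.

(* The second clause is the defining property of the conditional probability
   of {L_{n+1} = j, T_n <= t} given L_{0:n}, T_{0:n-1} and (P, F), on L_n = i.
   As it is restricted to t >= 1, it does not exclude T_n = 0 by itself. *)
Definition markov_renewal (l0 : E) (L : nat -> Omega -> E)
    (T : nat -> Omega -> nat) :=
  {ae Pr, forall w, L 0%N w = l0 /\ forall n, (0 < T n w)%N} /\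
  forall n t (i j : E) C, (0 < t)%N -> renewal_history L T n C ->
    Pr (C `&` [set w | L n w = i] `&`
        [set w | L n.+1 w = j /\ (T n w <= t)%N]) =
    (\int[Pr]_(w in C `&` [set w | L n w = i])
       (F i w [set k | (k <= t)%N] * P i w [set j]))%E.

End smbs.

Section semi_markov.
Local Open Scope nat_scope.
Context (E : eqType).
Implicit Types (l : nat -> E) (T : nat -> nat).

Definition renewal_time T n := \sum_(h < n) T h.

(* The index set is finite as soon as all the [T h] are positive; the sum has
   the junk value 0 if it is infinite. *)
Definition renewal_count T t :=
  \big[addn/0]_(n \in [set n | 0 < n]) (renewal_time T n <= t : nat).

Definition semi_markov l T t := l (renewal_count T t).

(* Statistics of a path x_{0:t}; only the values [x s] with s <= t matter. *)
Implicit Types x : nat -> E.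

Definition sojourn x t :=
  \max_(k < t.+1 | [forall h : 'I_t.+1, (h <= k) ==> (x (t - h) == x t)]) k.

Definition transitions x t i j :=
  \sum_(1 <= k < t.+1) ((x k.-1 == i) && (x k == j)).

(* A completed visit to i ends at some s <= t with x_{s-1} = i <> x_s, and it
   has lasted l(s-1) + 1 time units.  Lemma [completed_visitsE] below relates
   this to the sum over the renewals completed by time t. *)
Definition completed_visits x t i (A : set nat) :=
  \sum_(1 <= s < t.+1)
     [&& x s.-1 == i, x s != i & (sojourn x s.-1).+1 \in A].

Lemma renewal_timeS T n : renewal_time T n.+1 = renewal_time T n + T n.
Proof. by rewrite /renewal_time big_ord_recr. Qed.

Lemma leq_renewal_time T m n : m <= n -> renewal_time T m <= renewal_time T n.
Proof.
elim: n => [|n IHn]; first by rewrite leqn0 => /eqP ->.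
rewrite leq_eqVlt => /predU1P[-> //|/IHn le_mn].
by rewrite renewal_timeS (leq_trans le_mn) ?leq_addr.
Qed.

Lemma renewal_countE T t n :
  renewal_time T n <= t < renewal_time T n.+1 -> renewal_count T t = n.
Proof.
move=> /andP[le_nt lt_tn]; rewrite /renewal_count.
have le_mt m : (renewal_time T m <= t) = (m <= n).
  case: (leqP m n) => [/(leq_renewal_time T)/leq_trans -> //|lt_nm].
  by apply/negbTE; rewrite -ltnNge (leq_trans lt_tn)// leq_renewal_time.
rewrite (fsbigE (iota 1 n)) ?iota_uniq //.
- rewrite big_mkcond /=; transitivity (\sum_(m <- iota 1 n) 1).
    apply: eq_big_seq => m; rewrite mem_iota add1n ltnS => /andP[m0 mn].
    by rewrite mem_set // le_mt mn.
  by rewrite big_const_seq count_predT size_iota iter_addn_0 mul1n.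
- by move=> m /=; rewrite mem_iota => /andP[].
- move=> m /= m0; rewrite mem_iota m0 add1n ltnS /= => nmn.
  by rewrite le_mt (negbTE nmn).
Qed.

Lemma renewal_count_oo T t :
  (forall n, renewal_time T n <= t) -> renewal_count T t = 0.
Proof.
move=> le_t; rewrite /renewal_count fsbig_dflt // => fin.
have := infinite_nat; apply; have -> : [set: nat] = [set 0] `|` [set n | 0 < n].
  by apply/seteqP; split => // -[|n] _ /=; [left|right].
rewrite finite_setU; split; first exact: finite_set1.
rewrite [X in finite_set X](_ : _ = [set n | 0 < n] `&`
  (fun n => (renewal_time T n <= t : nat)) @^-1` [set~ 0]) //.
by apply/seteqP; split => n /= => [n0|[]//]; split => //; rewrite le_t.
Qed.

Lemma renewal_countP T t :
  (exists n, renewal_time T n <= t < renewal_time T n.+1) \/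
  (forall n, renewal_time T n <= t).
Proof.
have [[n lt_tn]|nlt] := pselect (exists n, t < renewal_time T n); last first.
  by right => n; rewrite leqNgt; apply/negP => lt_tn; apply: nlt; exists n.
left; have ex : exists n, t < renewal_time T n by exists n.
case: (ex_minnP ex) => -[|m] lt_tm min_m.
  by rewrite /renewal_time big_ord0 in lt_tm.
exists m; rewrite lt_tm andbT leqNgt; apply/negP => /min_m.
by rewrite ltnn.
Qed.

Section path_of_renewal.
Variables (l : nat -> E) (T : nat -> nat).
Hypothesis T_gt0 : forall n, 0 < T n.
Hypothesis l_neq : forall n, l n.+1 != l n.

Let x := semi_markov l T.
Let tau := renewal_time T.

Let tau_ge n : n <= tau n.
Proof.
elim: n => [//|n IHn]; rewrite /tau renewal_timeS -addn1.
by rewrite leq_add // T_gt0.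
Qed.

Let count_spec t : tau (renewal_count T t) <= t < tau (renewal_count T t).+1.
Proof.
have [[n ht]|/(_ t.+1)] := renewal_countP T t.
  by rewrite (renewal_countE ht).
by move=> /(leq_trans (tau_ge t.+1)); rewrite ltnn.
Qed.

Lemma sojourn_semi_markov t : sojourn x t = t - tau (renewal_count T t).
Proof.
set n := renewal_count T t; have /andP[le_nt lt_tn] := count_spec t.
have x_run h : h <= t - tau n -> x (t - h) = l n.
  move=> le_h; rewrite /x /semi_markov (@renewal_countE T _ n) //.
  rewrite -/(tau n) -/(tau n.+1) leq_subCr //; last first.
    by rewrite (leq_trans le_h) ?leq_subr.
  by rewrite le_h /= (leq_ltn_trans (leq_subr _ _)).
have xt : x t = l n by have := x_run 0 isT; rewrite subn0.
have lt_k : t - tau n < t.+1 by rewrite ltnS leq_subr.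
apply/eqP; rewrite eqn_leq; apply/andP; split; last first.
  apply: (leq_bigmax_cond (Ordinal lt_k)) => /=; apply/forallP => h.
  by apply/implyP => le_h; rewrite x_run // -[t in x t]subn0 x_run.
apply/bigop.bigmax_leqP => k /forallP run_k; rewrite leqNgt; apply/negP => lt_nk.
case n_eq : n => [|n'].
  move: lt_nk; rewrite n_eq /tau /renewal_time big_ord0 subn0.
  by rewrite ltnNge -ltnS ltn_ord.
have tau_gt0 : 0 < tau n by rewrite (leq_trans _ (tau_ge n)) // n_eq.
have lt_h : (t - tau n).+1 < t.+1.
  by rewrite ltnS ltn_subrL tau_gt0 (leq_trans tau_gt0).
have := run_k (Ordinal lt_h); rewrite /= lt_nk /= subnS subKn //.
rewrite xt n_eq.
rewrite /x /semi_markov (@renewal_countE T _ n').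
  by rewrite eq_sym (negbTE (l_neq n')).
rewrite n_eq in tau_gt0 *; rewrite -!/(tau _) prednK // leqnn andbT.
rewrite -ltnS prednK // /tau renewal_timeS -[X in X < _]addn0 ltn_add2l.
exact: T_gt0.
Qed.

Lemma completed_visitsE t i (A : set nat) :
  completed_visits x t i A =
  \sum_(k < renewal_count T t) ((T k \in A) && (l k == i)).
Proof.
elim: t => [|t IHt].
  rewrite /completed_visits big_geq // (@renewal_countE _ _ 0) ?big_ord0 //.
  by rewrite renewal_timeS /renewal_time big_ord0 T_gt0.
rewrite /completed_visits big_nat_recr //= -/(completed_visits x t i A) IHt.
have := count_spec t; rewrite sojourn_semi_markov /x /semi_markov.
set n := renewal_count T t => /andP[le_nt lt_tn].
have [lt_tn'|le_nt'] := ltnP t.+1 (tau n.+1).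
  rewrite (@renewal_countE T t.+1 n) ?lt_tn' ?(leq_trans le_nt) //.
  by rewrite andbA andbN addn0.
have tauS : tau n.+1 = t.+1 by apply/eqP; rewrite eqn_leq le_nt' lt_tn.
rewrite (@renewal_countE T t.+1 n.+1); last first.
  rewrite -!/(tau _) tauS leqnn /= -tauS /tau (renewal_timeS _ n.+1).
  by rewrite -[X in X < _]addn0 ltn_add2l.
rewrite big_ord_recr /= -subSn // -tauS /tau renewal_timeS addKn.
congr (_ + nat_of_bool _); rewrite [RHS]andbC.
by case: eqP => //= <-; rewrite l_neq.
Qed.

End path_of_renewal.
End semi_markov.

Section posterior.
Context (R : realType) dE (E : measurableType dE).
Context d (Omega : measurableType d) (Pr : probability Omega R).

Definition path_event (L : nat -> Omega -> E) (T : nat -> Omega -> nat)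
    (t : nat) (x : nat -> E) : set Omega :=
  [set w | forall s, (s <= t)%N -> semi_markov (L ^~ w) (T ^~ w) s = x s].

Lemma measurable_path_event (E_discrete : forall A : set E, measurable A)
    (L : nat -> {RV Pr >-> E}) (T : nat -> {RV Pr >-> nat}) t x :
  measurable (path_event L T t x).
Proof.
have mtau n (B : set nat) :
    measurable [set w | B (renewal_time (T ^~ w) n)].
  suff : measurable_fun setT (fun w => renewal_time (T ^~ w) n).
    by move=> /(_ measurableT B I); rewrite setTI.
  rewrite /renewal_time; elim: n => [|n IHn].
    by under eq_fun do rewrite big_ord0; exact: measurable_cst.
  under eq_fun do rewrite big_ord_recr /=.
  move=> _ C _; rewrite setTI.
  rewrite [X in measurable X](_ : _ = \bigcup_k
    ([set w | \sum_(h < n) T h w = k]%N `&` [set w | C (k + T n w)%N])).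
    apply: bigcupT_measurable => k; apply: measurableI.
      by have := IHn measurableT [set k] I; rewrite setTI.
    exact: (@measurable_funPTI _ _ _ _ (T n) [set m | C (k + m)%N]).
  by apply/seteqP; split => w /= => [Cw|[k _ [/= ->]] //];
    exists (\sum_(h < n) T h w)%N.
have mcount s n : measurable [set w | renewal_count (T ^~ w) s = n].
  pose B m := [set w |
    (renewal_time (T ^~ w) m <= s < renewal_time (T ^~ w) m.+1)%N].
  pose Boo := \bigcap_m [set w | (renewal_time (T ^~ w) m <= s)%N].
  have mB m : measurable (B m).
    rewrite /B [X in measurable X](_ : _ =
      [set w | (renewal_time (T ^~ w) m <= s)%N] `&`
      [set w | (s < renewal_time (T ^~ w) m.+1)%N]).
      apply: measurableI; first exact: (mtau m [set k | (k <= s)%N]).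
      exact: (mtau m.+1 [set k | (s < k)%N]).
    by apply/seteqP; split => w /= => [/andP[]|[-> ->]].
  have mBoo : measurable Boo.
    by apply: bigcapT_measurable => m; exact: (mtau m [set k | (k <= s)%N]).
  rewrite [X in measurable X](_ : _ = B n `|` (if n == 0%N then Boo else set0)).
    by apply: measurableU => //; case: ifP.
  apply/seteqP; split => w /=.
    have [[m Bm]|oo] := renewal_countP (T ^~ w) s.
      by rewrite (renewal_countE Bm) => <-; left.
    by rewrite (renewal_count_oo oo) => <-; right => m _ /=; exact: oo.
  move=> [/renewal_countE //|]; case: eqP => // -> oo.
  by apply: renewal_count_oo => m; exact: oo.
rewrite /path_event [X in measurable X](_ : _ =
  \bigcap_(s in [set s | (s <= t)%N]) \bigcup_n
    ([set w | renewal_count (T ^~ w) s = n] `&` L n @^-1` [set x s])).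
  apply: bigcap_measurableType => s _; apply: bigcupT_measurable => n.
  by apply: measurableI => //; exact: measurable_funPTI.
apply/seteqP; split => w /= Hw s st.
  by exists (renewal_count (T ^~ w) s) => //; split => //=; exact: Hw.
by have [n _ [/= <- <-]] := Hw s st.
Qed.

Definition cond_prob (B : set Omega) (mB : measurable B) : probability Omega R :=
  mnormalize (mrestr Pr mB) Pr.

Variables (m : E -> {measure set E -> \bar R}) (c : E -> nat -> R)
  (F0 : E -> probability nat R) (t : nat) (x : nat -> E).

(* I{l(t) >= s} for the state occupied at time t, 0 for the other states *)
Definition censored (i : E) (s : nat) : bool :=
  (i == x t) && (s <= sojourn x t)%N.

Definition updated_mass (ms : E -> {measure set E -> \bar R}) :=
  forall i, ms i [set i] = 0%E /\
  forall j, j != i ->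
    ms i [set j] = (m i [set j] + (transitions x t i j)%:R%:E)%E.

Definition updated_hazard (i : E) (s : nat) : R :=
  (c i s * fine (F0 i [set s]) + (completed_visits x t i [set s])%:R) /
  (c i s * fine (F0 i [set k | (s <= k)%N])
   + (completed_visits x t i [set k | (s <= k)%N])%:R + (censored i s)%:R).

Definition updated_distribution (Fs : E -> probability nat R) :=
  forall i u, (0 < u)%N ->
    Fs i [set k | (u < k)%N] =
    (\prod_(1 <= s < u.+1) (1 - updated_hazard i s))%:E.

Definition updated_precision (Fs : E -> probability nat R) (cs : E -> nat -> R) :=
  forall i u, (0 < u)%N ->
    cs i u = (c i u * fine (F0 i [set k | (u < k)%N])
              + (completed_visits x t i [set k | (u < k)%N])%:R
              + (censored i u)%:R) / fine (Fs i [set k | (u < k)%N]).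

End posterior.

(* Main.v *)
(* The posterior is updated one time step at a time.  Given the path up to time
   t, in state i for l + 1 time units, the conditional probability of the next
   state under (P, F) is 1 - U if the process stays in i and U * P^i({j}) if it
   jumps to j, where U is the (l+1)-st beta factor of F^i (its discrete hazard).
   So the posterior at t + 1 is the one at t reweighted by this function.
   Reweighting by a function of one member of an independent family keeps the
   family independent and changes the law of that member only.  The weight U
   turns Beta(a, b) into Beta(a + 1, b), the weight 1 - U turns it into
   Beta(a, b + 1), and the weight P^i({j}) turns Dir(m) into Dir(m + delta_j):
   for Z_k independent Gamma variables with sum S, Z / S is independent of S, so
   that reweighting by Z_j / S and by Z_j change the law of Z / S in the same
   way, and the latter replaces Gamma(a_j) by Gamma(a_j + 1). *)
From HB Require Import structures.
Require Import Defs.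
From mathcomp Require Import all_boot all_order all_algebra.
From mathcomp Require Import all_classical all_reals all_analysis.
From mathcomp Require Import measurable_realfun ring lra zify.
Set Implicit Arguments.
Unset Strict Implicit.
Unset Printing Implicit Defensive.
Import Order.TTheory GRing.Theory Num.Theory.
Import numFieldNormedType.Exports.
Local Open Scope classical_set_scope.
Local Open Scope ring_scope.

(** * Reweighted probability measures *)

(** Only proportionality is ever used: [reweighted] carries an unspecified positive constant, and
    finiteness of the normalising integrals is deduced from the laws being probabilities, so no beta
    or gamma function is evaluated. The one-step weight is a conditional probability given the path
    and the couple, so it relates successive posteriors on events about the couple only; hence the
    class of sets in [reweighted]. The defining clause of the process conditions on completed
    renewals, so the path event is separated into a [record_event], which belongs to the renewal
    history, and the censoring of the sojourn in progress, which integrates to a tail of F^i. A jump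
    has a product of two weights and is treated as two reweightings through an intermediate
    probability. The Dirichlet property concerns all partitions, whereas the weight is the mass of
    one state: the partition is refined by that state, and after the update the two pieces are
    merged by additivity of gamma variables. The product defining F_* is a survival function only if
    it tends to 0, which has to be proved. *)

Section transfer.
Local Open Scope ereal_scope.
Context (R : realType) d1 (T1 : measurableType d1) d2 (T2 : measurableType d2).
Variables (mu1 : {measure set T1 -> \bar R}) (mu2 : {measure set T2 -> \bar R}).

Import HBNNSimple.

(** The hypothesis says that [g1] under [mu1] on [C1] has the same image measure as [g2] under the
    density [h] on [C2]; the conclusion compares the means. Most integral identities below are
    instances, with [C1], [C2] and [h] chosen so that only probabilities of events need checking. *)
Lemma transfer_integral (C1 : set T1) (C2 : set T2) (g1 : T1 -> R) (g2 h : T2 -> R) :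
  measurable C1 -> measurable C2 ->
  measurable_fun setT g1 -> measurable_fun setT g2 -> measurable_fun setT h ->
  (forall w, C1 w -> 0 <= g1 w)%R -> (forall w, C2 w -> 0 <= g2 w)%R ->
  (forall w, C2 w -> 0 <= h w)%R ->
  (forall B, measurable B ->
    mu1 (C1 `&` g1 @^-1` B) = \int[mu2]_(w in C2 `&` g2 @^-1` B) (h w)%:E) ->
  \int[mu1]_(w in C1) (g1 w)%:E = \int[mu2]_(w in C2) (g2 w * h w)%:E.
Proof.
move=> mC1 mC2 mg1 mg2 mh g1_ge0 g2_ge0 h_ge0 gh.
have mD : measurable (`[0%R, +oo[%classic : set R) by exact: measurable_itv.
have mE : measurable_fun (`[0%R, +oo[%classic : set R) (EFin : R -> \bar R).
  by apply/measurable_EFinP; exact: measurable_id.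
(* Simple functions increasing to the identity of the half-line: composed with [g1] and with [g2],
   one sequence approximates both integrands. *)
pose f_ := nnsfun_approx mD mE.
have f_cvg y : (0 <= y)%R -> (f_ n y)%:E @[n --> \oo] --> y%:E.
  move=> y0; apply: cvg_nnsfun_approx => [z /=|/=]; last by rewrite in_itv /= y0.
  by rewrite in_itv /= andbT lee_fin.
have mpre (d : measure_display) (T : measurableType d) (g : T -> R) (A : set R) :
    measurable A -> measurable_fun setT g -> measurable (g @^-1` A).
  by move=> mA mg; rewrite -[X in measurable X]setTI; exact: mg.
have mfa n a : measurable (f_ n @^-1` [set a]).
  by rewrite -[X in measurable X]setTI; exact: measurable_funP.
have mfg n (d : measure_display) (T : measurableType d) (g : T -> R) :
    measurable_fun setT g -> measurable_fun setT (f_ n \o g).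
  by move=> mg; apply: measurableT_comp.
transitivity (limn (fun n => \int[mu1]_(w in C1) (f_ n (g1 w))%:E)).
  rewrite -monotone_convergence//.
  - apply: eq_integral => w /[!inE] wC; apply/esym/cvg_lim => //.
    by apply: f_cvg; exact: g1_ge0.
  - by move=> n; apply/measurable_EFinP/measurable_funTS; exact: mfg.
  - by move=> n w _; rewrite lee_fin.
  - by move=> w _ n p np; rewrite lee_fin; exact/lefP/nd_nnsfun_approx.
transitivity (limn (fun n => \int[mu2]_(w in C2) (f_ n (g2 w) * h w)%:E)); last first.
  rewrite -monotone_convergence//.
  - apply: eq_integral => w /[!inE] wC; apply/cvg_lim => //.
    under eq_fun do rewrite EFinM.
    by rewrite EFinM; apply: cvgeZr => //; apply: f_cvg; exact: g2_ge0.
  - move=> n; apply/measurable_EFinP/measurable_funM; apply: measurable_funTS => //.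
    exact: mfg.
  - by move=> n w wC; rewrite lee_fin mulr_ge0//; exact: h_ge0.
  - move=> w wC n p np; rewrite lee_fin ler_wpM2r//; first exact: h_ge0.
    exact/lefP/nd_nnsfun_approx.
congr (limn _); apply/funext => n.
have fE y : f_ n y = (\sum_(a \in range (f_ n)) (a * \1_(f_ n @^-1` [set a]) y))%R.
  exact: fimfunE.
have fEE y : (f_ n y)%:E = \sum_(a \in range (f_ n)) (a * \1_(f_ n @^-1` [set a]) y)%:E.
  by rewrite fsumEFin// -fE.
under eq_integral do rewrite fEE.
have ige0 a y : (0 <= a * \1_(f_ n @^-1` [set a]) y)%R.
  have [ya|ya] := pselect (f_ n y = a).
    by rewrite mulr_ge0// -ya.
  by rewrite indicE memNset// mulr0.
rewrite ge0_integral_fsum//; last 2 first.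
- move=> a; apply/measurable_EFinP/measurable_funM => //; apply: measurable_funTS.
  exact: (@measurable_indic _ _ _ _ (_ @^-1` (f_ n @^-1` [set a])) (mpre _ _ _ _ _ _)).
- by move=> a w _; rewrite lee_fin.
transitivity (\int[mu2]_(w in C2) \sum_(a \in range (f_ n))
     (a * \1_(f_ n @^-1` [set a]) (g2 w) * h w)%:E); last first.
  apply: eq_integral => w _; rewrite fsumEFin// fE; congr (_%:E).
  by rewrite !fsbig_finite//= mulr_suml.
rewrite ge0_integral_fsum//; last 2 first.
- move=> a; apply/measurable_EFinP/measurable_funM; apply: measurable_funTS => //.
  apply: measurable_funM => //.
  exact: (@measurable_indic _ _ _ _ (_ @^-1` (f_ n @^-1` [set a])) (mpre _ _ _ _ _ _)).
- by move=> a w wC; rewrite lee_fin mulr_ge0//; exact: h_ge0.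
apply: eq_fsbigr => a /[!inE] -[y _ ya].
have a0 : (0 <= a)%R by rewrite -ya.
transitivity (a%:E * \int[mu1]_(w in C1) (\1_(g1 @^-1` (f_ n @^-1` [set a])) w)%:E).
  rewrite -ge0_integralZl_EFin//.
  - apply/measurable_EFinP/measurable_funTS/measurable_indic.
    exact: mpre.
transitivity (a%:E * \int[mu2]_(w in C2)
    ((\1_(g2 @^-1` (f_ n @^-1` [set a])) w) * h w)%:E); last first.
  rewrite -ge0_integralZl_EFin//.
  - by apply: eq_integral => w wC; rewrite -EFinM mulrA.
  - by move=> w wC; rewrite lee_fin mulr_ge0//; exact: h_ge0.
  - apply/measurable_EFinP/measurable_funM; apply: measurable_funTS => //.
    by apply/measurable_indic; exact: mpre.
congr (_ * _).
(* The hypothesis [gh] enters here, applied to the level set of [f_ n] at [a]. *)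
rewrite integral_indic//; last exact: mpre.
rewrite setIC gh// integral_mkcondr.
apply: eq_integral => w _; rewrite patchE indicE.
by case: ifPn; rewrite ?mul1r// mul0r.
Qed.
End transfer.

Section weighted_measure.
Local Open Scope ereal_scope.
Context (R : realType) d (T : measurableType d).
Variables (mu : {measure set T -> \bar R}) (g : T -> R).
Hypotheses (mg : measurable_fun setT g) (g_ge0 : forall w, (0 <= g w)%R).

(** Measurability and positivity are arguments of the definition so that the canonical measure
    instance can be found from the term alone. *)
Definition weighted (_ : measurable_fun setT g) (_ : forall w, (0 <= g w)%R)
    (A : set T) := \int[mu]_(w in A) (g w)%:E.

Let weighted0 : weighted mg g_ge0 set0 = 0.
Proof. exact: integral_set0. Qed.

Let weighted_ge0 A : 0 <= weighted mg g_ge0 A.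
Proof. by apply: integral_ge0 => w _; rewrite lee_fin. Qed.

Let weighted_sigma_additive : semi_sigma_additive (weighted mg g_ge0).
Proof.
move=> A mA tA mUA; rewrite /weighted ge0_integral_bigcup//.
- by apply: is_cvg_ereal_nneg_natsum => n _; exact: weighted_ge0.
- exact/measurable_EFinP/measurable_funTS.
- by move=> w _; rewrite lee_fin.
Qed.

HB.instance Definition _ := isMeasure.Build _ _ _ (weighted mg g_ge0)
  weighted0 weighted_ge0 weighted_sigma_additive.

End weighted_measure.

Section reweighting.
Local Open Scope ereal_scope.
Context (R : realType) d (Omega : measurableType d).
Implicit Types (Q : probability Omega R) (H : set (set Omega)) (g : Omega -> R).

Lemma mule_pinjl (z : R) (x y : \bar R) :
  (0 < z)%R -> z%:E * x = z%:E * y -> x = y.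
Proof.
move=> z_gt0 xy; rewrite -[x]mul1e -[y]mul1e -(@mulVf _ z) ?gt_eqF//.
by rewrite EFinM -!muleA xy.
Qed.

(** Bayes' rule with a free normalising constant. The class [H] is a parameter because a posterior
    has a known density only on events about the couple (P, F). *)
Definition reweighted Q1 Q2 H g :=
  exists2 z : R, (0 < z)%R &
    forall C, H C -> z%:E * Q2 C = \int[Q1]_(w in C) (g w)%:E.

Lemma reweighted_sub Q1 Q2 H1 H2 g : H2 `<=` H1 ->
  reweighted Q1 Q2 H1 g -> reweighted Q1 Q2 H2 g.
Proof. by move=> H12 [z z0 zQ]; exists z => // C /H12; exact: zQ. Qed.

Lemma reweighted_exists Q g :
  measurable_fun setT g -> (forall w, 0 <= g w)%R ->
  0 < \int[Q]_w (g w)%:E < +oo -> exists Q', reweighted Q Q' measurable g.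
Proof.
move=> mg g_ge0 /andP[Ig_gt0 Ig_lty].
have Ig_fin : \int[Q]_w (g w)%:E \is a fin_num by rewrite ge0_fin_numE// ltW.
exists (mnormalize (weighted Q mg g_ge0) Q).
exists (fine (\int[Q]_w (g w)%:E)); first by rewrite fine_gt0// Ig_gt0.
move=> C mC; rewrite /= /mnormalize /weighted gt_eqF//= lt_eqF// fineK//.
rewrite muleC -muleA -[X in _ * X]muleC -{1}(fineK Ig_fin) -EFinM divff ?mule1//.
by rewrite gt_eqF// fine_gt0// Ig_gt0.
Qed.

Lemma integral_indep Q (A C : set Omega) g :
  measurable A -> measurable C -> measurable_fun setT g ->
  (forall w, 0 <= g w)%R ->
  (forall B, measurable B ->
    Q (A `&` (C `&` g @^-1` B)) = Q A * Q (C `&` g @^-1` B)) ->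
  \int[Q]_(w in A `&` C) (g w)%:E = Q A * \int[Q]_(w in C) (g w)%:E.
Proof.
move=> mA mC mg g_ge0 AC.
have mgB B : measurable B -> measurable (g @^-1` B).
  by move=> mB; rewrite -[X in measurable X]setTI; exact: mg.
rewrite (@transfer_integral _ _ _ _ _ Q Q _ C g g (cst (fine (Q A))))//; last 3 first.
- exact: measurableI.
- by move=> w _; rewrite fine_ge0.
- move=> B mB; rewrite -setIA; have mCB : measurable (C `&` g @^-1` B).
    by apply: measurableI => //; exact: mgB.
  have := integral_cst Q mCB (fine (Q A))%:E; rewrite /cst => ->.
  by rewrite fineK ?fin_num_measure//; exact: AC.
rewrite -[in RHS](@fineK _ (Q A)) ?fin_num_measure// -ge0_integralZl_EFin//.
- by apply: eq_integral => w _; rewrite mulrC.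
- by move=> w _; rewrite lee_fin.
- exact/measurable_EFinP/measurable_funTS.
- by rewrite fine_ge0.
Qed.

Lemma independent_sym Q G H : independent Q G H -> independent Q H G.
Proof. by move=> GH A B HA GB; rewrite setIC GH// muleC. Qed.

Lemma independent_eq Q1 Q2 G1 G2 : (forall A, G1 A -> Q1 A = Q2 A) ->
  (forall A, G2 A -> Q1 A = Q2 A) ->
  (forall A B, G1 A -> G2 B -> Q1 (A `&` B) = Q2 (A `&` B)) ->
  independent Q1 G1 G2 -> independent Q2 G1 G2.
Proof. by move=> eq1 eq2 eq12 GG A B GA GB; rewrite -eq12// -eq1// -eq2// GG. Qed.

Section independent.
Variables (Q1 Q2 : probability Omega R) (G1 G2 H : set (set Omega)) (g : Omega -> R).
Hypotheses (mG1 : G1 `<=` measurable) (mG2 : G2 `<=` measurable).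
Hypotheses (G1T : G1 setT) (G2T : G2 setT).
Hypothesis H12 : forall A B, G1 A -> G2 B -> H (A `&` B).
Hypotheses (mg : measurable_fun setT g) (g_ge0 : forall w, (0 <= g w)%R).
Hypothesis gG1 : forall A B, G1 A -> measurable B -> G1 (A `&` g @^-1` B).
Hypothesis Q12 : reweighted Q1 Q2 H g.
Hypothesis G12 : independent Q1 G1 G2.

(** By [gG1] the weight belongs to the [G1] side, so its integral over [A] and [B] jointly is [Q1 B]
    times its integral over [A], which is proportional to [Q2 A]. Both the unchanged law on [G2] and
    independence follow. *)
Let reweightedI A B : G1 A -> G2 B -> Q2 (A `&` B) = Q2 A * Q1 B.
Proof.
move=> GA GB; case: Q12 => z z_gt0 Qz.
have HA : H A by rewrite -[A]setIT; exact: H12.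
apply: (mule_pinjl z_gt0).
rewrite muleA !Qz//; last exact: H12.
rewrite setIC integral_indep//; last first.
- by move=> C mC; rewrite setIC G12// 1?muleC//; exact: gG1.
- exact: mG1.
- exact: mG2.
by rewrite muleC.
Qed.

Lemma reweighted_indep_eq B : G2 B -> Q2 B = Q1 B.
Proof. by move=> GB; rewrite -[in LHS](setTI B) reweightedI// probability_setT mul1e. Qed.

Lemma reweighted_independent : independent Q2 G1 G2.
Proof. by move=> A B GA GB; rewrite reweightedI// (reweighted_indep_eq GB). Qed.

End independent.

Lemma bigsetI_closed H (I : eqType) (s : seq I) (A : I -> set Omega) :
  setI_closed H -> H setT -> (forall i, i \in s -> H (A i)) ->
  H (\big[setI/setT]_(i <- s) A i).
Proof.
move=> HI HT; elim: s => [|i s IHs] HA; first by rewrite big_nil.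
rewrite big_cons; apply: HI; first by apply: HA; rewrite mem_head.
by apply: IHs => j js; apply: HA; rewrite inE js orbT.
Qed.

(** A fold over the list can be split and permuted with the lemmas on big operators, unlike the
    intersection indexed by a set. *)
Lemma mutually_independentE Q (I : eqType) (D : set I) (G : I -> set (set Omega)) :
  mutually_independent Q D G <->
  forall (s : seq I) (A : I -> set Omega), uniq s -> [set` s] `<=` D ->
    (forall i, i \in s -> G i (A i)) ->
    Q (\big[setI/setT]_(i <- s) A i) = (\prod_(i <- s) fine (Q (A i)))%:E.
Proof.
have bigE (s : seq I) (A : I -> set Omega) :
    \bigcap_(i in [set` s]) A i = \big[setI/setT]_(i <- s) A i.
  elim: s => [|i s IHs]; first by rewrite big_nil set_nil bigcap_set0.
  rewrite big_cons -IHs -bigcap_setU1; apply: eq_bigcapl.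
  by split=> j /=; rewrite inE => /predU1P.
by split=> GD s A us sD GA; rewrite -GD// bigE.
Qed.

Lemma mutually_independent_eq Q1 Q2 (I : eqType) (D : set I)
    (G : I -> set (set Omega)) H :
  setI_closed H -> H setT -> (forall i, D i -> G i `<=` H) ->
  (forall A, H A -> Q1 A = Q2 A) ->
  mutually_independent Q1 D G -> mutually_independent Q2 D G.
Proof.
move=> HI HT GH eqQ /mutually_independentE GD; apply/mutually_independentE.
move=> s A us sD GA; rewrite -eqQ ?GD//; last first.
  apply: bigsetI_closed => // i si.
  exact: (GH _ (sD _ si) _ (GA _ si)).
congr (_%:E); apply: eq_big_seq => i si; rewrite eqQ//.
by apply: (GH i); [exact: sD|exact: GA].
Qed.

Section mutually_independent.
Variables (Q1 Q2 : probability Omega R) (I : eqType) (D : set I).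
Variables (G : I -> set (set Omega)) (H : set (set Omega)) (g : Omega -> R).
Hypotheses (mH : H `<=` measurable) (HI : setI_closed H) (HT : H setT).
Hypothesis GH : forall i, D i -> G i `<=` H.
Hypotheses (mg : measurable_fun setT g) (g_ge0 : forall w, (0 <= g w)%R).
Variable i0 : I.
Hypotheses (Di0 : D i0) (GT : G i0 setT).
Hypothesis gG : forall A B, G i0 A -> measurable B -> G i0 (A `&` g @^-1` B).
Hypothesis Q12 : reweighted Q1 Q2 H g.
Hypothesis GD : mutually_independent Q1 D G.

(** Only the member [i0] sees the weight: the other factors come out of the integral with their [Q1]
    probabilities, and what remains is proportional to [Q2 B]. *)
Let reweightedI (s : seq I) (A : I -> set Omega) (B : set Omega) :
  uniq s -> i0 \notin s -> [set` s] `<=` D -> (forall i, i \in s -> G i (A i)) ->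
  G i0 B ->
  Q2 ((\big[setI/setT]_(i <- s) A i) `&` B) = (\prod_(i <- s) fine (Q1 (A i)))%:E * Q2 B.
Proof.
move=> us i0s sD GA GB; have := GD; move=> /mutually_independentE GD'.
case: Q12 => z z_gt0 Qz.
have HA : H (\big[setI/setT]_(i <- s) A i).
  by apply: bigsetI_closed => // i si; exact: (GH (sD _ si) (GA _ si)).
have HB : H B by exact: GH GB.
have key C : G i0 C -> Q1 ((\big[setI/setT]_(i <- s) A i) `&` C) =
    (\prod_(i <- s) fine (Q1 (A i)))%:E * Q1 C.
  (* As [i0] is not in [s], the event at [i0] may be chosen freely, and independence is applied to
     [i0 :: s]. *)
  move=> GC; pose A' i := if i == i0 then C else A i.
  have A'E i : i \in s -> A' i = A i.
    by move=> si; rewrite /A'; case: eqP si => // -> si; rewrite si in i0s.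
  have A'0 : A' i0 = C by rewrite /A' eqxx.
  have A'G i : i \in i0 :: s -> G i (A' i).
    rewrite inE => /orP[/eqP ->|si]; first by rewrite A'0.
    by rewrite A'E//; exact: GA.
  have sD' : [set` i0 :: s] `<=` D.
    by move=> i /=; rewrite inE => /orP[/eqP -> //|/sD].
  have /= := GD' (i0 :: s) A' _ sD' A'G; rewrite i0s us !big_cons A'0 => /(_ isT).
  rewrite (eq_big_seq A)// setIC => ->.
  rewrite EFinM fineK ?fin_num_measure//; last by apply: mH; exact: GH GC.
  by rewrite muleC; congr (_%:E * _); apply: eq_big_seq => i si; rewrite A'E.
have QA : Q1 (\big[setI/setT]_(i <- s) A i) = (\prod_(i <- s) fine (Q1 (A i)))%:E.
  exact: GD'.
apply: (mule_pinjl z_gt0).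
rewrite Qz; last exact: HI.
rewrite integral_indep//; last first.
- by move=> C mC; rewrite key ?QA//; exact: gG.
- exact: mH.
- exact: mH.
by rewrite QA -Qz// muleCA.
Qed.

Lemma reweighted_mutually_indep_eq i A : D i -> i != i0 -> G i A -> Q2 A = Q1 A.
Proof.
move=> Di ii0 GA; have := @reweightedI [:: i] (fun=> A) setT.
rewrite !big_seq1 !setIT inE eq_sym ii0 probability_setT mule1 => -> //.
- by rewrite fineK// fin_num_measure//; apply: mH; exact: GH GA.
- by move=> j /=; rewrite inE => /eqP ->.
- by move=> j; rewrite inE => /eqP ->.
Qed.

Lemma reweighted_mutually_independent : mutually_independent Q2 D G.
Proof.
apply/mutually_independentE => s A us sD GA.
have fineQ (r : seq I) : i0 \notin r -> [set` r] `<=` D ->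
    (forall i, i \in r -> G i (A i)) ->
    (\prod_(i <- r) fine (Q1 (A i)) = \prod_(i <- r) fine (Q2 (A i)))%R.
  move=> i0r rD GAr; apply: eq_big_seq => i ir.
  rewrite (@reweighted_mutually_indep_eq i)//; [exact: rD| |exact: GAr].
  by apply: contraNneq i0r => <-.
have [i0s|i0s] := boolP (i0 \in s); last first.
  rewrite -[X in Q2 X]setIT reweightedI// probability_setT mule1.
  by rewrite fineQ.
have ps := perm_to_rem i0s.
have remD i : i \in rem i0 s -> i \in s by exact: mem_rem.
have i0r : i0 \notin rem i0 s by rewrite mem_rem_uniq// !inE eqxx.
rewrite (perm_big _ ps)/= big_cons setIC reweightedI//; first last.
- exact: GA.
- by move=> i /remD; exact: GA.
- by move=> i /remD; exact: sD.
- exact: rem_uniq.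
rewrite (perm_big _ ps)/= big_cons fineQ//.
- rewrite [in RHS]EFinM fineK 1?muleC// fin_num_measure//.
  by apply: mH; apply: (GH Di0); exact: GA.
- by move=> i /remD; exact: sD.
- by move=> i /remD; exact: GA.
Qed.

End mutually_independent.

End reweighting.

(** * Reweighted beta and gamma laws *)

Section laws.
Local Open Scope ereal_scope.
Context (R : realType).
Let leb := @lebesgue_measure R.

Lemma eq_density_law (D : set R) (f f' : R -> R) :
  (forall x, D x -> f x = f' x) -> density_law D f = density_law D f'.
Proof.
move=> ff'; apply/funext => A; rewrite /density_law; congr (_ / _)%:E.
  by apply: eq_Rintegral => x; rewrite inE => -[_ /ff'].
by apply: eq_Rintegral => x; rewrite inE => /ff'.
Qed.

Context d (Omega : measurableType d).
Implicit Types (Q : probability Omega R) (X : Omega -> R).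

Section density.
Variables (D : set R) (f : R -> R).
Hypotheses (mD : measurable D) (mf : measurable_fun setT f).
Hypothesis (f_ge0 : forall x, D x -> (0 <= f x)%R).

(** If the integral of [f] over [D] were zero or infinite, its real value would be 0 and
    [density_law] would give mass 0 to the whole line, which no probability allows. So having such a
    law already provides a finite positive constant [z]. *)
Lemma has_law_density Q X : measurable_fun setT X ->
  has_law Q X (density_law D f) <->
  exists2 z : R, (0 < z)%R & forall B, measurable B ->
    z%:E * Q (X @^-1` B) = \int[leb]_(x in B `&` D) (f x)%:E.
Proof.
move=> mX; split=> [QX|[z z_gt0 QX] B mB]; last first.
  have mXA A : measurable A -> measurable (X @^-1` A).
    by move=> mA; rewrite -[X in measurable X]setTI; exact: mX.
  have zE : \int[leb]_(x in D) (f x)%:E = z%:E.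
    by rewrite -[D]setTI -QX// preimage_setT probability_setT mule1.
  rewrite /density_law /Rintegral zE -QX//=.
  rewrite -(@fineK _ (Q (X @^-1` B))); last by rewrite fin_num_measure//; exact: mXA.
  by rewrite -EFinM/= mulrAC mulfV ?mul1r// gt_eqF.
have I_ge0 : 0 <= \int[leb]_(x in D) (f x)%:E.
  by apply: integral_ge0 => x /f_ge0; rewrite lee_fin.
have : (\int[leb]_(x in D) f x != 0)%R.
  apply/eqP => I0; have := QX setT measurableT.
  rewrite preimage_setT probability_setT /density_law setTI I0 mul0r => /eqP.
  by rewrite eqe oner_eq0.
rewrite /Rintegral; case IE : (\int[leb]_(x in D) (f x)%:E) => [z| |]; rewrite ?eqxx//= => z_neq0.
have z_gt0 : (0 < z)%R by rewrite lt_neqAle eq_sym z_neq0 -lee_fin -IE.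
exists z => // B mB; rewrite QX// /density_law /Rintegral IE/=.
rewrite -EFinM mulrC mulfVK// fineK// ge0_fin_numE.
  rewrite (@le_lt_trans _ _ z%:E) ?ltry// -IE.
  apply: ge0_subset_integral => //; first exact: measurableI.
  exact/measurable_EFinP/measurable_funTS.
by apply: integral_ge0 => x [_ /f_ge0]; rewrite lee_fin.
Qed.

(** Positivity of [phi] is asked both along [X] and on [D], since [X] may leave [D] on a null
    set. *)
Lemma has_law_density_integral Q X (phi : R -> R) (z : R) B :
  measurable_fun setT X -> measurable_fun setT phi ->
  (forall w, 0 <= phi (X w))%R -> (forall x, D x -> 0 <= phi x)%R ->
  (0 < z)%R ->
  (forall B, measurable B -> z%:E * Q (X @^-1` B) = \int[leb]_(x in B `&` D) (f x)%:E) ->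
  measurable B ->
  z%:E * \int[Q]_(w in X @^-1` B) (phi (X w))%:E =
  \int[leb]_(x in B `&` D) (f x * phi x)%:E.
Proof.
move=> mX mphi phiX_ge0 phi_ge0 z_gt0 QX mB.
have mXA A : measurable A -> measurable (X @^-1` A).
  by move=> mA; rewrite -[X in measurable X]setTI; exact: mX.
have mphiB B' : measurable B' -> measurable (phi @^-1` B').
  by move=> mB'; rewrite -[X in measurable X]setTI; exact: mphi.
have mBD : measurable (B `&` D) by exact: measurableI.
have mfz : measurable_fun setT (fun x => f x / z)%R by exact: measurable_funM.
have fz_ge0 x : (B `&` D) x -> (0 <= f x / z)%R.
  by move=> [_ Dx]; rewrite divr_ge0 ?f_ge0// ltW.
rewrite (@transfer_integral _ _ _ _ _ Q leb _ _ _ _ _ (mXA _ mB) mBD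
  (measurableT_comp mphi mX) mphi mfz).
- rewrite -ge0_integralZl_EFin//.
  + apply: eq_integral => x _.
    by rewrite -EFinM; congr (_%:E); field; rewrite gt_eqF.
  + by move=> x BDx; rewrite lee_fin mulr_ge0 ?fz_ge0 ?phi_ge0//; case: BDx.
  + by apply/measurable_EFinP/measurable_funTS; exact: measurable_funM.
  + exact: ltW.
- by move=> w _; exact: phiX_ge0.
- by move=> x [_]; exact: phi_ge0.
- exact: fz_ge0.
move=> B' mB'; apply: (mule_pinjl z_gt0).
transitivity (\int[leb]_(x in B `&` phi @^-1` B' `&` D) (f x)%:E).
  by apply: QX; apply: measurableI => //; exact: mphiB.
rewrite -ge0_integralZl_EFin//.
- rewrite setIAC; apply: eq_integral => x _.
  by rewrite -EFinM mulrCA mulfV ?mulr1// gt_eqF.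
- by apply: measurableI => //; exact: mphiB.
- by move=> x [/fz_ge0 ? _]; rewrite lee_fin.
- exact/measurable_EFinP/measurable_funTS.
- exact: ltW.
Qed.

Lemma reweighted_density Q1 Q2 X (phi : R -> R) (H : set (set Omega)) :
  measurable_fun setT X -> measurable_fun setT phi ->
  (forall w, 0 <= phi (X w))%R -> (forall x, D x -> 0 <= phi x)%R ->
  (forall B, measurable B -> H (X @^-1` B)) ->
  reweighted Q1 Q2 H (phi \o X) ->
  has_law Q1 X (density_law D f) ->
  has_law Q2 X (density_law D (fun x => f x * phi x)%R).
Proof.
move=> mX mphi phiX_ge0 phi_ge0 HX [z2 z2_gt0 Q12] /(has_law_density _ mX)[z1 z1_gt0 Q1X].
have mXE A : measurable A -> measurable (X @^-1` A).
  by move=> mA; rewrite -[X in measurable X]setTI; exact: mX.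
have QX B : measurable B ->
    (z1 * z2)%:E * Q2 (X @^-1` B) = \int[leb]_(x in B `&` D) (f x * phi x)%:E.
  move=> mB; rewrite EFinM -muleA Q12; last exact: HX.
  exact: has_law_density_integral.
move=> B mB; rewrite /density_law /Rintegral -QX//.
rewrite -[D in X in (_ / X)%R]setTI -QX// preimage_setT probability_setT mule1/=.
rewrite -(@fineK _ (Q2 (X @^-1` B))); last by rewrite fin_num_measure//; exact: mXE.
by rewrite -EFinM/= mulrAC mulfV ?mul1r// gt_eqF// mulr_gt0.
Qed.

End density.

Lemma has_law_dirac0_integral Q X (phi : R -> R) B :
  measurable_fun setT X -> measurable_fun setT phi ->
  (forall w, 0 <= phi (X w))%R -> (0 <= phi 0)%R ->
  has_law Q X \d_(0%R : R) -> measurable B ->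
  \int[Q]_(w in X @^-1` B) (phi (X w))%:E = (phi 0)%:E * \d_(0%R : R) B.
Proof.
move=> mX mphi phiX_ge0 phi_ge0 QX mB.
have mXB : measurable (X @^-1` B).
  by rewrite -[X in measurable X]setTI; exact: mX.
have mphiB B' : measurable B' -> measurable (phi @^-1` B').
  by move=> mB'; rewrite -[X in measurable X]setTI; exact: mphi.
(* The comparison takes place on the single point 0, where [phi] is known to be nonnegative. *)
have m0 : measurable (B `&` [set 0%R]) by exact: measurableI.
rewrite (@transfer_integral _ _ _ _ _ Q (\d_(0%R : R)) _ _ _ _ (cst 1%R) mXB m0
  (measurableT_comp mphi mX) mphi)//.
- rewrite integral_dirac//=; last first.
    by apply/measurable_EFinP/measurable_funTS/measurable_funM.
  rewrite mulr1 muleC; congr (_ * _); rewrite /dirac/= !indicE; congr (_%:R%:E).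
  by congr nat_of_bool; apply/idP/idP; rewrite !in_setE /=; tauto.
- by move=> w _; exact: phiX_ge0.
- by move=> x [_ ->].
move=> B' mB'; transitivity (@dirac _ _ (0%R : R) R (B `&` phi @^-1` B')).
  by apply: QX; apply: measurableI => //; exact: mphiB.
have mC : measurable (B `&` [set 0%R] `&` phi @^-1` B').
  by apply: measurableI => //; exact: mphiB.
have := integral_dirac (0%R : R) mC (@measurable_cst _ _ _ _ _ (1%:E : \bar R)).
rewrite /cst => ->; rewrite mule1 /dirac/= !indicE; congr (_%:R%:E).
by congr nat_of_bool; apply/idP/idP; rewrite !in_setE /=; tauto.
Qed.

(** The normalising constant is [phi 0], hence positive. For [phi = id] this is absurd, which is how
    parameter 0 is excluded for an event that has been observed. *)
Lemma reweighted_dirac0 Q1 Q2 X (phi : R -> R) (H : set (set Omega)) :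
  measurable_fun setT X -> measurable_fun setT phi ->
  (forall w, 0 <= phi (X w))%R -> (0 <= phi 0)%R ->
  (forall B, measurable B -> H (X @^-1` B)) ->
  reweighted Q1 Q2 H (phi \o X) ->
  has_law Q1 X \d_(0%R : R) -> (0 < phi 0)%R /\ has_law Q2 X \d_(0%R : R).
Proof.
move=> mX mphi phiX_ge0 phi_ge0 HX [z z_gt0 Q12] Q1X.
have zQ B : measurable B -> z%:E * Q2 (X @^-1` B) = (phi 0)%:E * \d_(0%R : R) B.
  move=> mB; rewrite Q12; last exact: HX.
  exact: has_law_dirac0_integral.
have zE : z = phi 0%R.
  have := zQ _ measurableT; rewrite preimage_setT probability_setT mule1.
  by rewrite diracT mule1 => -[].
split; first by rewrite -zE.
by move=> B mB; apply: (mule_pinjl z_gt0); rewrite zQ// zE.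
Qed.

Section beta.
Variables (Q1 Q2 : probability Omega R) (X : Omega -> R) (H : set (set Omega)).
Variables (a b : R).
Hypotheses (mX : measurable_fun setT X) (X01 : forall w, (0 <= X w <= 1)%R).
Hypothesis HX : forall B, measurable B -> H (X @^-1` B).
Hypothesis X_beta : has_law Q1 X (beta_law a b).

Let mD : measurable (`]0%R, 1%R[%classic : set R). Proof. exact: measurable_itv. Qed.
Let mf : measurable_fun setT (fun x : R => x `^ (a - 1) * (1 - x) `^ (b - 1))%R.
Proof.
apply: measurable_funM; first exact: measurable_powR.
apply: (@measurableT_comp _ _ _ _ _ _ (fun x : R => x `^ (b - 1))%R).
  exact: measurable_powR.
exact: measurable_funB.
Qed.

(** The weight raises the exponent of [x] in the density by one. For [a = 0] the variable is almost
    surely 0 and cannot be a weight of positive mean. *)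
Lemma reweighted_beta_l : (0 <= a)%R -> reweighted Q1 Q2 H X ->
  has_law Q2 X (beta_law (a + 1) b).
Proof.
move=> a_ge0 Q12; move: X_beta; rewrite /beta_law.
have [_ X0|a_neq0 X_dens] := eqVneq a 0%R.
  have X_ge0 w : (0 <= id (X w))%R by have /andP[] := X01 w.
  have [/= lt00 _] := @reweighted_dirac0 Q1 Q2 X id H mX (@measurable_id _ _ _) X_ge0
    (lexx 0%R) HX Q12 X0.
  by exfalso; move: lt00; rewrite ltxx.
have /gt_eqF -> : (0 < a + 1)%R by rewrite ltr_wpDl.
have := @reweighted_density _ _ mD mf _ Q1 Q2 X id H mX _ _ _ HX Q12 X_dens.
rewrite (@eq_density_law _ _ (fun x => x `^ (a + 1 - 1) * (1 - x) `^ (b - 1))%R).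
  apply => //.
  - by move=> x _; rewrite mulr_ge0// powR_ge0.
  - by move=> w; have /andP[] := X01 w.
  - by move=> x; rewrite /= in_itv/= => /andP[/ltW].
move=> x; rewrite /= in_itv/= => /andP[x_gt0 _].
rewrite mulrAC; congr (_ * _)%R.
rewrite -[X in (_ * X)%R](powRr1 (ltW x_gt0)) -powRD; last first.
  by rewrite (gt_eqF x_gt0) implybT.
by rewrite addrAC.
Qed.

Lemma reweighted_beta_r : reweighted Q1 Q2 H (fun w => 1 - X w)%R ->
  has_law Q2 X (beta_law a (b + 1)).
Proof.
move=> Q12; move: X_beta; rewrite /beta_law.
have mphi : measurable_fun setT (fun x : R => 1 - x)%R by exact: measurable_funB.
have phiX w : (0 <= 1 - X w)%R by rewrite subr_ge0; have /andP[] := X01 w.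
have [_ X0|a_neq0 X_dens] := eqVneq a 0%R.
  have phi0 : (0 <= 1 - 0 :> R)%R by rewrite subr0.
  by have [] := @reweighted_dirac0 Q1 Q2 X (fun x => 1 - x)%R H mX mphi phiX phi0 HX Q12 X0.
have := @reweighted_density _ _ mD mf _ Q1 Q2 X (fun x => 1 - x)%R H mX mphi phiX _ HX Q12 X_dens.
rewrite (@eq_density_law _ _ (fun x => x `^ (a - 1) * (1 - x) `^ (b + 1 - 1))%R).
  apply => //.
  - by move=> x _; rewrite mulr_ge0// powR_ge0.
  - by move=> x; rewrite /= in_itv/= subr_ge0 => /andP[_ /ltW].
move=> x; rewrite /= in_itv/= => /andP[_ x_lt1].
have x1 : (0 < 1 - x)%R by rewrite subr_gt0.
rewrite -mulrA; congr (_ * _)%R.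
rewrite -[X in (_ * X)%R](powRr1 (ltW x1)) -powRD; last first.
  by rewrite (gt_eqF x1) implybT.
by rewrite addrAC.
Qed.

End beta.

End laws.

(** * Affine changes of variable, exponential tilting of gamma laws *)

Section lebesgue_affine.
Local Open Scope ereal_scope.
Context (R : realType).
Let leb := @lebesgue_measure R.

(** The image of Lebesgue measure under the affine map, scaled by [c], gives half-open intervals
    their length, so uniqueness of Lebesgue measure identifies the two. Both translations and
    dilations are used later. *)
Lemma ge0_integral_affine (c a : R) (f : R -> \bar R) : (0 < c)%R ->
  measurable_fun setT f -> (forall x, 0 <= f x) ->
  \int[leb]_x f x = c%:E * \int[leb]_x f (c * x + a)%R.
Proof.
move=> c_gt0 mf f_ge0.
pose phi : measurableTypeR R -> measurableTypeR R := fun x => (c * x + a)%R.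
have mphi : measurable_fun setT phi.
  by apply: measurable_funD => //; exact: measurable_funM.
pose phi_leb := measure_function_pushforward__canonical__measure_function_Measure leb mphi.
have c_ge0 : (0 <= c)%R by exact: ltW.
have lebE A : measurable A -> leb A = mscale (NngNum c_ge0) phi_leb A.
  move=> mA; apply: lebesgue_measure_unique => // _ [[l r]] _ <-.
  transitivity (c%:E * leb (phi @^-1` `]l, r]%classic)); last by [].
  rewrite (_ : phi @^-1` _ = (`]((l - a) / c)%R, ((r - a) / c)%R]%classic : set R)).
    rewrite /leb !lebesgue_measure_itv/= !lte_fin ltr_pM2r ?invr_gt0// ltrD2r.
    case: ifPn => _; last by rewrite mule0.
    by rewrite -!EFinB -EFinM; congr (_%:E); field; rewrite gt_eqF.
  by apply/seteqP; split=> x; rewrite /= !in_itv/= ltr_pdivrMr// ler_pdivlMr//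
    ltrBlDr lerBrDr (mulrC x).
transitivity (\int[mscale (NngNum c_ge0) phi_leb]_x f x).
  by apply: eq_measure_integral => A mA _; exact: lebE.
rewrite ge0_integral_mscale//; congr (_ * _).
exact: (@ge0_integral_pushforward _ _ _ _ _ phi mphi leb setT f).
Qed.

End lebesgue_affine.

Section gamma.
Local Open Scope ereal_scope.
Context (R : realType) d (Omega : measurableType d).
Implicit Types (Q : probability Omega R) (Z : Omega -> R).
Let leb := @lebesgue_measure R.
Let D : set R := `]0%R, +oo[%classic.
Let f (a : R) : R -> R := fun x => (x `^ (a - 1) * expR (- x))%R.

Let mD : measurable D. Proof. exact: measurable_itv. Qed.
Let mf a : measurable_fun setT (f a).
Proof.
apply: measurable_funM; first exact: measurable_powR.
by apply: measurableT_comp => //; exact: measurable_oppr.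
Qed.
Let f_ge0 a x : (0 <= f a x)%R.
Proof. by rewrite /f mulr_ge0// ?powR_ge0// expR_ge0. Qed.

Lemma reweighted_gamma Q1 Q2 Z (H : set (set Omega)) a :
  measurable_fun setT Z -> (forall w, 0 <= Z w)%R ->
  (forall B, measurable B -> H (Z @^-1` B)) -> (0 <= a)%R ->
  reweighted Q1 Q2 H Z -> has_law Q1 Z (gamma_law a) ->
  (0 < a)%R /\ has_law Q2 Z (gamma_law (a + 1)).
Proof.
move=> mZ Z_ge0 HZ a_ge0 Q12; rewrite /gamma_law.
have [_ Z0|a_neq0 Z_dens] := eqVneq a 0%R.
  have [/= lt00 _] := @reweighted_dirac0 _ _ _ Q1 Q2 Z id H mZ (@measurable_id _ _ _) Z_ge0
    (lexx 0%R) HZ Q12 Z0.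
  by exfalso; move: lt00; rewrite ltxx.
have a_gt0 : (0 < a)%R by rewrite lt_neqAle eq_sym a_neq0.
split=> //; have /gt_eqF -> : (0 < a + 1)%R by rewrite ltr_wpDl.
have D_ge0 x : D x -> (0 <= id x)%R by rewrite /D /= in_itv/= andbT => /ltW.
have := @reweighted_density _ _ _ _ (f a) mD (@mf a) (fun x _ => f_ge0 a x) Q1 Q2 Z id H mZ
  (@measurable_id _ _ _) Z_ge0 D_ge0 HZ Q12 Z_dens.
rewrite (@eq_density_law _ _ _ (f (a + 1)))// => x.
rewrite /D /= in_itv/= andbT => x_gt0; rewrite /f mulrAC; congr (_ * _)%R.
rewrite -[X in (_ * X)%R](powRr1 (ltW x_gt0)) -powRD; last first.
  by rewrite (gt_eqF x_gt0) implybT.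
by rewrite addrAC.
Qed.

(** The weight turns [exp (- x)] into [exp (- (1 + l) x)] in the density, and the dilation by
    [1 + l] undoes this. *)
Lemma reweighted_gamma_scale Q1 Q2 Z (H : set (set Omega)) a (l : R) :
  measurable_fun setT Z -> (forall w, 0 <= Z w)%R ->
  (forall B, measurable B -> H (Z @^-1` B)) -> (0 < l)%R ->
  reweighted Q1 Q2 H (fun w => expR (- (l * Z w)))%R ->
  has_law Q1 Z (gamma_law a) ->
  has_law Q2 (fun w => (1 + l) * Z w)%R (gamma_law a).
Proof.
move=> mZ Z_ge0 HZ l_gt0 Q12; rewrite /gamma_law.
pose phi x : R := expR (- (l * x))%R.
have mphi : measurable_fun setT phi.
  by apply: measurableT_comp => //; apply: measurableT_comp => //; exact: measurable_funM.
pose c := (1 + l)%R.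
have c_gt0 : (0 < c)%R by rewrite addr_gt0.
have mcZ : measurable_fun setT (fun w => c * Z w)%R by exact: measurable_funM.
have phi_ge0 x : (0 <= phi x)%R by exact: expR_ge0.
have mcB B : measurable B -> measurable ((fun x : R => c * x)%R @^-1` B).
  move=> mB; rewrite -[X in measurable X]setTI.
  by have : measurable_fun setT (fun x : R => c * x)%R;
    [exact: measurable_funM|exact].
have [a0 Z0|a_neq0 Z_dens] := eqVneq a 0%R.
  have [_ Q2Z] := reweighted_dirac0 mZ mphi (fun w => phi_ge0 _) (phi_ge0 _) HZ Q12 Z0.
  move=> B mB; rewrite -[LHS]/(Q2 (Z @^-1` ((fun x : R => c * x)%R @^-1` B))).
  rewrite Q2Z; last exact: mcB.
  rewrite /dirac/= !indicE; congr (_%:R%:E); congr nat_of_bool.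
  by apply/idP/idP; rewrite !in_setE /= mulr0.
have := reweighted_density mD (@mf a) (fun x _ => f_ge0 a x) mZ mphi
  (fun w => phi_ge0 _) (fun x _ => phi_ge0 x) HZ Q12 Z_dens.
move=> /(has_law_density mD _ _ _ mZ).1 [].
- by apply: measurable_funM => //; exact: mf.
- by move=> x _; rewrite mulr_ge0// f_ge0.
move=> z z_gt0 Q2Z.
apply/(has_law_density mD (@mf a) (fun x _ => f_ge0 a x) _ mcZ).
(* In the substitution of [c x] for [x], one factor [c] comes from Lebesgue measure and
   [c ^ (a - 1)] from the power. *)
exists (c * c `^ (a - 1) * z)%R; first by rewrite !mulr_gt0// powR_gt0.
move=> B mB.
rewrite EFinM -muleA -[X in Q2 X]/(Z @^-1` ((fun x : R => c * x)%R @^-1` B)).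
rewrite Q2Z; last exact: mcB.
rewrite integral_mkcond [RHS]integral_mkcond.
rewrite [RHS](@ge0_integral_affine _ c 0%R _ c_gt0); last 2 first.
- apply/(measurable_restrictT _ _).1; first exact: measurableI.
  exact/measurable_EFinP/measurable_funTS.
- move=> x; rewrite patchE; case: ifPn => // _.
  by rewrite lee_fin.
rewrite EFinM -muleA; congr (_ * _).
rewrite -ge0_integralZl_EFin//.
- apply: eq_integral => x _; rewrite !patchE addr0.
  have -> : (c * x)%R \in B `&` D = (x \in (fun x : R => c * x)%R @^-1` B `&` D).
    apply/idP/idP; rewrite !in_setE /D /= !in_itv/= !andbT pmulr_rgt0//.
  case: ifPn; last by rewrite mule0.
  rewrite in_setE /D /= in_itv/= andbT => -[_ x_gt0].
  rewrite -EFinM; congr (_%:E); rewrite /f /phi powRM ?(ltW c_gt0) ?(ltW x_gt0)//.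
  rewrite -!mulrA; congr (_ * (_ * _))%R; rewrite -expRD; congr expR.
  by rewrite /c; ring.
- move=> x _; rewrite patchE; case: ifPn => // _.
  by rewrite lee_fin mulr_ge0// f_ge0.
- apply/(measurable_restrictT _ _).1.
    by apply: measurableI => //; exact: mcB.
  apply/measurable_EFinP/measurable_funTS; apply: measurable_funM => //.
  exact: mf.
- exact: powR_ge0.
Qed.

(** Since [Z <= 2 exp (Z / 2)], it suffices to integrate [x ^ (a - 1) exp (- x / 2)]; doubling the
    variable turns this into a multiple of the normalising integral, which is finite. *)
Lemma gamma_integral_lty Q Z a :
  measurable_fun setT Z -> (forall w, 0 <= Z w)%R ->
  has_law Q Z (gamma_law a) -> \int[Q]_w (Z w)%:E < +oo.
Proof.
move=> mZ Z_ge0; rewrite /gamma_law -(preimage_setT Z).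
have [a0 Z0|a_neq0 /(has_law_density mD (@mf a) (fun x _ => f_ge0 a x) _ mZ)[z z_gt0 QZ]] :=
    eqVneq a 0%R.
  rewrite (@has_law_dirac0_integral R d Omega Q Z id setT mZ (@measurable_id _ _ _))//.
  by rewrite mul0e.
pose phi x : R := expR (x / 2)%R.
have mphi : measurable_fun setT phi.
  by apply: measurableT_comp => //; exact: measurable_funM.
have phi_ge0 x : (0 <= phi x)%R by exact: expR_ge0.
apply: (@le_lt_trans _ _ (2%:E * \int[Q]_(w in Z @^-1` setT) (phi (Z w))%:E)).
  rewrite preimage_setT -ge0_integralZl_EFin//; last 2 first.
  - by move=> w _; rewrite lee_fin.
  - by apply/measurable_EFinP; exact: measurableT_comp.
  apply: ge0_le_integral => //.
  - by move=> w _; rewrite lee_fin.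
  - exact/measurable_EFinP.
  - apply/(@measurable_EFinP _ _ _ _ (fun w => 2 * phi (Z w))%R).
    by apply: measurable_funM => //; exact: measurableT_comp.
  move=> w _; rewrite -EFinM lee_fin /phi mulrC -ler_pdivrMr//.
  by apply: le_trans (expR_ge1Dx _); rewrite lerDr.
have I_lty : \int[leb]_(x in setT `&` D) (f a x * phi x)%:E < +oo.
  rewrite setTI integral_mkcond (@ge0_integral_affine _ 2 0%R)//; last 2 first.
  - apply/(measurable_restrictT _ _).1 => //.
    by apply/measurable_EFinP/measurable_funTS; apply: measurable_funM => //; exact: mf.
  - move=> x; rewrite patchE; case: ifPn => // _.
    by rewrite lee_fin mulr_ge0// f_ge0.
  rewrite (_ : \int[_]_x _ = (2 `^ (a - 1))%:E * \int[leb]_(x in setT `&` D) (f a x)%:E).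
    by rewrite -QZ// preimage_setT probability_setT mule1 -!EFinM ltry.
  rewrite setTI -ge0_integralZl_EFin//; last 2 first.
  - by move=> x _; rewrite lee_fin.
  - by apply/measurable_EFinP; apply: measurable_funTS; exact: mf.
  rewrite [RHS]integral_mkcond.
  apply: eq_integral => x _; rewrite !patchE addr0.
  have -> : ((2 * x)%R \in D) = (x \in D).
    apply/idP/idP; rewrite !in_setE /D /= !in_itv/= !andbT pmulr_rgt0//.
  case: ifPn => //.
  rewrite in_setE /D /= in_itv/= andbT => x_gt0.
  rewrite -EFinM; congr (_%:E); rewrite /f /phi powRM ?(ltW x_gt0)//.
  rewrite -!mulrA; congr (_ * (_ * _))%R; rewrite -expRD; congr expR.
  by field.
rewrite lte_mul_pinfty// -(@lte_pmul2l _ z%:E)// ?lte_fin// (has_law_density_integral mD (@mf a))//.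
by rewrite gt0_muley ?lte_fin.
Qed.

End gamma.

Section probability_lemmas.
Local Open Scope ereal_scope.
Context (R : realType) d (Omega : measurableType d) (Q : probability Omega R).

Lemma probability_setI1 (N A : set Omega) : measurable N -> measurable A ->
  Q N = 1 -> Q (A `&` N) = Q A.
Proof.
move=> mN mA QN; rewrite -[in RHS](setUIDK A N) measureU//; last 3 first.
- exact: measurableI.
- exact: measurableD.
- by rewrite setDE setIACA setICr setI0.
rewrite [X in _ + X](_ : _ = 0) ?adde0//; apply/eqP; rewrite -measure_le0 (@le_trans _ _ (Q (~` N)))//.
  apply: le_measure; rewrite ?inE; [exact: measurableD|exact: measurableC|].
  by rewrite setDE; exact: subIsetr.
by rewrite probability_setC// QN subee.
Qed.

Lemma eq_probability_full (N A B : set Omega) :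
  measurable N -> measurable A -> measurable B -> Q N = 1 ->
  A `&` N = B `&` N -> Q A = Q B.
Proof. by move=> mN mA mB QN AB; rewrite -(probability_setI1 mN mA)// AB probability_setI1. Qed.

(** Two finite measures, the restriction of [Q] to [A] and the multiple of [Q] by [Q A], agree on a
    pi-system; [setT] is added to it so that it covers the space. *)
Lemma independent_g_sigma (G H : set (set Omega)) :
  G `<=` measurable -> H `<=` measurable -> setI_closed H ->
  independent Q G H -> independent Q G <<s H >>.
Proof.
move=> mG mH HI GH A B GA sHB; have mA := mG _ GA.
have r_ge0 : (0 <= fine (Q A))%R by rewrite fine_ge0.
pose m1 : {measure set Omega -> \bar R} := mrestr Q mA.
pose m2 : {measure set Omega -> \bar R} := mscale (NngNum r_ge0) Q.
pose H' := H `|` [set setT].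
rewrite setIC -[LHS]/(m1 B) -[Q A]fineK ?fin_num_measure// -[RHS]/(m2 B).
apply: (@g_sigma_algebra_measure_unique _ R _ H' _ (fun=> setT)) => //.
- by move=> C [/mH //|->].
- by right.
- by rewrite bigcup_const.
- move=> C1 C2 [HC1|->] [HC2|->]; rewrite ?setTI ?setIT; [|by left|by left|by right].
  by left; exact: HI.
- move=> C [HC|->]; rewrite /m1 /m2/= /mrestr /mscale/= fineK ?fin_num_measure//.
    by rewrite setIC GH.
  by rewrite setTI probability_setT mule1.
- by move=> k; rewrite /m1/= /mrestr setTI -ge0_fin_numE ?fin_num_measure.
- by move: B sHB; apply: sub_sigma_algebra2 => C HC; left.
Qed.

End probability_lemmas.

(** * Sums of gamma variables *)

Section gamma_add.
Local Open Scope ereal_scope.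
Context (R : realType) d (Omega : measurableType d) (Q : probability Omega R).
Let leb := @lebesgue_measure R.
Let D : set R := `]0%R, +oo[%classic.
(** The unnormalised gamma density with the half-line built in as an indicator, so that convolutions
    are integrals over the whole line. *)
Let h (a x : R) : R := (x `^ (a - 1) * expR (- x) * \1_D x)%R.

Let mD : measurable D. Proof. exact: measurable_itv. Qed.
Let mh a : measurable_fun setT (h a).
Proof.
apply: measurable_funM; last exact: measurable_indic.
apply: measurable_funM; first exact: measurable_powR.
by apply: measurableT_comp => //; exact: measurable_oppr.
Qed.
Let h_ge0 a x : (0 <= h a x)%R.
Proof. by rewrite /h !mulr_ge0// ?powR_ge0// expR_ge0. Qed.

Let gamma_lawE a : a != 0%R ->
  gamma_law a = density_law D (fun x => x `^ (a - 1) * expR (- x))%R.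
Proof. by rewrite /gamma_law => /negbTE ->. Qed.

Let mf a : measurable_fun setT (fun x : R => x `^ (a - 1) * expR (- x))%R.
Proof.
apply: measurable_funM; first exact: measurable_powR.
by apply: measurableT_comp => //; exact: measurable_oppr.
Qed.

Let f_ge0 a x : D x -> (0 <= x `^ (a - 1) * expR (- x) :> R)%R.
Proof. by rewrite mulr_ge0// ?powR_ge0// expR_ge0. Qed.

Let gamma_law_integral (X : Omega -> R) a : measurable_fun setT X -> a != 0%R ->
  has_law Q X (gamma_law a) ->
  exists2 z : R, (0 < z)%R & forall phi : R -> R,
    measurable_fun setT phi -> (forall x, 0 <= phi x)%R ->
    z%:E * \int[Q]_w (phi (X w))%:E = \int[leb]_x (h a x * phi x)%:E.
Proof.
move=> mX a_neq0; rewrite gamma_lawE// => /(has_law_density mD (@mf a) (@f_ge0 a) _ mX)[z z_gt0 Qz].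
exists z => // phi mphi phi_ge0.
have := has_law_density_integral mD (@mf a) (@f_ge0 a) mX mphi (fun w => phi_ge0 _)
  (fun x _ => phi_ge0 x) z_gt0 Qz measurableT.
rewrite preimage_setT => ->; rewrite setTI integral_mkcond.
apply: eq_integral => x _; rewrite patchE /h !indicE.
by case: (x \in D) => /=; rewrite ?mulr1 ?mulr0 ?mul0r.
Qed.

Let has_gamma_law (X : Omega -> R) a z : measurable_fun setT X -> a != 0%R ->
  (0 < z)%R ->
  (forall B, measurable B -> z%:E * Q (X @^-1` B) = \int[leb]_x (h a x * \1_B x)%:E) ->
  has_law Q X (gamma_law a).
Proof.
move=> mX a_neq0 z_gt0 Qz; rewrite gamma_lawE//.
apply/(has_law_density mD (@mf a) (@f_ge0 a) _ mX); exists z => // B mB; rewrite Qz//.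
rewrite [RHS]integral_mkcond; apply: eq_integral => x _.
rewrite patchE /h !indicE in_setI.
case: (x \in B) => /=; last by rewrite mulr0.
by case: (x \in D) => /=; rewrite !(mulr1, mulr0).
Qed.

(** The unnormalised Beta(a, b) density, cut off to the unit interval by the two indicators. *)
Let kappa (a b v : R) : R :=
  (v `^ (a - 1) * (1 - v) `^ (b - 1) * \1_D v * \1_D (1 - v))%R.

Let m1Dsub (s : R) : measurable_fun setT (fun v : R => \1_D (s - v)%R : R).
Proof.
apply: (@measurableT_comp _ _ _ _ _ _ (\1_D : R -> R)).
  exact: measurable_indic.
exact: measurable_funB.
Qed.

(** Substituting [y = s v] separates the variables: the powers of [s] combine with the Jacobian [s]
    into [s ^ (a + b - 1)], and the exponentials multiply to [exp (- s)]. For [s <= 0] both sides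
    vanish, as [y] and [s - y] cannot both be positive. *)
Let convolution a b s :
  \int[leb]_y (h a y * h b (s - y))%:E =
  \int[leb]_v (kappa a b v)%:E * (h (a + b) s)%:E.
Proof.
have mhb : measurable_fun setT (fun y : R => h b (s - y))%R.
  by apply: measurableT_comp; [exact: mh|exact: measurable_funB].
have [s_le0|s_gt0] := leP s 0%R.
  have -> : h (a + b) s = 0%R.
    rewrite /h indicE memNset ?mulr0// /D /= in_itv/= andbT.
    by apply/negP; rewrite -leNgt.
  rewrite mule0; apply: integral0_eq => y _.
  have [y_le0|y_gt0] := leP y 0%R.
    rewrite /h indicE memNset ?mulr0 ?mul0r// /D /= in_itv/= andbT.
    by apply/negP; rewrite -leNgt.
  rewrite [h b _]/h indicE memNset ?mulr0// /D /= in_itv/= andbT.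
  by apply/negP; rewrite -leNgt; lra.
rewrite (@ge0_integral_affine _ s 0%R _ s_gt0); last 2 first.
- by apply/measurable_EFinP; exact: measurable_funM.
- by move=> y; rewrite lee_fin mulr_ge0.
have mkappa : measurable_fun setT (kappa a b).
  apply: measurable_funM; last exact: m1Dsub.
  apply: measurable_funM; last exact: measurable_indic.
  apply: measurable_funM; first exact: measurable_powR.
  apply: (@measurableT_comp _ _ _ _ _ _ (fun x : R => x `^ (b - 1))%R).
    exact: measurable_powR.
  exact: measurable_funB.
have kappa_ge0 v : (0 <= kappa a b v)%R by rewrite /kappa !mulr_ge0// powR_ge0.
rewrite [RHS]muleC -ge0_integralZl_EFin//; last 3 first.
- by move=> v _; rewrite lee_fin mulr_ge0.
- apply/measurable_EFinP; apply: measurable_funM.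
    by apply: (measurableT_comp (mh a)); apply: measurable_funD => //; exact: measurable_funM.
  apply: (measurableT_comp (mh b)); apply: measurable_funB => //.
  by apply: measurable_funD => //; exact: measurable_funM.
- exact: ltW.
rewrite -ge0_integralZl_EFin//; last 2 first.
- by move=> v _; rewrite lee_fin.
- exact/measurable_EFinP.
apply: eq_integral => v _; rewrite -!EFinM addr0; congr (_%:E).
have -> : h (a + b) s = (s `^ (a + b - 1) * expR (- s))%R.
  by rewrite /h indicE mem_set ?mulr1// /D /= in_itv/= andbT.
have -> : (s - s * v = s * (1 - v))%R by rewrite mulrBr mulr1.
have [v01|] := boolP ((0 < v) && (0 < 1 - v))%R; last first.
  have D0 u : ~~ (0 < u)%R -> \1_D u = 0%R :> R.
    by move=> u0; rewrite indicE memNset// /D /= in_itv/= andbT; exact/negP.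
  rewrite negb_and => /orP[v0|v1].
    rewrite /kappa (D0 v)// /h (D0 (s * v)%R) ?pmulr_rgt0//.
    by rewrite !(mulr0, mul0r).
  rewrite /kappa (D0 (1 - v)%R)// /h (D0 (s * (1 - v))%R) ?pmulr_rgt0//.
  by rewrite !(mulr0, mul0r).
have D1 u : (0 < u)%R -> \1_D u = 1%R :> R.
  by move=> u0; rewrite indicE mem_set// /D /= in_itv/= andbT.
move: v01 => /andP[v_gt0 v_lt1].
rewrite /kappa /h !D1// ?mulr_gt0// !mulr1 !powRM ?(ltW s_gt0) ?(ltW v_gt0) ?(ltW v_lt1)//.
have -> : (s `^ (a + b - 1) = s * s `^ (a - 1) * s `^ (b - 1))%R.
  rewrite -{2}(powRr1 (ltW s_gt0)) -!powRD ?(gt_eqF s_gt0) ?implybT//.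
  by congr (_ `^ _)%R; ring.
have -> : expR (- s) = (expR (- (s * v)) * expR (- (s * (1 - v))))%R.
  by rewrite -expRD; congr expR; ring.
by ring.
Qed.

(** By independence the pair has the product law, and Tonelli with [convolution] gives the law of
    the sum up to the factor [K], a beta integral whose value never matters. *)
Lemma gamma_add (Y Z : {RV Q >-> R}) a b : (0 <= a)%R -> (0 <= b)%R ->
  independent Q (sigma_var Y) (sigma_var Z) ->
  has_law Q Y (gamma_law a) -> has_law Q Z (gamma_law b) ->
  has_law Q (fun w => Y w + Z w)%R (gamma_law (a + b)).
Proof.
move=> a_ge0 b_ge0 indep QY QZ.
have mY : measurable_fun setT Y by exact: measurable_funP.
have mZ : measurable_fun setT Z by exact: measurable_funP.
have mYZ : measurable_fun setT (fun w => Y w + Z w)%R by exact: measurable_funD.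
have mpre (X : Omega -> R) B : measurable_fun setT X -> measurable B -> measurable (X @^-1` B).
  by move=> mX mB; rewrite -[X in measurable X]setTI; exact: mX.
(* Parameter 0 means almost surely 0, so the sum coincides with the other variable on a full
   event. *)
have [a0|a_neq0] := eqVneq a 0%R.
  rewrite a0 add0r => B mB; rewrite -QZ//.
  have m0 : measurable [set 0%R : R] by [].
  apply: (@eq_probability_full _ _ _ Q (Y @^-1` [set 0%R])); do ?exact: mpre.
    by move: QY; rewrite a0 /gamma_law eqxx => ->//; rewrite diracE mem_set.
  by apply/seteqP; split=> w [/= + Yw]; rewrite Yw add0r.
have [b0|b_neq0] := eqVneq b 0%R.
  rewrite b0 addr0 => B mB; rewrite -QY//.
  have m0 : measurable [set 0%R : R] by [].
  apply: (@eq_probability_full _ _ _ Q (Z @^-1` [set 0%R])); do ?exact: mpre.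
    by move: QZ; rewrite b0 /gamma_law eqxx => ->//; rewrite diracE mem_set.
  by apply/seteqP; split=> w [/= + Zw]; rewrite Zw addr0.
have [z1 z1_gt0 QzY] := gamma_law_integral mY a_neq0 QY.
have [z2 z2_gt0 QzZ] := gamma_law_integral mZ b_neq0 QZ.
pose K := \int[leb]_v (kappa a b v)%:E.
have K_ge0 : 0 <= K.
  by apply: integral_ge0 => v _; rewrite lee_fin /kappa !mulr_ge0// powR_ge0.
have m1 B : measurable B -> measurable_fun setT (\1_B : R -> R).
  by move=> mB; exact: measurable_indic.
have main B : measurable B ->
    (z1 * z2)%:E * Q ((fun w => Y w + Z w)%R @^-1` B) =
    K * \int[leb]_x (h (a + b) x * \1_B x)%:E.
  move=> mB.
  have mh1 c : measurable_fun setT (fun x : R => h c x * \1_B x)%R.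
    by apply: measurable_funM; [exact: mh|exact: m1].
  have mconv s : measurable_fun setT (fun y : R => h a y * h b (s - y))%R.
    apply: measurable_funM; first exact: mh.
    by apply: (measurableT_comp (mh b)); exact: measurable_funB.
  pose C := [set p : R * R | B (p.1 + p.2)%R].
  have mC : measurable C.
    have mD' : measurable_fun setT (fun p : R * R => p.1 + p.2)%R.
      by apply: measurable_funD; [exact: measurable_fst|exact: measurable_snd].
    by have := mD' measurableT B mB; rewrite setTI.
  have mpair : measurable_fun setT (fun w => (Y w, Z w)).
    exact/measurable_fun_pairP.
  pose m' := measure_function_pushforward__canonical__measure_function_Measure Q mpair.
  have QC : (distribution Q Y \x distribution Q Z) C = m' C.
    apply: product_measure_unique => // A1 A2 mA1 mA2.
    by apply: indep; [exists A1|exists A2].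
  pose phi y := fine (distribution Q Z (xsection C y)).
  have phiE y : (phi y)%:E = distribution Q Z (xsection C y).
    by rewrite fineK// fin_num_measure//; exact: measurable_xsection.
  have mphi : measurable_fun setT phi.
    suff /measurable_EFinP : measurable_fun setT (fun y => (phi y)%:E) by [].
    under eq_fun do rewrite phiE.
    exact: measurable_fun_xsection.
  have phi_ge0 y : (0 <= phi y)%R by rewrite fine_ge0.
  have -> : Q ((fun w => Y w + Z w)%R @^-1` B) = \int[Q]_w (phi (Y w))%:E.
    rewrite -[LHS]/(m' C) -QC /product_measure1.
    transitivity (\int[distribution Q Y]_y (phi y)%:E).
      by apply: eq_integral => y _; rewrite phiE.
    rewrite ge0_integral_distribution//; exact/measurable_EFinP.
  have z2phi y : z2%:E * (phi y)%:E = \int[leb]_s (h b (s - y) * \1_B s)%:E.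
    rewrite phiE.
    have mB1 : measurable_fun setT (fun z : R => \1_B (y + z)%R : R).
      by apply: (@measurableT_comp _ _ _ _ _ _ (\1_B : R -> R)); [exact: m1|exact: measurable_funD].
    have -> : distribution Q Z (xsection C y) = \int[Q]_w (\1_B (y + Z w)%R)%:E.
      rewrite (_ : (fun w => _) = (fun w => (\1_(Z @^-1` (xsection C y)) w)%:E)).
        rewrite integral_indic ?setIT//.
        by apply: mpre => //; exact: measurable_xsection.
      apply/funext => w; rewrite !indicE; congr (_%:R%:E); congr nat_of_bool.
      by apply/idP/idP; rewrite !in_setE /xsection/= in_setE.
    rewrite (QzZ (fun z => \1_B (y + z)%R))//.
    (* Translation to the variable [s = y + z], so that the event no longer involves [y]. *)
    rewrite (@ge0_integral_affine _ 1 (- y)%R)//.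
    - rewrite mul1e; apply: eq_integral => s _.
      by rewrite mul1r addrCA subrr addr0.
    - by apply/measurable_EFinP; exact: measurable_funM.
    - by move=> s; rewrite lee_fin mulr_ge0.
  rewrite mulrC EFinM -muleA QzY// -ge0_integralZl_EFin//; last 3 first.
  - by move=> x _; rewrite lee_fin mulr_ge0.
  - have mhphi : measurable_fun setT (fun x : R => h a x * phi x)%R.
      by apply: measurable_funM => //; exact: mh.
    by apply/measurable_EFinP; exact: mhphi.
  - exact: ltW.
  have mhb y : measurable_fun setT (fun s : R => h b (s - y) * \1_B s)%R.
    apply: measurable_funM => //.
    by apply: (measurableT_comp (mh b)); exact: measurable_funB.
  transitivity (\int[leb]_y \int[leb]_s (h a y * h b (s - y) * \1_B s)%:E).
    apply: eq_integral => y _; rewrite EFinM muleCA z2phi -ge0_integralZl_EFin//.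
    - by apply: eq_integral => s _; rewrite -EFinM mulrA.
    - by move=> s _; rewrite lee_fin mulr_ge0.
    - by apply/measurable_EFinP; exact: mhb.
  rewrite (@fubini_tonelli _ _ _ _ _ leb leb (fun p => (h a p.1 * h b (p.2 - p.1) * \1_B p.2)%:E))/=.
  - rewrite -ge0_integralZl//; last 2 first.
    + by apply/measurable_EFinP; exact: mh1.
    + by move=> s _; rewrite lee_fin mulr_ge0.
    apply: eq_integral => s _.
    under eq_integral do rewrite mulrC EFinM.
    rewrite ge0_integralZl_EFin//.
    + by rewrite convolution -/K muleCA; congr (_ * _); rewrite -EFinM mulrC.
    + by move=> y _; rewrite lee_fin mulr_ge0.
    + by apply/measurable_EFinP; exact: mconv.
  - apply/measurable_EFinP; apply: measurable_funM; last first.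
      by apply: (@measurableT_comp _ _ _ _ _ _ (\1_B : R -> R)); [exact: m1|exact: measurable_snd].
    apply: measurable_funM.
      by apply: (measurableT_comp (mh a)); exact: measurable_fst.
    apply: (measurableT_comp (mh b)).
    by apply: measurable_funB; [exact: measurable_snd|exact: measurable_fst].
  - move=> p; rewrite lee_fin; apply: mulr_ge0; last by rewrite indicE.
    by apply: mulr_ge0; exact: h_ge0.
have z12_gt0 : (0 < z1 * z2)%R by exact: mulr_gt0.
(* Total mass 1 gives [K] times the gamma integral equal to [z1 z2], which is positive and finite;
   hence [K] is neither 0 nor infinite. *)
have KJ := main _ measurableT.
rewrite preimage_setT probability_setT mule1 in KJ.
have J_ge0 : 0 <= \int[leb]_x (h (a + b) x * \1_setT x)%:E.
  by apply: integral_ge0 => x _; rewrite lee_fin mulr_ge0.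
have J_gt0 : 0 < \int[leb]_x (h (a + b) x * \1_setT x)%:E.
  rewrite lt_neqAle J_ge0 andbT; apply/eqP => J0.
  by move: KJ; rewrite -J0 mule0 => -[z120]; rewrite z120 ltxx in z12_gt0.
have K_fin : K \is a fin_num.
  rewrite ge0_fin_numE// ltey; apply/eqP => Koo.
  by move: KJ; rewrite Koo gt0_mulye.
have K_gt0 : (0 < fine K)%R.
  rewrite fine_gt0// -ge0_fin_numE// K_fin andbT lt_neqAle K_ge0 andbT.
  apply/eqP => K0; move: KJ; rewrite -K0 mul0e => -[z120].
  by rewrite z120 ltxx in z12_gt0.
apply: (@has_gamma_law _ _ (z1 * z2 / fine K)%R) => //.
- by rewrite gt_eqF// addr_gt0// lt_neqAle eq_sym ?a_neq0 ?b_neq0.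
- by rewrite divr_gt0.
move=> B mB; apply: (mule_pinjl K_gt0).
by rewrite muleA -EFinM mulrCA mulfV ?gt_eqF// mulr1 main// fineK.
Qed.

End gamma_add.

(** * Joint laws of independent variables, Dirichlet representations *)

Section measurability.
Context (R : realType) d (T : measurableType d).

Lemma measurable_funV (D : set T) (f : T -> R) : measurable_fun D f ->
  measurable_fun D (fun x => (f x)^-1).
Proof.
move=> mf.
have mV : measurable_fun setT (fun x : R => x^-1).
  (* The power of exponent -1 is the inverse on nonnegative numbers only, hence the detour through
     the square. The identity persists at 0 by the convention on inverses. *)
  rewrite (_ : (fun x : R => x^-1) = (fun x => x * (x * x) `^ (-1))); last first.
    apply/funext => x; rewrite powR_inv1 -?expr2 ?sqr_ge0// expr2 invfM mulrA.
    by have [->|x0] := eqVneq x 0; [rewrite invr0 mulr0|rewrite mulfV// mul1r].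
  apply: measurable_funM => //; apply: (@measurableT_comp _ _ _ _ _ _ (fun x : R => x `^ (-1))).
    exact: measurable_powR.
  exact: measurable_funM.
exact: (measurableT_comp mV).
Qed.

Definition to_RV (P : probability T R) (f : T -> R) (mf : measurable_fun setT f) :
  {RV P >-> R} := HB.pack_for {mfun T >-> R} f (isMeasurableFun.Build _ _ _ _ f mf).

Definition normalize n (x : n.-tuple R) : n.-tuple R :=
  [tuple tnth x j / \sum_(k < n) tnth x k | j < n].

Lemma measurable_mktuple n (f : 'I_n -> T -> R) :
  (forall j, measurable_fun setT (f j)) ->
  measurable_fun setT (fun w => [tuple f j w | j < n]).
Proof.
move=> mf; apply/measurable_fun_tnthP => j.
by rewrite (_ : _ \o _ = f j)//; apply/funext => w /=; rewrite tnth_mktuple.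
Qed.

End measurability.

Lemma measurable_normalize (R : realType) n : measurable_fun setT (@normalize R n).
Proof.
apply/measurable_mktuple => j; apply: measurable_funM; first exact: measurable_tnth.
by apply/measurable_funV/measurable_sum => k; exact: measurable_tnth.
Qed.

Section joint_law.
Local Open Scope ereal_scope.
Context (R : realType) d1 (T1 : measurableType d1) d2 (T2 : measurableType d2).
Variables (Q1 : probability T1 R) (Q2 : probability T2 R) (n : nat).
Variables (Z1 : 'I_n -> T1 -> R) (Z2 : 'I_n -> T2 -> R).
Hypotheses (mZ1 : forall j, measurable_fun setT (Z1 j)).
Hypotheses (mZ2 : forall j, measurable_fun setT (Z2 j)).
Hypothesis iZ1 : mutually_independent Q1 setT (fun j => sigma_var (Z1 j)).
Hypothesis iZ2 : mutually_independent Q2 setT (fun j => sigma_var (Z2 j)).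
Hypothesis Z12 : forall j B, measurable B -> Q1 (Z1 j @^-1` B) = Q2 (Z2 j @^-1` B).

(** Rectangles form a pi-system that generates the product sigma-algebra, and on them independence
    expresses both laws by the marginals. The two families may live on different spaces. *)
Lemma eq_joint_law (B : set (n.-tuple R)) : measurable B ->
  Q1 ((fun w => [tuple Z1 j w | j < n]) @^-1` B) =
  Q2 ((fun w => [tuple Z2 j w | j < n]) @^-1` B).
Proof.
move=> mB.
have mT1 := measurable_mktuple mZ1.
have mT2 := measurable_mktuple mZ2.
pose rect (A : 'I_n -> set R) : set (n.-tuple R) := [set x | forall j, A j (tnth x j)].
pose G := [set C | exists2 A, (forall j, measurable (A j)) & C = rect A].
have rectE (A : 'I_n -> set R) d (T : measurableType d) (Z : 'I_n -> T -> R) :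
    (fun w => [tuple Z j w | j < n]) @^-1` (rect A) =
    \bigcap_(j in [set` enum 'I_n]) (Z j @^-1` A j).
  apply/seteqP; split=> w /= Aw j; first by have := Aw j; rewrite tnth_mktuple.
  by rewrite tnth_mktuple; apply: Aw; rewrite /= mem_enum.
have mrect A : (forall j, measurable (A j)) -> measurable (rect A).
  move=> mA; rewrite (_ : rect A = \bigcap_(j in [set` enum 'I_n]) ((@tnth n R ^~ j) @^-1` A j)).
    rewrite bigcap_seq; apply: bigsetI_measurable => j _.
    by rewrite -[X in measurable X]setTI; exact: measurable_tnth.
  apply/seteqP; split=> x /= Ax j; first by move=> _; exact: Ax.
  by apply: Ax; rewrite /= mem_enum.
apply: (@measure_unique _ R _ G (fun=> setT) _ _ _ _
  (measure_function_pushforward__canonical__measure_function_Measure Q1 mT1)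
  (measure_function_pushforward__canonical__measure_function_Measure Q2 mT2)) => //.
- apply/seteqP; split; last first.
    apply: smallest_sub; first exact: sigma_algebra_measurable.
    by move=> _ [A mA ->]; exact: mrect.
  apply: smallest_sub; first exact: smallest_sigma_algebra.
  move=> C; rewrite -bigcup_seq/= => -[i _ [A mA <-]]; apply: sub_sigma_algebra.
  (* A generator of the product sigma-algebra constrains one coordinate: it is a rectangle with all
     other sides full. *)
  exists (fun j => if j == i then A else setT); first by move=> j; case: ifP.
  rewrite setTI; apply/seteqP; split=> x /=.
    by move=> Ax j; case: eqP => // ->.
  by move=> /(_ i); rewrite eqxx.
- move=> _ _ [A1 mA1 ->] [A2 mA2 ->]; exists (fun j => A1 j `&` A2 j).
    by move=> j; exact: measurableI.
  by apply/seteqP; split=> x /= => [[A1x A2x] j|Ax]; [|split=> j; have [] := Ax j].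
- by move=> k; exists (fun=> setT) => //; apply/seteqP; split.
- by rewrite bigcup_const.
- move=> _ [A mA ->]; rewrite /= /pushforward !rectE iZ1 ?enum_uniq// ?iZ2 ?enum_uniq//.
  + by congr (_%:E); apply: eq_bigr => j _; rewrite Z12.
  + by move=> j _; exists (A j).
  + by move=> j _; exists (A j).
- by move=> k; rewrite /= /pushforward preimage_setT probability_setT ltry.
Qed.

End joint_law.

Section gamma_norm.
Context (R : realType).

Lemma gamma_law_norm (a : R) (B : set R) :
  gamma_law a ((fun x : R => `|x|) @^-1` B) = gamma_law a B.
Proof.
rewrite /gamma_law; case: ifPn => _.
  rewrite /dirac/= !indicE; congr (_%:R%:E); congr nat_of_bool.
  by apply/idP/idP; rewrite !in_setE /= normr0.
rewrite /density_law; congr ((_ / _)%:E).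
congr (\int[lebesgue_measure]_(x in _) _).
by apply/seteqP; split=> x /=; rewrite in_itv/= andbT => -[+ x_gt0]; rewrite gtr0_norm.
Qed.

Lemma mutually_independent_sub d (Omega : measurableType d) (Q : probability Omega R)
    (I : eqType) (D : set I) (G G' : I -> set (set Omega)) :
  (forall i, D i -> G' i `<=` G i) -> mutually_independent Q D G ->
  mutually_independent Q D G'.
Proof.
move=> GG' GD s A us sD GA; apply: GD => // i si.
by apply: GG'; [exact: sD|exact: GA].
Qed.

Lemma sigma_var_comp d (Omega : measurableType d) (X : Omega -> R) (phi : R -> R) :
  measurable_fun setT phi -> sigma_var (phi \o X) `<=` sigma_var X.
Proof.
move=> mphi _ [B mB <-]; exists (phi @^-1` B); last by rewrite comp_preimage.
by rewrite -[X in measurable X]setTI; exact: mphi.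
Qed.

(** Gamma variables are nonnegative only almost surely. Replacing each by its absolute value keeps
    the laws and the independence, and makes them usable as weights at every point. *)
Lemma has_dirichlet_law_ge0 d (Omega : measurableType d) (Q : probability Omega R)
    n (X : Omega -> n.-tuple R) (a : 'I_n -> R) : has_dirichlet_law Q X a ->
  exists d' (Omega' : measurableType d') (Q' : probability Omega' R)
    (Z : 'I_n -> {RV Q' >-> R}),
  [/\ mutually_independent Q' setT (fun j => sigma_var (Z j)),
      forall j, has_law Q' (Z j) (gamma_law (a j)),
      forall j w, 0 <= Z j w &
      forall B : set (n.-tuple R), measurable B ->
        Q (X @^-1` B) = Q' ((fun w => normalize [tuple Z j w | j < n]) @^-1` B)].
Proof.
case=> d'; case=> Omega'; case=> Q'; case=> Z; case=> iZ lZ XZ.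
have mZ j : measurable_fun setT (Z j) by exact: measurable_funP.
have mnZ j : measurable_fun setT (fun w => `|Z j w|) by exact: measurableT_comp.
have nZ_law j : has_law Q' (fun w => `|Z j w|) (gamma_law (a j)).
  move=> B mB; rewrite -gamma_law_norm -lZ//.
  by rewrite -[X in measurable X]setTI; exact: normr_measurable.
have inZ : mutually_independent Q' setT (fun j => sigma_var (fun w => `|Z j w|)).
  apply: mutually_independent_sub iZ => j _; apply: sigma_var_comp.
  exact: normr_measurable.
exists d', Omega', Q', (fun j => to_RV Q' (mnZ j)); split => //.
  by move=> j w /=; exact: normr_ge0.
move=> B mB; rewrite XZ//.
have mNB : measurable (@normalize R n @^-1` B).
  by rewrite -[X in measurable X]setTI; exact: measurable_normalize.
transitivity (Q' ((fun w => [tuple Z j w | j < n]) @^-1` (@normalize R n @^-1` B))).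
  congr (Q' _); apply/seteqP; split=> w /=.
    congr B; apply: eq_mktuple => j; rewrite tnth_mktuple; congr (_ / _).
    by apply: eq_bigr => k _; rewrite tnth_mktuple.
  congr B; apply: eq_mktuple => j; rewrite tnth_mktuple; congr (_ / _).
  by apply: eq_bigr => k _; rewrite tnth_mktuple.
apply: eq_joint_law => // j C mC.
by rewrite lZ// nZ_law.
Qed.

End gamma_norm.

(** * Successive reweightings and exponential difference quotients *)

Section reweighted_chain.
Local Open Scope ereal_scope.
Context (R : realType) d (Omega : measurableType d).
Implicit Types (Q : probability Omega R) (g : Omega -> R).

Lemma integral1 Q (C : set Omega) : measurable C -> \int[Q]_(w in C) 1%:E = Q C.
Proof. by move=> mC; rewrite -[RHS]mul1e -integral_cst. Qed.

Lemma integral_pos_gt0 Q g : measurable_fun setT g -> (forall w, 0 < g w)%R ->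
  0 < \int[Q]_w (g w)%:E.
Proof.
move=> mg g_gt0; have I_ge0 : 0 <= \int[Q]_w (g w)%:E.
  by apply: integral_ge0 => w _; rewrite lee_fin ltW.
rewrite lt_neqAle I_ge0 andbT; apply/eqP => I0.
have : \int[Q]_(w in setT) `|(g w)%:E| = 0.
  by rewrite I0; apply: eq_integral => w _; rewrite gee0_abs// lee_fin ltW.
have mgE : measurable_fun setT (fun w => (g w)%:E) by exact/measurable_EFinP.
move=> /(ae_eq_integral_abs Q measurableT mgE)[N [mN QN0 subN]].
have NT : N = setT.
  apply/seteqP; split=> // w _; apply: subN => /= /(_ I)[gw].
  by have := g_gt0 w; rewrite gw ltxx.
have QN1 : Q N = 1 by rewrite NT probability_setT.
by have /eqP := etrans (esym QN0) QN1; rewrite eqe eq_sym oner_eq0.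
Qed.

Lemma integral_le1_lty Q g : measurable_fun setT g -> (forall w, 0 <= g w <= 1)%R ->
  \int[Q]_w (g w)%:E < +oo.
Proof.
move=> mg g01; apply: (@le_lt_trans _ _ (\int[Q]_w 1%:E)).
  apply: ge0_le_integral => //.
  - by move=> w _; rewrite lee_fin; have /andP[] := g01 w.
  - exact/measurable_EFinP.
  - by move=> w _; rewrite lee_fin; have /andP[] := g01 w.
by rewrite integral1// probability_setT ltry.
Qed.

Lemma reweighted_refl Q : reweighted Q Q measurable (cst 1%R).
Proof. by exists 1%R => // C mC; rewrite mul1e -integral1. Qed.

Lemma reweighted_integral Q0 Q1 g1 g2 (z : R) C :
  measurable_fun setT g1 -> measurable_fun setT g2 ->
  (forall w, 0 <= g1 w)%R -> (forall w, 0 <= g2 w)%R -> (0 < z)%R ->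
  (forall B, measurable B -> z%:E * Q1 B = \int[Q0]_(w in B) (g1 w)%:E) ->
  measurable C -> z%:E * \int[Q1]_(w in C) (g2 w)%:E = \int[Q0]_(w in C) (g2 w * g1 w)%:E.
Proof.
move=> mg1 mg2 g1_ge0 g2_ge0 z_gt0 Q01 mC.
have mh : measurable_fun setT (fun w => g1 w / z)%R by exact: measurable_funM.
have h_ge0 w : (0 <= g1 w / z)%R by rewrite divr_ge0// ltW.
rewrite (@transfer_integral _ _ _ _ _ Q1 Q0 _ _ _ _ _ mC mC mg2 mg2 mh)//.
  rewrite -ge0_integralZl_EFin//.
  - apply: eq_integral => w _; rewrite -EFinM; congr (_%:E); field.
    by rewrite gt_eqF.
  - by move=> w _; rewrite lee_fin mulr_ge0.
  - by apply/measurable_EFinP/measurable_funTS; exact: measurable_funM.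
  - exact: ltW.
move=> B mB; apply: (mule_pinjl z_gt0).
have mCB : measurable (C `&` g2 @^-1` B).
  by apply: measurableI => //; rewrite -[X in measurable X]setTI; exact: mg2.
rewrite Q01// -ge0_integralZl_EFin//.
- apply: eq_integral => w _; rewrite -EFinM; congr (_%:E); field.
  by rewrite gt_eqF.
- by move=> w _; rewrite lee_fin.
- exact/measurable_EFinP/measurable_funTS.
- exact: ltW.
Qed.

Lemma reweighted_trans Q0 Q1 Q2 g1 g2 :
  measurable_fun setT g1 -> measurable_fun setT g2 ->
  (forall w, 0 <= g1 w)%R -> (forall w, 0 <= g2 w)%R ->
  reweighted Q0 Q1 measurable g1 -> reweighted Q1 Q2 measurable g2 ->
  reweighted Q0 Q2 measurable (fun w => g2 w * g1 w)%R.
Proof.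
move=> mg1 mg2 g1_ge0 g2_ge0 [z1 z1_gt0 Q01] [z2 z2_gt0 Q12].
exists (z1 * z2)%R => [|C mC]; first exact: mulr_gt0.
by rewrite EFinM -muleA Q12//; exact: reweighted_integral.
Qed.

(** Splits a product weight: the passage to [Q1] absorbs [g1], and [g2] remains. The first
    reweighting holds on all measurable sets, so that integrals of [g2] under [Q1] can be computed
    under [Q0]. *)
Lemma reweighted_divr Q0 Q1 Q2 H g1 g2 : H `<=` measurable ->
  measurable_fun setT g1 -> measurable_fun setT g2 ->
  (forall w, 0 <= g1 w)%R -> (forall w, 0 <= g2 w)%R ->
  reweighted Q0 Q1 measurable g1 -> reweighted Q0 Q2 H (fun w => g2 w * g1 w)%R ->
  reweighted Q1 Q2 H g2.
Proof.
move=> Hm mg1 mg2 g1_ge0 g2_ge0 [z1 z1_gt0 Q01] [z2 z2_gt0 Q02].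
exists (z2 / z1)%R => [|C HC]; first exact: divr_gt0.
apply: (mule_pinjl z1_gt0); rewrite muleA -EFinM mulrCA mulfV ?gt_eqF// mulr1 Q02//.
by apply/esym; apply: reweighted_integral => //; exact: Hm.
Qed.

(** With [y = S / (n + 1)], the inequality [1 + y <= exp y] bounds the integrand between
    [S / (1 + y)] and [S]: this gives pointwise convergence by squeezing, and domination by the
    integrable [S]. *)
Lemma integral_expR_lim Q (C : set Omega) (S : Omega -> R) : measurable C ->
  measurable_fun setT S -> (forall w, 0 <= S w)%R -> \int[Q]_w (S w)%:E < +oo ->
  \int[Q]_(w in C) (n.+1%:R * (1 - expR (- (harmonic n * S w))))%:E @[n --> \oo] -->
  \int[Q]_(w in C) (S w)%:E.
Proof.
move=> mC mS S_ge0 S_lty.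
have SN (n : nat) w : (n.+1%:R * (1 - expR (- (harmonic n * S w))) <= S w)%R.
  rewrite -ler_pdivlMl// lerBlDr -lerBlDl.
  by have := expR_ge1Dx (- (harmonic n * S w)); rewrite /harmonic.
have lN (n : nat) w : (S w / (1 + harmonic n * S w) <=
    n.+1%:R * (1 - expR (- (harmonic n * S w))))%R.
  have y_ge0 : (0 <= harmonic n * S w)%R by rewrite mulr_ge0// harmonic_ge0.
  have y1_gt0 : (0 < 1 + harmonic n * S w)%R by rewrite ltr_pwDl.
  rewrite -ler_pdivrMl// lerBrDr -lerBrDl.
  rewrite (_ : (1 - _ = (1 + harmonic n * S w)^-1)%R).
    by rewrite expRN lef_pV2 ?posrE ?expR_gt0// expR_ge1Dx.
  rewrite mulrA -[(_ * S w)%R]/(harmonic n * S w)%R.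
  by move: (harmonic n * S w)%R y1_gt0 => y y1_gt0; field; rewrite gt_eqF.
have mf_ n : measurable_fun C (fun w => (n.+1%:R * (1 - expR (- (harmonic n * S w))))%:E).
  apply/measurable_EFinP/measurable_funTS/measurable_funM => //.
  apply: measurable_funB => //; apply: measurableT_comp => //.
  by apply: measurableT_comp => //; exact: measurable_funM.
have mSC : measurable_fun C (fun w => (S w)%:E) by exact/measurable_EFinP/measurable_funTS.
have ge0 (n : nat) w : (0 <= n.+1%:R * (1 - expR (- (harmonic n * S w))))%R.
  rewrite mulr_ge0// subr_ge0 -expR0 ler_expR oppr_le0.
  by rewrite mulr_ge0// harmonic_ge0.
have [] // := @dominated_convergence _ _ _ Q C mC
  (fun n w => (n.+1%:R * (1 - expR (- (harmonic n * S w))))%:E)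
  (fun w => (S w)%:E) (fun w => (S w)%:E) mf_ mSC.
- apply: aeW => w _; apply: cvg_EFin; first exact: nearW.
  apply: (@squeeze_cvgr _ _ _ _ (fun n => S w / (1 + harmonic n * S w))%R (cst (S w))).
  + by apply: nearW => n /=; rewrite lN SN.
  + rewrite -[X in _ --> X]divr1 -[X in (_ / X)%R](addr0 1%R) -[X in (1 + X)%R](mul0r (S w)).
    apply: cvgM; first exact: cvg_cst.
    apply: cvgV; first by rewrite mul0r addr0 oner_eq0.
    apply: cvgD; first exact: cvg_cst.
    by apply: cvgM; [exact: cvg_harmonic|exact: cvg_cst].
  + exact: cvg_cst.
- apply/integrableP; split => //.
  apply: le_lt_trans S_lty; under eq_integral do rewrite gee0_abs ?lee_fin//.
  apply: ge0_subset_integral => //; first exact/measurable_EFinP.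
  by move=> w _; rewrite lee_fin.
- apply: aeW => w n _ /=; rewrite ger0_norm ?lee_fin; [exact: SN|exact: ge0].
Qed.

End reweighted_chain.

(** * Reweighted Dirichlet laws *)

Section gamma_family.
Local Open Scope ereal_scope.
Context (R : realType) d (Omega : measurableType d) (Q : probability Omega R) (n : nat).
Variables (Z : 'I_n -> {RV Q >-> R}) (a : 'I_n -> R).
Hypothesis iZ : mutually_independent Q setT (fun j => sigma_var (Z j)).
Hypothesis lZ : forall j, has_law Q (Z j) (gamma_law (a j)).
Hypothesis Z_ge0 : forall j w, (0 <= Z j w)%R.

Let S w : R := (\sum_(k < n) Z k w)%R.
Let W w : n.-tuple R := normalize [tuple Z j w | j < n].

Let mZ j : measurable_fun setT (Z j). Proof. exact: measurable_funP. Qed.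
Let mS : measurable_fun setT S. Proof. by apply: measurable_sum => k; exact: mZ. Qed.
Let mW : measurable_fun setT W.
Proof. exact: (measurableT_comp (@measurable_normalize R n) (measurable_mktuple mZ)). Qed.
Let S_ge0 w : (0 <= S w)%R. Proof. by apply: sumr_ge0 => k _; exact: Z_ge0. Qed.

Let mpre d' (T : measurableType d') (X : Omega -> T) B :
  measurable_fun setT X -> measurable B -> measurable (X @^-1` B).
Proof. by move=> mX mB; rewrite -[X in measurable X]setTI; exact: mX. Qed.

Let sigmaZ_sub j : setT j -> sigma_var (Z j) `<=` measurable.
Proof. by move=> _ _ [B mB <-]; exact: mpre. Qed.

Let sigmaZT j : sigma_var (Z j) setT.
Proof. by exists setT => //; rewrite preimage_setT. Qed.

Let sigmaZI j (phi : R -> R) A B : measurable_fun setT phi ->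
  sigma_var (Z j) A -> measurable B -> sigma_var (Z j) (A `&` (phi \o Z j) @^-1` B).
Proof.
move=> mphi [C mC <-] mB; exists (C `&` phi @^-1` B) => //.
by apply: measurableI => //; rewrite -[X in measurable X]setTI; exact: mphi.
Qed.

Let mexp (l : R) j : measurable_fun setT (fun w => expR (- (l * Z j w)))%R.
Proof.
apply: measurableT_comp => //; apply: measurableT_comp => //.
exact: measurable_funM.
Qed.

(** The weight is a product of functions of single variables, so it is applied one index at a time.
    Each tilt keeps independence and changes the law of that variable only; the list [r] records the
    indices already tilted. *)
Let scaled_gamma (l : R) (r : seq 'I_n) : (0 < l)%R -> uniq r ->
  exists Q' : probability Omega R,
  [/\ reweighted Q Q' measurable (fun w => expR (- (l * \sum_(k <- r) Z k w)))%R,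
      mutually_independent Q' setT (fun j => sigma_var (Z j)) &
      forall j, has_law Q' (fun w => if j \in r then (1 + l) * Z j w else Z j w)%R
        (gamma_law (a j))].
Proof.
move=> l_gt0; elim: r => [_|i r IHr /= /andP[ir ur]].
  exists Q; split => //.
  under [X in reweighted _ _ _ X]eq_fun do rewrite big_nil mulr0 oppr0 expR0.
  exact: reweighted_refl.
have [Q1 [Q01 iQ1 lQ1]] := IHr ur.
pose phi (x : R) := expR (- (l * x))%R.
have mphi : measurable_fun setT phi.
  by apply: measurableT_comp => //; apply: measurableT_comp => //; exact: measurable_funM.
have exp_gt0 w : (0 < expR (- (l * Z i w)))%R by exact: expR_gt0.
have exp_ge0 w := ltW (exp_gt0 w).
have [Q2 Q12] : exists Q2, reweighted Q1 Q2 measurable (phi \o Z i).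
  apply: reweighted_exists => //; first exact: mexp.
  rewrite integral_pos_gt0 ?integral_le1_lty//; do ?exact: mexp.
  move=> w; rewrite /phi /= expR_ge0/= -expR0 ler_expR oppr_le0.
  by rewrite mulr_ge0// ltW.
exists Q2; split.
- rewrite (_ : (fun w => _) = (fun w => (phi \o Z i) w * expR (- (l * \sum_(k <- r) Z k w)))%R).
    apply: reweighted_trans Q12 => //.
    + apply: measurableT_comp => //; apply: measurableT_comp => //.
      by apply: measurable_funM => //; apply: measurable_sum => k; exact: mZ.
    + exact: mexp.
  by apply/funext => w; rewrite /phi/= big_cons mulrDr opprD expRD.
- apply: (@reweighted_mutually_independent _ _ _ Q1 Q2 _ _ _ measurable (phi \o Z i) _ _ _ _ _ _ i) => //.
  + by move=> A B; exact: measurableI.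
  + exact: mexp.
  + by move=> A B; exact: sigmaZI.
- move=> j; have [->|ji] := eqVneq j i.
    under [X in has_law _ X]eq_fun do rewrite mem_head.
    apply: (@reweighted_gamma_scale _ _ _ Q1 Q2 (Z i) measurable) => //.
      by move=> B mB; exact: mpre.
    by have := lQ1 i; rewrite (negbTE ir).
  move=> B mB; rewrite -lQ1//.
  have -> : (fun w => if j \in i :: r then (1 + l) * Z j w else Z j w)%R =
            (fun w => if j \in r then (1 + l) * Z j w else Z j w)%R.
    by apply/funext => w; rewrite inE (negbTE ji).
  apply: (@reweighted_mutually_indep_eq _ _ _ Q1 Q2 _ setT (fun j => sigma_var (Z j)) measurable
    (phi \o Z i) _ _ _ _ _ _ i _ _ _ _ _ j) => //.
  + by move=> ? ?; exact: measurableI.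
  + exact: mexp.
  + by move=> ? ?; exact: sigmaZI.
  + case: (j \in r); last by exists B.
    exists ((fun x => (1 + l) * x)%R @^-1` B) => //.
    by rewrite -[X in measurable X]setTI; apply: measurable_funM.
Qed.

Let gamma_sum_indep_exp (l : R) B : (0 < l)%R -> measurable B ->
  \int[Q]_(w in W @^-1` B) (expR (- (l * S w)))%:E =
  Q (W @^-1` B) * \int[Q]_w (expR (- (l * S w)))%:E.
Proof.
move=> l_gt0 mB.
have [Q' [[z z_gt0 QQ'] iQ' lQ']] := scaled_gamma l_gt0 (index_enum_uniq 'I_n).
(* The vector [(1 + l) Z] under [Q'] has the joint law of [Z] under [Q], and normalisation cancels
   the common factor. *)
have QWB : Q' (W @^-1` B) = Q (W @^-1` B).
  have mlZ j : measurable_fun setT (fun w => (1 + l) * Z j w)%R by exact: measurable_funM.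
  have mNB : measurable (@normalize R n @^-1` B).
    by rewrite -[X in measurable X]setTI; exact: measurable_normalize.
  transitivity (Q' ((fun w => [tuple (1 + l) * Z j w | j < n])%R @^-1` (@normalize R n @^-1` B))).
    congr (Q' _); apply/seteqP; suff WE w :
      normalize [tuple (1 + l) * Z j w | j < n]%R = W w.
      by split=> w /=; rewrite WE.
    apply: eq_mktuple => j; rewrite !tnth_mktuple.
    under eq_bigr do rewrite tnth_mktuple.
    under [in RHS]eq_bigr do rewrite tnth_mktuple.
    rewrite -mulr_sumr invfM mulrACA mulfV ?mul1r//.
    by rewrite gt_eqF// addr_gt0.
  apply: eq_joint_law => //.
    apply: mutually_independent_sub iQ' => j _; apply: (@sigma_var_comp _ _ _ (Z j) (fun x => (1 + l) * x)%R).
    exact: measurable_funM.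
  move=> j C mC; rewrite [RHS]lZ// -(lQ' j)//; congr (Q' _).
  by under [X in _ = X @^-1` _]eq_fun do rewrite mem_index_enum.
have := QQ' _ measurableT; rewrite probability_setT mule1 => <-.
by rewrite muleC -QWB; apply/esym/QQ'; exact: mpre.
Qed.

Lemma gamma_sum_lty : \int[Q]_w (S w)%:E < +oo.
Proof.
rewrite /S; under eq_integral do rewrite -sumEFin.
rewrite ge0_integral_sum//; last 2 first.
- by move=> k; apply/measurable_EFinP; exact: mZ.
- by move=> k w _; rewrite lee_fin.
by apply: lte_sum_pinfty => k _; exact: (gamma_integral_lty (mZ k) (Z_ge0 k) (lZ k)).
Qed.

(* [W] is homogeneous of degree 0 in [Z], and the law of a Gamma variable [Z]
   reweighted by [exp (- l Z)] is that of [Z / (1 + l)]: hence [W] is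
   uncorrelated with [exp (- l S)], and with [S] by differentiation at 0. *)
Lemma gamma_sum_indep B : measurable B ->
  \int[Q]_(w in W @^-1` B) (S w)%:E = Q (W @^-1` B) * \int[Q]_w (S w)%:E.
Proof.
move=> mB; have mWB : measurable (W @^-1` B) by exact: mpre.
have QWB_fin : Q (W @^-1` B) \is a fin_num by rewrite fin_num_measure.
have lim1 := integral_expR_lim mWB mS S_ge0 gamma_sum_lty.
have := integral_expR_lim measurableT mS S_ge0 gamma_sum_lty.
move=> /(cvgeZl QWB_fin) lim2.
pose e (k : nat) w := expR (- (harmonic k * S w)) : R.
have me k : measurable_fun setT (e k).
  by apply: measurableT_comp => //; apply: measurableT_comp => //; exact: measurable_funM.
have e01 k w : (0 <= e k w <= 1)%R.
  rewrite expR_ge0/= -expR0 ler_expR oppr_le0 mulr_ge0//.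
  exact: harmonic_ge0.
have e_ge0 k w : (0 <= e k w)%R by have /andP[] := e01 k w.
have e1_ge0 k w : (0 <= 1 - e k w)%R by rewrite subr_ge0; have /andP[] := e01 k w.
have e_fin k C : measurable C -> \int[Q]_(w in C) (e k w)%:E \is a fin_num.
  move=> mC; rewrite ge0_fin_numE; last by apply: integral_ge0 => w _; rewrite lee_fin.
  apply: le_lt_trans (integral_le1_lty Q (me k) (e01 k)).
  apply: ge0_subset_integral => //; first exact/measurable_EFinP.
  by move=> w _; rewrite lee_fin.
have e1E k C : measurable C ->
    \int[Q]_(w in C) (1 - e k w)%:E = Q C - \int[Q]_(w in C) (e k w)%:E.
  move=> mC; rewrite -(integral1 Q mC).
  transitivity (\int[Q]_(w in C) (1 - e k w)%:E + \int[Q]_(w in C) (e k w)%:E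
    - \int[Q]_(w in C) (e k w)%:E); first by rewrite addeK ?e_fin.
  rewrite -ge0_integralD//.
  - congr (_ - _); apply: eq_integral => w _; rewrite -EFinD; congr (_%:E).
    by rewrite subrK.
  - by move=> w _; rewrite lee_fin.
  - by apply/measurable_EFinP/measurable_funTS; exact: measurable_funB.
  - by move=> w _; rewrite lee_fin.
  - exact/measurable_EFinP/measurable_funTS.
have cE k C : measurable C -> \int[Q]_(w in C) (k.+1%:R * (1 - e k w))%:E =
    k.+1%:R%:E * \int[Q]_(w in C) (1 - e k w)%:E.
  move=> mC; rewrite -ge0_integralZl_EFin//.
  - by move=> w _; rewrite lee_fin.
  - by apply/measurable_EFinP/measurable_funTS; exact: measurable_funB.
(* The two difference quotients agree for every [k], so their limits do. *)
apply: (cvg_unique _ lim1) => //; move: lim2.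
rewrite (_ : (fun k => _ * _) = (fun k => \int[Q]_(w in W @^-1` B)
    (k.+1%:R * (1 - expR (- (harmonic k * S w))))%:E))//.
apply/funext => k; rewrite [RHS]cE// [X in _ * X]cE//.
rewrite muleCA; congr (_ * _).
rewrite !e1E// gamma_sum_indep_exp ?harmonic_gt0//.
by rewrite probability_setT muleBr// ?mule1// fin_num_adde_defl// fin_numN e_fin.
Qed.

End gamma_family.

(** The sets fixing [Y] in [B] and [Z] in [C] form a pi-system generating a sigma-algebra for which
    [Y + Z] is measurable. *)
Lemma setI_indep_add (R : realType) d (Omega : measurableType d)
    (Q : probability Omega R) (A : set Omega)
    (Y Z : Omega -> R) : measurable A ->
  measurable_fun setT Y -> measurable_fun setT Z ->
  (forall B C, measurable B -> measurable C ->
    (Q (A `&` (Y @^-1` B `&` Z @^-1` C)) = Q A * Q (Y @^-1` B `&` Z @^-1` C))%E) ->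
  forall B, measurable B -> (Q (A `&` (fun w => Y w + Z w)%R @^-1` B) =
    Q A * Q ((fun w => Y w + Z w)%R @^-1` B))%E.
Proof.
have mpre (X : Omega -> R) B : measurable_fun setT X -> measurable B -> measurable (X @^-1` B).
  by move=> mX mB; rewrite -[X in measurable X]setTI; exact: mX.
move=> mA mY mZ AYZ B mB.
pose H := [set D | exists B C, [/\ measurable B, measurable C & D = Y @^-1` B `&` Z @^-1` C]].
have HE : independent Q [set A] <<s H >>.
  apply: independent_g_sigma.
  - by move=> _ ->.
  - by move=> _ [B1 [C1 [mB1 mC1 ->]]]; apply: measurableI; exact: mpre.
  - move=> _ _ [B1 [C1 [mB1 mC1 ->]]] [B2 [C2 [mB2 mC2 ->]]].
    exists (B1 `&` B2), (C1 `&` C2); split; try exact: measurableI.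
    by rewrite !preimage_setI setIACA.
  - by move=> _ _ -> [B1 [C1 [mB1 mC1 ->]]]; exact: AYZ.
apply: HE => //.
pose T := g_sigma_algebraType H.
have mY' : measurable_fun setT (Y : T -> R).
  move=> _ C mC; rewrite setTI; apply: sub_sigma_algebra.
  by exists C, setT; split => //; rewrite preimage_setT setIT.
have mZ' : measurable_fun setT (Z : T -> R).
  move=> _ C mC; rewrite setTI; apply: sub_sigma_algebra.
  by exists setT, C; split => //; rewrite preimage_setT setTI.
have mYZ : measurable_fun setT (fun w : T => Y w + Z w)%R by exact: measurable_funD.
by have := mYZ measurableT B mB; rewrite setTI.
Qed.

Section dirichlet.
Local Open Scope ereal_scope.
Context (R : realType) d (Omega : measurableType d).

Let mpre d1 (T1 : measurableType d1) d2 (T2 : measurableType d2) (X : T1 -> T2) B :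
  measurable_fun setT X -> measurable B -> measurable (X @^-1` B).
Proof. by move=> mX mB; rewrite -[X in measurable X]setTI; exact: mX. Qed.

(** The reweighting is carried to the space of the gamma variables, where the weight becomes [W k];
    up to the constant [ES] it may be replaced by [Z k] as far as [W] is concerned, and [Q3] is the
    reweighting by [Z k]. *)
Lemma reweighted_dirichlet (Q1 Q2 : probability Omega R) n
    (X : Omega -> n.-tuple R) (a : 'I_n -> R) (k : 'I_n) (H : set (set Omega)) :
  measurable_fun setT X -> (forall w, 0 <= tnth (X w) k)%R ->
  (forall B, measurable B -> H (X @^-1` B)) -> (forall j, 0 <= a j)%R ->
  reweighted Q1 Q2 H (fun w => tnth (X w) k) ->
  has_dirichlet_law Q1 X a ->
  (0 < a k)%R /\ has_dirichlet_law Q2 X (fun j => a j + (j == k)%:R)%R.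
Proof.
move=> mX X_ge0 HX a_ge0 [z z_gt0 Q12] /has_dirichlet_law_ge0.
case=> d'; case=> Omega'; case=> Q'; case=> Z [iZ lZ Z_ge0 XZ].
pose S w := (\sum_(j < n) Z j w)%R.
pose W w : n.-tuple R := normalize [tuple Z j w | j < n].
have mZ j : measurable_fun setT (Z j) by exact: measurable_funP.
have mS : measurable_fun setT S by apply: measurable_sum => j; exact: mZ.
have S_ge0 w : (0 <= S w)%R by apply: sumr_ge0 => j _; exact: Z_ge0.
have mW : measurable_fun setT W.
  exact: (measurableT_comp (@measurable_normalize R n) (measurable_mktuple mZ)).
have WE w j : tnth (W w) j = (Z j w / S w)%R.
  rewrite !tnth_mktuple; congr (_ / _)%R.
  by apply: eq_bigr => i _; rewrite tnth_mktuple.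
have mtnth d1 (T1 : measurableType d1) (Y : T1 -> n.-tuple R) j :
    measurable_fun setT Y -> measurable_fun setT (fun w => tnth (Y w) j).
  by move=> mY; exact: (measurableT_comp (measurable_tnth j) mY).
have Wk_ge0 w : (0 <= tnth (W w) k)%R by rewrite WE divr_ge0.
have Q1W B : measurable B ->
    z%:E * Q2 (X @^-1` B) = \int[Q']_(w in W @^-1` B) (tnth (W w) k)%:E.
  move=> mB; rewrite Q12; last exact: HX.
  rewrite (@transfer_integral _ _ _ _ _ Q1 Q' _ (W @^-1` B) _ (fun w => tnth (W w) k) (cst 1%R)).
  - by apply: eq_integral => w _; rewrite mulr1.
  - exact: mpre.
  - exact: mpre.
  - exact: mtnth.
  - exact: mtnth.
  - exact: measurable_cst.
  - by move=> w _; exact: X_ge0.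
  - by move=> w _; exact: Wk_ge0.
  - by [].
  move=> B' mB'.
  have mB2 : measurable ((fun x : n.-tuple R => tnth x k) @^-1` B').
    by apply: mpre => //; exact: measurable_tnth.
  transitivity (Q' (W @^-1` (B `&` (fun x : n.-tuple R => tnth x k) @^-1` B'))).
    by rewrite -XZ//; exact: measurableI.
  rewrite integral1//; apply: measurableI; first exact: mpre.
  by apply: mpre => //; exact: mtnth.
have ES_lty := gamma_sum_lty lZ Z_ge0.
have ES_fin : \int[Q']_w (S w)%:E \is a fin_num.
  by rewrite ge0_fin_numE//; apply: integral_ge0 => w _; rewrite lee_fin.
pose ES := fine (\int[Q']_w (S w)%:E).
have ES_ge0 : (0 <= ES)%R.
  by rewrite fine_ge0//; apply: integral_ge0 => w _; rewrite lee_fin.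
(* This also holds where [S] vanishes, for then the nonnegative [Z k] is 0. *)
have WS w : (tnth (W w) k * S w = Z k w)%R.
  rewrite WE; have [S0|S_neq0] := eqVneq (S w) 0%R; last by rewrite divfK.
  rewrite S0 mulr0; apply/esym/eqP; rewrite eq_le Z_ge0 andbT -S0.
  by rewrite /S (bigD1 k)//= lerDl sumr_ge0.
(* By [gamma_sum_indep], the density [S] multiplies the law of [W] by the constant [ES]. So the
   integral of [W k] under that density is [ES] times its integral under [Q'], and also the integral
   of [W k S = Z k]. *)
have ESW B : measurable B ->
    ES%:E * \int[Q']_(w in W @^-1` B) (tnth (W w) k)%:E = \int[Q']_(w in W @^-1` B) (Z k w)%:E.
  move=> mB; have mWB : measurable (W @^-1` B) by exact: mpre.
  have mWk := mtnth _ _ W k mW.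
  rewrite -ge0_integralZl_EFin//; last 2 first.
  - by move=> w _; rewrite lee_fin.
  - exact/measurable_EFinP/measurable_funTS.
  transitivity (\int[weighted Q' mS S_ge0]_(w in W @^-1` B) (tnth (W w) k)%:E).
    rewrite (@transfer_integral _ _ _ _ _ (weighted Q' mS S_ge0) Q' _ (W @^-1` B) _ (fun w => tnth (W w) k) (cst ES))//.
    - by apply: eq_integral => w _; rewrite -EFinM mulrC.
    - move=> B' mB'.
      have mBB' : measurable (B `&` (fun x : n.-tuple R => tnth x k) @^-1` B').
        by apply: measurableI => //; apply: mpre => //; exact: measurable_tnth.
      transitivity (\int[Q']_(w in W @^-1` (B `&` (fun x : n.-tuple R => tnth x k) @^-1` B')) (S w)%:E).
        by [].
      rewrite (gamma_sum_indep iZ lZ Z_ge0 mBB') -[X in _ * X]fineK// muleC -integral_cst//.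
      exact: mpre.
  rewrite (@transfer_integral _ _ _ _ _ (weighted Q' mS S_ge0) Q' _ (W @^-1` B) _ (fun w => tnth (W w) k) S)//.
  by apply: eq_integral => w _; rewrite WS.
have zE : z%:E = \int[Q']_w (tnth (W w) k)%:E.
  by have := Q1W _ measurableT; rewrite !preimage_setT probability_setT mule1.
have eE : \int[Q']_w (Z k w)%:E = (ES * z)%:E.
  by have := ESW _ measurableT; rewrite preimage_setT -zE -EFinM => <-.
(* Otherwise [Z k] would vanish almost everywhere, and so would [W k], whose mean is [z]. *)
have e_gt0 : (0 < ES * z)%R.
  rewrite lt_neqAle mulr_ge0// ?(ltW z_gt0)// andbT; apply/eqP => e0.
  have : \int[Q']_(w in setT) `|(Z k w)%:E| = 0.
    transitivity (\int[Q']_w (Z k w)%:E); last by rewrite eE -e0.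
    by apply: eq_integral => w _; rewrite gee0_abs// lee_fin.
  have mZE : measurable_fun setT (fun w => (Z k w)%:E) by exact/measurable_EFinP.
  move=> /(ae_eq_integral_abs Q' measurableT mZE) Zk0.
  have : \int[Q']_w (tnth (W w) k)%:E = \int[Q']_w 0.
    apply: ge0_ae_eq_integral => //.
    - by apply/measurable_EFinP; exact: mtnth.
    - by move=> w _; rewrite lee_fin.
    - apply: filterS Zk0 => w /= /[apply] -[Zk0].
      by rewrite WE Zk0 mul0r.
  rewrite integral0 -zE => /eqP; rewrite eqe => /eqP z0.
  by rewrite z0 ltxx in z_gt0.
have [Q3 Q'3] : exists Q3, reweighted Q' Q3 measurable (Z k).
  apply: reweighted_exists => //.
  by rewrite eE lte_fin e_gt0 ltry.
have sigmaZ_sub j : setT j -> sigma_var (Z j) `<=` measurable.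
  by move=> _ _ [B mB <-]; exact: mpre.
have sigmaZT : sigma_var (Z k) setT by exists setT => //; rewrite preimage_setT.
have sigmaZI A B : sigma_var (Z k) A -> measurable B -> sigma_var (Z k) (A `&` Z k @^-1` B).
  by move=> [C mC <-] mB; exists (C `&` B) => //; exact: measurableI.
have mI : setI_closed (@measurable _ Omega') by move=> ? ?; exact: measurableI.
have HZ B : measurable B -> measurable (Z k @^-1` B) by exact: mpre.
have [ak_gt0 lZk] := reweighted_gamma (mZ k) (Z_ge0 k) HZ (a_ge0 k) Q'3 (lZ k).
split=> //; exists d', Omega', Q3, Z; split.
- exact: (@reweighted_mutually_independent _ _ _ Q' Q3 _ setT (fun j => sigma_var (Z j)) measurable (Z k)
    (fun _ => id) mI measurableT sigmaZ_sub (mZ k) (Z_ge0 k) k I sigmaZT sigmaZI Q'3 iZ).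
- move=> j; have [->|jk] := eqVneq j k; first exact: lZk.
  rewrite addr0 => B mB; rewrite -lZ//.
  apply: (@reweighted_mutually_indep_eq _ _ _ Q' Q3 _ setT (fun j => sigma_var (Z j)) measurable (Z k)
    (fun _ => id) mI measurableT sigmaZ_sub (mZ k) (Z_ge0 k) k I sigmaZT sigmaZI Q'3 iZ j) => //.
  by exists B.
move=> B mB.
have QX3 : Q2 (X @^-1` B) = Q3 (W @^-1` B).
  apply: (mule_pinjl e_gt0); rewrite EFinM -muleA Q1W// ESW// -EFinM -eE.
  case: Q'3 => z3 _ Q'3; have := Q'3 _ measurableT; rewrite probability_setT mule1 => <-.
  by rewrite Q'3//; exact: mpre.
rewrite QX3; congr (Q3 _); apply/seteqP; suff WE' w :
  W w = [tuple Z j w / \sum_(k0 < n) Z k0 w | j < n]%R.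
  by split=> w /=; rewrite WE'.
by apply: eq_from_tnth => j; rewrite WE tnth_mktuple.
Qed.

(** Coordinate 0 is absorbed by coordinate [k] of the others. The total of the gamma variables does
    not change, so the normalised coordinates simply add, and [gamma_add] gives the merged law. *)
Lemma has_dirichlet_law_merge (Q : probability Omega R) n
    (X : Omega -> n.+1.-tuple R) (a : 'I_n.+1 -> R) (k : 'I_n) :
  measurable_fun setT X -> (forall j, 0 <= a j)%R -> has_dirichlet_law Q X a ->
  has_dirichlet_law Q
    (fun w => [tuple tnth (X w) (lift ord0 j) +
      (if j == k then tnth (X w) ord0 else 0) | j < n])%R
    (fun j => a (lift ord0 j) + (if j == k then a ord0 else 0))%R.
Proof.
move=> mX a_ge0 /has_dirichlet_law_ge0.
case=> d'; case=> Omega'; case=> Q'; case=> Z [iZ lZ Z_ge0 XZ].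
have iZE := (mutually_independentE _ _ _).1 iZ.
have mZ j : measurable_fun setT (Z j) by exact: measurable_funP.
pose Y (j : 'I_n) w := (Z (lift ord0 j) w + (if j == k then Z ord0 w else 0))%R.
have mY j : measurable_fun setT (Y j).
  apply: measurable_funD; first exact: mZ.
  by case: (j == k); [exact: mZ|exact: measurable_cst].
have Yk : Y k = (fun w => Z (lift ord0 k) w + Z ord0 w)%R.
  by apply/funext => w; rewrite /Y eqxx.
have sigmaY j A : j != k -> sigma_var (Y j) A -> sigma_var (Z (lift ord0 j)) A.
  move=> jk [B mB <-]; exists B => //; congr (_ @^-1` B).
  by apply/funext => w; rewrite /Y (negbTE jk) addr0.
have msY j A : sigma_var (Y j) A -> measurable A by move=> [B mB <-]; exact: mpre.
have iY : mutually_independent Q' setT (fun j => sigma_var (Y j)).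
  apply/mutually_independentE => s A us _ GA.
  (* Away from [k], the events are independent of the pair of variables to be merged;
     [setI_indep_add] extends this to their sum. *)
  have noK (r : seq 'I_n) : uniq r -> k \notin r ->
      (forall j, j \in r -> sigma_var (Y j) (A j)) ->
      Q' (\big[setI/setT]_(j <- r) A j) = (\prod_(j <- r) fine (Q' (A j)))%:E /\
      (forall B C, measurable B -> measurable C ->
       Q' (\big[setI/setT]_(j <- r) A j `&` (Z (lift ord0 k) @^-1` B `&` Z ord0 @^-1` C)) =
       (\prod_(j <- r) fine (Q' (A j)) * (fine (Q' (Z (lift ord0 k) @^-1` B)) *
          fine (Q' (Z ord0 @^-1` C))))%:E).
    move=> ur kr GAr.
    (* Events indexed by all [n + 1] variables: [A0] at index 0, [A1] at the shift of [k], and the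
       given ones elsewhere. *)
    pose A2 A1 (A0 : set Omega') i := oapp (fun j => if j == k then A1 else A j) A0 (unlift ord0 i).
    have A2l A1 A0' j : j \in r -> A2 A1 A0' (lift ord0 j) = A j.
      by rewrite /A2 liftK /=; case: eqP => // ->; rewrite (negbTE kr).
    have u2 : uniq (map (lift ord0) r) by rewrite map_inj_uniq//; exact: lift_inj.
    have G2 A1 A0' i : i \in map (lift ord0) r -> sigma_var (Z i) (A2 A1 A0' i).
      move=> /mapP[j jr ->]; rewrite A2l//; apply: sigmaY; last exact: GAr.
      by apply: contraNneq kr => <-.
    split.
      have := iZE (map (lift ord0) r) (A2 setT setT) u2 (fun _ _ => I) (G2 _ _).
      rewrite !big_map (eq_big_seq A) => [->|j jr]; last by rewrite A2l.
      by congr (_%:E); apply: eq_big_seq => j jr; rewrite A2l.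
    move=> B C mB mC.
    pose A3 := A2 (Z (lift ord0 k) @^-1` B) (Z ord0 @^-1` C).
    have A30 : A3 ord0 = Z ord0 @^-1` C by rewrite /A3 /A2 unlift_none.
    have A3k : A3 (lift ord0 k) = Z (lift ord0 k) @^-1` B by rewrite /A3 /A2 liftK /= eqxx.
    have u3 : uniq [:: ord0, lift ord0 k & map (lift ord0) r].
      rewrite /= u2 andbT inE negb_or; apply/andP; split.
        by rewrite neq_lift; apply/negP => /mapP[j _ /eqP]; rewrite (negbTE (neq_lift _ _)).
      by rewrite mem_map//; exact: lift_inj.
    have G3 i : i \in [:: ord0, lift ord0 k & map (lift ord0) r] -> sigma_var (Z i) (A3 i).
      rewrite !inE => /or3P[/eqP -> | /eqP -> |]; last exact: G2.
        by rewrite A30; exists C.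
      by rewrite A3k; exists B.
    have := iZE _ A3 u3 (fun _ _ => I) G3; rewrite !big_cons A30 A3k !big_map.
    rewrite (eq_big_seq A) => [|j jr]; last by rewrite /A3 A2l.
    rewrite setIA setIC (setIC (Z ord0 @^-1` C)) => ->.
    rewrite (eq_big_seq (fun j => fine (Q' (A j)))) => [|j jr]; last by rewrite /A3 A2l.
    by congr (_%:E); ring.
  have [ks|ks] := boolP (k \in s); last by have [] := noK s us ks GA.
  have ps := perm_to_rem ks.
  rewrite (perm_big _ ps)/= big_cons (perm_big _ ps)/= big_cons setIC.
  have kr : k \notin rem k s by rewrite mem_rem_uniq// !inE eqxx.
  have [Qr QrBC] := noK _ (rem_uniq k us) kr (fun j jr => GA j (mem_rem jr)).
  have nilA j : j \in [::] -> sigma_var (Y j) (A j) by [].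
  have [_ QBC] := noK [::] isT isT nilA.
  have [B mB AkE] := GA k ks.
  rewrite -AkE Yk (setI_indep_add _ (mZ (lift ord0 k)) (mZ ord0) _ mB).
  - rewrite Qr EFinM muleC; congr (_ * _).
    by rewrite fineK// fin_num_measure//; apply: mpre => //; exact: measurable_funD.
  - rewrite big_seq_cond; apply: bigsetI_measurable => j; rewrite andbT => jr.
    by apply: (msY j); exact/GA/(mem_rem jr).
  move=> B1 C1 mB1 mC1; rewrite QrBC// Qr EFinM; congr (_ * _).
  by have := QBC _ _ mB1 mC1; rewrite !big_nil setTI mul1r => ->.
exists d', Omega', Q', (fun j => to_RV Q' (mY j)); split.
- exact: iY.
- move=> j; have [->|jk] := eqVneq j k.
    rewrite -[X in has_law _ X]/(Y k) Yk.
    apply: gamma_add => //.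
    move=> _ _ [B mB <-] [C mC <-].
    pose A (i : 'I_n.+1) := if i == ord0 then Z ord0 @^-1` C else Z (lift ord0 k) @^-1` B.
    have := iZE [:: lift ord0 k; ord0] A isT (fun _ _ => I).
    rewrite !big_cons !big_nil setIT mulr1 /A eqxx eq_sym (negbTE (neq_lift _ _)) => ->.
      by rewrite EFinM !fineK// fin_num_measure//; exact: mpre.
    move=> i; rewrite !inE => /orP[] /eqP ->.
      by rewrite eq_sym (negbTE (neq_lift _ _)); exists B.
    by rewrite eqxx; exists C.
  rewrite addr0 (_ : (to_RV Q' (mY j) : _ -> _) = Z (lift ord0 j))//.
  by apply/funext => w; rewrite /= /Y (negbTE jk) addr0.
move=> B mB.
pose M (x : n.+1.-tuple R) := [tuple tnth x (lift ord0 j) +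
  (if j == k then tnth x ord0 else 0) | j < n]%R.
have mM : measurable_fun setT M.
  apply/measurable_mktuple => j; apply: measurable_funD; first exact: measurable_tnth.
  by case: (j == k); [exact: measurable_tnth|exact: measurable_cst].
rewrite -[LHS]/(Q (X @^-1` (M @^-1` B))) XZ; last exact: mpre.
congr (Q' _); apply/seteqP; suff ME w : M (normalize [tuple Z j w | j < n.+1]) =
    [tuple Y j w / \sum_(k0 < n) Y k0 w | j < n]%R.
  split=> w Bw.
    by have : B (M (normalize [tuple Z j w | j < n.+1])) := Bw; rewrite ME.
  by have : B [tuple Y j w / \sum_(k0 < n) Y k0 w | j < n]%R := Bw; rewrite -ME.
have SE : (\sum_(k0 < n) Y k0 w = \sum_(k0 < n.+1) tnth [tuple Z j w | j < n.+1] k0)%R.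
  rewrite big_ord_recl tnth_mktuple big_split/= addrC -big_mkcond big_pred1_eq.
  by congr (_ + _)%R; apply: eq_bigr => j _; rewrite tnth_mktuple.
apply: eq_from_tnth => j; rewrite !tnth_mktuple SE /Y.
by case: (j == k); rewrite ?addr0// mulrDl.
Qed.

End dirichlet.

(** * Random characteristic couples *)

Section ae_transfer.
Local Open Scope ereal_scope.
Context (R : realType) d (Omega : measurableType d) (Q : probability Omega R).

(** Serves to pass from the beta factors of a beta-Stacy process to the hazards of F^i, with which
    they agree only almost surely. *)
Lemma mutually_independent_ae (I : eqType) (D : set I) (X Y : I -> Omega -> R)
    (N : set Omega) :
  (forall i, measurable_fun setT (X i)) -> (forall i, measurable_fun setT (Y i)) ->
  measurable N -> Q N = 1 -> (forall i w, D i -> N w -> X i w = Y i w) ->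
  mutually_independent Q D (fun i => sigma_var (X i)) ->
  mutually_independent Q D (fun i => sigma_var (Y i)).
Proof.
move=> mX mY mN QN XY /mutually_independentE iX; apply/mutually_independentE.
move=> s A us sD YA.
have mpre (f : Omega -> R) B : measurable_fun setT f -> measurable B -> measurable (f @^-1` B).
  by move=> mf mB; rewrite -[X in measurable X]setTI; exact: mf.
have /boolp.choice[B BP] : forall i, exists C : set R,
    i \in s -> measurable C /\ Y i @^-1` C = A i.
  move=> i; have [si|_] := boolP (i \in s); last by exists set0.
  by have [C mC CE] := YA i si; exists C.
have XYN i : i \in s -> X i @^-1` B i `&` N = A i `&` N.
  move=> si; have [_ <-] := BP i si.
  by apply/seteqP; split=> w /= [+ Nw]; rewrite XY//; exact: sD.
have mXB i : i \in s -> measurable (X i @^-1` B i).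
  by move=> si; apply: mpre => //; have [] := BP i si.
have mA i : i \in s -> measurable (A i).
  by move=> si; have [mB <-] := BP i si; exact: mpre.
have QXA i : i \in s -> Q (X i @^-1` B i) = Q (A i).
  by move=> si; apply: eq_probability_full QN (XYN i si) => //; [exact: mXB|exact: mA].
have -> : Q (\big[setI/setT]_(i <- s) A i) = Q (\big[setI/setT]_(i <- s) (X i @^-1` B i)).
  apply: (@eq_probability_full _ _ _ Q N) => //.
  - by rewrite big_seq_cond; apply: bigsetI_measurable => i; rewrite andbT; exact: mA.
  - by rewrite big_seq_cond; apply: bigsetI_measurable => i; rewrite andbT; exact: mXB.
  elim: s XYN {us sD YA BP mXB mA QXA} => [|i s IHs] XYN; first by rewrite !big_nil.
  rewrite !big_cons -!setIA IHs => [|j js]; last by rewrite XYN// inE js orbT.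
  by rewrite setICA -XYN ?mem_head// setICA.
rewrite iX//.
  by congr (_%:E); apply: eq_big_seq => i si; rewrite QXA.
by move=> i si; exists (B i) => //; have [] := BP i si.
Qed.

Lemma has_law_ae (X Y : Omega -> R) (mu : set R -> \bar R) (N : set Omega) :
  measurable_fun setT X -> measurable_fun setT Y ->
  measurable N -> Q N = 1 -> (forall w, N w -> X w = Y w) ->
  has_law Q X mu -> has_law Q Y mu.
Proof.
move=> mX mY mN QN XY QX B mB; rewrite -QX//.
have mpre (f : Omega -> R) : measurable_fun setT f -> measurable (f @^-1` B).
  by move=> mf; rewrite -[X in measurable X]setTI; exact: mf.
apply: (@eq_probability_full _ _ _ Q N) => //; try exact: mpre.
by apply/seteqP; split=> w /= [+ Nw]; rewrite XY.
Qed.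

Lemma has_dirichlet_law_eq (Q' : probability Omega R) n (X : Omega -> n.-tuple R)
    (a : 'I_n -> R) :
  (forall B, measurable B -> Q (X @^-1` B) = Q' (X @^-1` B)) ->
  has_dirichlet_law Q X a -> has_dirichlet_law Q' X a.
Proof.
move=> QQ'; case=> d'; case=> Omega'; case=> Pr'; case=> Z [iZ lZ XZ].
by exists d', Omega', Pr', Z; split=> // B mB; rewrite -QQ'// XZ.
Qed.

End ae_transfer.

Section sigma_kernel.
Context (R : realType) d (Omega : measurableType d).

Lemma g_sigmaI (H : set (set Omega)) : setI_closed <<s H >>.
Proof. by move=> A B; exact: (@measurableI _ (g_sigma_algebraType H)). Qed.

Lemma g_sigmaT (H : set (set Omega)) : <<s H >> setT.
Proof. exact: (@measurableT _ (g_sigma_algebraType H)). Qed.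

Lemma sigma_kernel_measurable d' (Y : measurableType d') (k : R.-pker Omega ~> Y) :
  sigma_kernel k `<=` measurable.
Proof.
apply: smallest_sub; first exact: sigma_algebra_measurable.
move=> _ [A mA [B mB <-]]; rewrite -[X in measurable X]setTI.
exact: (measurable_kernel k A mA).
Qed.

Lemma sigma_kernels_measurable (I : Type) d' (Y : measurableType d')
    (k : I -> R.-pker Omega ~> Y) : sigma_kernels k `<=` measurable.
Proof.
apply: smallest_sub; first exact: sigma_algebra_measurable.
by move=> A [i _ kA]; exact: (@sigma_kernel_measurable _ _ (k i)).
Qed.

Lemma sigma_kernel_sub (I : Type) d' (Y : measurableType d')
    (k : I -> R.-pker Omega ~> Y) i : sigma_kernel (k i) `<=` sigma_kernels k.
Proof. by move=> A kA; apply: sub_sigma_algebra; exists i. Qed.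

(** With the generated sigma-algebra as the structure on the domain, ordinary measurability lemmas
    prove membership in [sigma_kernel]. The same device returns for tuples, hazards and weights. *)
Lemma measurable_sigma_kernel d' (Y : measurableType d') (k : R.-pker Omega ~> Y)
    (A : set Y) : measurable A ->
  measurable_fun setT ((fun w => fine (k w A)) :
    g_sigma_algebraType (\bigcup_(A in measurable) sigma_var (k ^~ A)) -> R).
Proof.
move=> mA; apply: (@measurableT_comp _ _ _ _ _ _ fine).
  exact: fine_measurable.
move=> _ B mB; rewrite setTI; apply: sub_sigma_algebra.
by exists A => //; exists B.
Qed.

End sigma_kernel.

Lemma pkernel_fin_num (R : realType) d (X : measurableType d) d' (Y : measurableType d')
    (k : R.-pker X ~> Y) w (A : set Y) : measurable A -> k w A \is a fin_num.
Proof.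
move=> mA; rewrite ge0_fin_numE// (@le_lt_trans _ _ (k w setT))//.
  by apply: le_measure; rewrite ?inE.
by rewrite prob_kernel ltry.
Qed.

Section couple.
Local Open Scope ereal_scope.
Context (R : realType) dE (E : measurableType dE).
Hypothesis E_discrete : forall A : set E, measurable A.
Context d (Omega : measurableType d).
Variables (P : E -> R.-pker Omega ~> E) (F : E -> R.-pker Omega ~> nat).
Hypothesis PF : characteristic_couple P F.
Implicit Types (Q : probability Omega R).

Definition sigma_couple : set (set Omega) :=
  <<s sigma_kernels P `|` sigma_kernels F >>.

Definition tail i k w : R := fine (F i w [set j | (k < j)%N]).

(* The beta-distributed factor U_k of F^i. *)
Definition hazard i k w : R := (1 - tail i k w / tail i k.-1 w)%R.

Lemma tailE i k w : (tail i k w)%:E = F i w [set j | (k < j)%N].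
Proof. by rewrite fineK// pkernel_fin_num. Qed.

Lemma tail_ge0 i k w : (0 <= tail i k w)%R.
Proof. by rewrite fine_ge0. Qed.

Lemma tail0 i w : tail i 0 w = 1%R.
Proof.
apply: (@EFin_inj R); rewrite tailE.
have [_ F0] := PF w i.
have FU : F i w ([set 0%N] `|` [set j | (0 < j)%N]) =
    F i w [set 0%N] + F i w [set j | (0 < j)%N].
  by apply: measureU => //; apply/seteqP; split=> j //= [->].
rewrite F0 add0e in FU; rewrite -FU (_ : _ `|` _ = setT) ?prob_kernel//.
by apply/seteqP; split=> -[|j] // _; [left|right].
Qed.

Lemma tailS i k w : tail i k w = (fine (F i w [set k.+1]) + tail i k.+1 w)%R.
Proof.
apply: (@EFin_inj R); rewrite EFinD !tailE fineK ?pkernel_fin_num//.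
rewrite -(measureU (F i w) (A := [set k.+1]) (B := [set j | (k.+1 < j)%N]))//.
  congr (F i w _); apply/seteqP; split=> j /=.
    by rewrite leq_eqVlt => /predU1P[<-|kj]; [left|right].
  by move=> [->//|/ltnW].
by apply/seteqP; split=> j //= [->]; rewrite ltnn.
Qed.

(** Where the tail at [k] vanishes, division by zero makes the hazard 1, and the next tail vanishes
    too by monotonicity. *)
Lemma tail_pmass i k w : (tail i k w * (1 - hazard i k.+1 w) = tail i k.+1 w)%R.
Proof.
rewrite /hazard subKr /=; have [t0|t0] := eqVneq (tail i k w) 0%R; last by rewrite mulrCA mulfV ?mulr1.
rewrite t0 mul0r; apply/esym/eqP; rewrite eq_le tail_ge0 andbT -t0 (tailS i k w).
by rewrite lerDr fine_ge0.
Qed.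

Lemma pmass_hazard i k w : (fine (F i w [set k.+1]) = tail i k w * hazard i k.+1 w)%R.
Proof.
have := tail_pmass i k w; rewrite mulrBr mulr1 => /eqP; rewrite subr_eq => /eqP tE.
by apply: (@addIr _ (tail i k.+1 w)); rewrite -tailS addrC {1}tE addrC.
Qed.

Lemma tail_prod i k w : (tail i k w = \prod_(1 <= j < k.+1) (1 - hazard i j w))%R.
Proof.
elim: k => [|k IHk]; first by rewrite big_geq// tail0.
by rewrite big_nat_recr//= -IHk tail_pmass.
Qed.

Lemma hazard01 i k w : (0 < k)%N -> (0 <= hazard i k w <= 1)%R.
Proof.
case: k => // k _; have tk := tailS i k w; rewrite /hazard/= subr_ge0 gerBl.
rewrite divr_ge0 ?tail_ge0// andbT.
have [t0|t0] := eqVneq (tail i k w) 0%R; first by rewrite t0 invr0 mulr0.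
rewrite ler_pdivrMr ?mul1r; last by rewrite lt_neqAle eq_sym t0 tail_ge0.
by rewrite tk lerDr fine_ge0.
Qed.

Lemma sigma_kernel_hazard i k B : measurable B -> sigma_kernel (F i) (hazard i k @^-1` B).
Proof.
move=> mB.
pose T := g_sigma_algebraType (\bigcup_(A in measurable) sigma_var (F i ^~ A)).
have mt j : measurable_fun setT (tail i j : T -> R) by exact: measurable_sigma_kernel.
have mh : measurable_fun setT (hazard i k : T -> R).
  apply: measurable_funB => //; apply: measurable_funM => //.
  exact: measurable_funV.
by have := mh measurableT B mB; rewrite setTI.
Qed.

Lemma measurable_hazard i k : measurable_fun setT (hazard i k).
Proof.
move=> _ B mB; rewrite setTI.
by apply: (@sigma_kernel_measurable _ _ _ _ _ (F i)); exact: sigma_kernel_hazard.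
Qed.

Lemma sigma_kernels_couple_P : sigma_kernels P `<=` sigma_couple.
Proof. by move=> A PA; apply: sub_sigma_algebra; left. Qed.

Lemma sigma_kernels_couple_F : sigma_kernels F `<=` sigma_couple.
Proof. by move=> A PA; apply: sub_sigma_algebra; right. Qed.

(* The law of [(P, F)] in terms of the beta parameters of the factors of F. *)
Definition conjugate_law Q (m : E -> {measure set E -> \bar R}) (al be : E -> nat -> R) :=
  [/\ independent Q (sigma_kernels P) (sigma_kernels F),
      mutually_independent Q setT (fun i => sigma_kernel (P i)) /\
      mutually_independent Q setT (fun i => sigma_kernel (F i)),
      forall i, dirichlet_process Q (P i) (m i),
      forall i, mutually_independent Q [set k | (0 < k)%N] (fun k => sigma_var (hazard i k)) &
      forall i k, (0 < k)%N -> has_law Q (hazard i k) (beta_law (al i k) (be i k))].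

Lemma dirichlet_process_eq Q1 Q2 i (m : set E -> \bar R) :
  (forall A, sigma_kernel (P i) A -> Q1 A = Q2 A) ->
  dirichlet_process Q1 (P i) m -> dirichlet_process Q2 (P i) m.
Proof.
move=> Q12 Pm n A mA tA cA; apply: has_dirichlet_law_eq (Pm n A mA tA cA) => B mB.
apply: Q12.
pose T := g_sigma_algebraType (\bigcup_(A in measurable) sigma_var (P i ^~ A)).
have mX : measurable_fun setT ((fun w => [tuple fine (P i w (A j)) | j < n]) : T -> n.-tuple R).
  by apply: measurable_mktuple => j; exact: measurable_sigma_kernel.
by have := mX measurableT B mB; rewrite setTI.
Qed.

Lemma conjugate_law_eq Q1 Q2 m al be : (forall A, sigma_couple A -> Q1 A = Q2 A) ->
  conjugate_law Q1 m al be -> conjugate_law Q2 m al be.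
Proof.
move=> Q12 [iPF [iP iF] dP ih lh].
have sP i : sigma_kernel (P i) `<=` sigma_couple.
  by move=> A /(@sigma_kernel_sub _ _ _ _ _ _ P)/sigma_kernels_couple_P.
have sF i : sigma_kernel (F i) `<=` sigma_couple.
  by move=> A /(@sigma_kernel_sub _ _ _ _ _ _ F)/sigma_kernels_couple_F.
have sh i k : sigma_var (hazard i k) `<=` sigma_couple.
  by move=> _ [B mB <-]; apply: (sF i); exact: sigma_kernel_hazard.
split.
- apply: independent_eq iPF.
  + by move=> A /sigma_kernels_couple_P; exact: Q12.
  + by move=> A /sigma_kernels_couple_F; exact: Q12.
  + move=> A B /sigma_kernels_couple_P PA /sigma_kernels_couple_F FB.
    by apply: Q12; exact: g_sigmaI.
- by split; [apply: mutually_independent_eq Q12 iP|apply: mutually_independent_eq Q12 iF];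
    do ?[exact: g_sigmaI|exact: g_sigmaT].
- by move=> i; apply: dirichlet_process_eq (dP i) => A PA; apply: Q12; exact: (sP i).
- move=> i; apply: mutually_independent_eq Q12 (ih i) => //; [exact: g_sigmaI|exact: g_sigmaT].
- move=> i k k0 B mB.
  have FB : sigma_couple (hazard i k @^-1` B) by apply: (sh i k); exists B.
  by rewrite -(Q12 _ FB) (lh i k k0).
Qed.

(** The weight lies in the innermost of three nested independent families: the pair (P, F), the F^i,
    and the hazards of F^i0. Reweighting is applied at each level, and everything except one hazard
    keeps its law. The new law of that hazard is a hypothesis, so that both weights, U and 1 - U,
    are covered. *)
Lemma reweighted_hazard Q1 Q2 m al be al' be' i0 k0 (phi : R -> R) :
  (0 < k0)%N -> measurable_fun setT phi -> (forall w, 0 <= phi (hazard i0 k0 w))%R ->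
  reweighted Q1 Q2 sigma_couple (phi \o hazard i0 k0) ->
  conjugate_law Q1 m al be ->
  (forall i k, (0 < k)%N -> (i != i0) || (k != k0) -> al' i k = al i k /\ be' i k = be i k) ->
  has_law Q2 (hazard i0 k0) (beta_law (al' i0 k0) (be' i0 k0)) ->
  conjugate_law Q2 m al' be'.
Proof.
move=> k0_gt0 mphi phi_ge0 Q12 [iPF [iP iF] dP ih lh] ab' lh0.
have mP := @sigma_kernels_measurable _ _ Omega _ _ _ P.
have mF := @sigma_kernels_measurable _ _ Omega _ _ _ F.
have mg : measurable_fun setT (phi \o hazard i0 k0).
  exact: measurableT_comp mphi (measurable_hazard i0 k0).
have mphiB B : measurable B -> measurable (phi @^-1` B).
  by move=> mB; rewrite -[X in measurable X]setTI; exact: mphi.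
have gFi A B : sigma_kernel (F i0) A -> measurable B ->
    sigma_kernel (F i0) (A `&` (phi \o hazard i0 k0) @^-1` B).
  move=> FA mB; apply: g_sigmaI => //; rewrite comp_preimage.
  by apply: sigma_kernel_hazard; exact: mphiB.
have gF A B : sigma_kernels F A -> measurable B ->
    sigma_kernels F (A `&` (phi \o hazard i0 k0) @^-1` B).
  move=> FA mB; apply: g_sigmaI => //; rewrite comp_preimage.
  by apply: (@sigma_kernel_sub _ _ _ _ _ _ F i0); apply: sigma_kernel_hazard; exact: mphiB.
have FP A B : sigma_kernels F A -> sigma_kernels P B -> sigma_couple (A `&` B).
  move=> /sigma_kernels_couple_F FA /sigma_kernels_couple_P PB.
  exact: g_sigmaI.
have iFP := independent_sym iPF.
have Q12P A : sigma_kernels P A -> Q1 A = Q2 A.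
  move=> PA; apply/esym.
  exact: (reweighted_indep_eq mF mP (@g_sigmaT _ _ _) (@g_sigmaT _ _ _) FP mg phi_ge0 gF Q12 iFP PA).
have Q12F := reweighted_sub sigma_kernels_couple_F Q12.
have subF i : setT i -> sigma_kernel (F i) `<=` sigma_kernels F.
  by move=> _; exact: sigma_kernel_sub.
have sh i k : sigma_var (hazard i k) `<=` sigma_kernel (F i).
  by move=> _ [B mB <-]; exact: sigma_kernel_hazard.
have shk k : [set k | (0 < k)%N] k -> sigma_var (hazard i0 k) `<=` sigma_kernel (F i0).
  by move=> _; exact: sh.
have Q12Fi A i : i != i0 -> sigma_kernel (F i) A -> Q1 A = Q2 A.
  move=> ii0 FA; apply/esym.
  exact: (reweighted_mutually_indep_eq mF (@g_sigmaI _ _ _) (@g_sigmaT _ _ _) subF mg phi_ge0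
    I (@g_sigmaT _ _ _) gFi Q12F iF I ii0 FA).
have mFi0 := @sigma_kernel_measurable _ _ Omega _ _ (F i0).
have Q12F0 := reweighted_sub (@sigma_kernel_sub _ _ _ _ _ _ F i0) Q12F.
have shT : sigma_var (hazard i0 k0) setT by exists setT => //; rewrite preimage_setT.
have shI A B : sigma_var (hazard i0 k0) A -> measurable B ->
    sigma_var (hazard i0 k0) (A `&` (phi \o hazard i0 k0) @^-1` B).
  move=> [C mC <-] mB; exists (C `&` phi @^-1` B) => //.
  by apply: measurableI => //; exact: mphiB.
split.
- apply: independent_sym.
  exact: (reweighted_independent mF mP (@g_sigmaT _ _ _) (@g_sigmaT _ _ _) FP mg phi_ge0 gF Q12 iFP).
- split.
    apply: mutually_independent_eq Q12P iP; [exact: g_sigmaI|exact: g_sigmaT|].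
    by move=> i _; exact: sigma_kernel_sub.
  exact: (reweighted_mutually_independent mF (@g_sigmaI _ _ _) (@g_sigmaT _ _ _) subF mg phi_ge0
    I (@g_sigmaT _ _ _) gFi Q12F iF).
- move=> i; apply: dirichlet_process_eq (dP i) => A PA; apply: Q12P.
  exact: sigma_kernel_sub PA.
- move=> i; have [->|ii0] := eqVneq i i0.
    exact: (reweighted_mutually_independent mFi0 (@g_sigmaI _ _ _) (@g_sigmaT _ _ _) shk mg phi_ge0
      k0_gt0 shT shI Q12F0 (ih i0)).
  apply: (@mutually_independent_eq _ _ _ Q1 Q2 _ _ _ (sigma_kernel (F i)) (@g_sigmaI _ _ _)
    (@g_sigmaT _ _ _) _ _ (ih i)) => [k _|A FA]; first exact: sh.
  exact: Q12Fi FA.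
- move=> i k k_gt0; have [/andP[/eqP -> /eqP ->]//|] := boolP ((i == i0) && (k == k0)).
  rewrite negb_and => ik; have [-> ->] := ab' i k k_gt0 ik => B mB; rewrite -(lh i k k_gt0)//.
  have hB : sigma_var (hazard i k) (hazard i k @^-1` B) by exists B.
  have [ii0|ii0] := eqVneq i i0; last exact/esym/(Q12Fi _ i ii0 (sh i k _ hB)).
  rewrite ii0 eqxx/= in ik; rewrite ii0 in hB *.
  exact: (reweighted_mutually_indep_eq mFi0 (@g_sigmaI _ _ _) (@g_sigmaT _ _ _) shk mg phi_ge0
      k0_gt0 shT shI Q12F0 (ih i0) k_gt0 ik hB).
Qed.

Lemma fine_measure_split (mu : {measure set E -> \bar R}) (A : set E) (j : E) :
  mu setT < +oo -> A j -> (fine (mu (A `\` [set j])) + fine (mu [set j]) = fine (mu A))%R.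
Proof.
move=> mu_fin Aj.
have mu_num B : mu B \is a fin_num.
  by rewrite ge0_fin_numE// (le_lt_trans _ mu_fin)// le_measure ?inE.
apply: (@EFin_inj R); rewrite EFinD !fineK// -measureU//.
  congr (mu _); apply/seteqP; split=> x /=; first by move=> [[]//|->].
  by move=> Ax; have [->|xj] := pselect (x = j); [right|left].
by apply/seteqP; split=> x //= [[_ +] xj].
Qed.

(** The state [j0] need not be a cell of the given partition. It is split off as a separate cell,
    whose mass is the weight, and returned to its cell after the update. The cell deprived of [j0]
    may be empty, which the zero parameters of Dirichlet laws allow. *)
Lemma reweighted_transition Q1 Q2 (m m' : E -> {measure set E -> \bar R}) al be i0 j0 :
  (forall i, m i setT < +oo) ->
  (forall i A, i != i0 -> m' i A = m i A) ->
  (forall A, m' i0 A = m i0 A + \d_j0 A) ->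
  reweighted Q1 Q2 sigma_couple (fun w => fine (P i0 w [set j0])) ->
  conjugate_law Q1 m al be -> conjugate_law Q2 m' al be.
Proof.
move=> m_fin m'i m'i0 Q12 [iPF [iP iF] dP ih lh].
pose g w := fine (P i0 w [set j0]).
have mP := @sigma_kernels_measurable _ _ Omega _ _ _ P.
have mF := @sigma_kernels_measurable _ _ Omega _ _ _ F.
have g_ge0 w : (0 <= g w)%R by rewrite fine_ge0.
pose TP := g_sigma_algebraType (\bigcup_(A in measurable) sigma_var (P i0 ^~ A)).
have mPA A : measurable_fun setT ((fun w => fine (P i0 w A)) : TP -> R).
  exact: measurable_sigma_kernel.
have gB B : measurable B -> sigma_kernel (P i0) (g @^-1` B).
  by move=> mB; have := mPA [set j0] measurableT B mB; rewrite setTI.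
have mg : measurable_fun setT g.
  by move=> _ B mB; rewrite setTI; apply: (@sigma_kernel_measurable _ _ _ _ _ (P i0)); exact: gB.
have gPi A B : sigma_kernel (P i0) A -> measurable B -> sigma_kernel (P i0) (A `&` g @^-1` B).
  by move=> PA mB; apply: g_sigmaI => //; exact: gB.
have gP A B : sigma_kernels P A -> measurable B -> sigma_kernels P (A `&` g @^-1` B).
  move=> PA mB; apply: g_sigmaI => //.
  by apply: (@sigma_kernel_sub _ _ _ _ _ _ P i0); exact: gB.
have PF' A B : sigma_kernels P A -> sigma_kernels F B -> sigma_couple (A `&` B).
  move=> /sigma_kernels_couple_P PA /sigma_kernels_couple_F PB.
  exact: g_sigmaI.
have Q12F A : sigma_kernels F A -> Q1 A = Q2 A.
  move=> FA; apply/esym.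
  exact: (reweighted_indep_eq mP mF (@g_sigmaT _ _ _) (@g_sigmaT _ _ _) PF' mg g_ge0 gP Q12 iPF FA).
have Q12P := reweighted_sub sigma_kernels_couple_P Q12.
have subP i : setT i -> sigma_kernel (P i) `<=` sigma_kernels P.
  by move=> _; exact: sigma_kernel_sub.
have Q12Pi A i : i != i0 -> sigma_kernel (P i) A -> Q1 A = Q2 A.
  move=> ii0 PA; apply/esym.
  exact: (reweighted_mutually_indep_eq mP (@g_sigmaI _ _ _) (@g_sigmaT _ _ _) subP mg g_ge0
    I (@g_sigmaT _ _ _) gPi Q12P iP I ii0 PA).
split.
- exact: (reweighted_independent mP mF (@g_sigmaT _ _ _) (@g_sigmaT _ _ _) PF' mg g_ge0 gP Q12 iPF).
- split; last first.
    apply: mutually_independent_eq Q12F iF; [exact: g_sigmaI|exact: g_sigmaT|].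
    by move=> i _; exact: sigma_kernel_sub.
  exact: (reweighted_mutually_independent mP (@g_sigmaI _ _ _) (@g_sigmaT _ _ _) subP mg g_ge0
    I (@g_sigmaT _ _ _) gPi Q12P iP).
- move=> i; have [{i}->|ii0] := eqVneq i i0; last first.
    have mE : (m' i : set E -> \bar R) = m i by apply/funext => A; exact: m'i.
    rewrite mE; apply: dirichlet_process_eq (dP i) => A PA; exact: Q12Pi PA.
  move=> n A mA tA cA.
  have [k _ Akj] : (\bigcup_j A j) j0 by rewrite cA.
  have Aj j : j != k -> A j `\` [set j0] = A j.
    move=> jk; apply/seteqP; split=> x /=; first by case.
    move=> Ax; split=> // xj; have /trivIsetP/(_ j k I I jk) AA := tA.
    have : (A j `&` A k) j0 by split => //; rewrite -xj.
    by rewrite AA.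
  (* Index 0 is the new cell; of the old ones only cell [k] is altered. *)
  pose A' (i : 'I_n.+1) := oapp (fun j => A j `\` [set j0]) [set j0] (unlift ord0 i).
  have A'0 : A' ord0 = [set j0] by rewrite /A' unlift_none.
  have A'l j : A' (lift ord0 j) = A j `\` [set j0] by rewrite /A' liftK.
  have tA' : trivIset setT A'.
    apply/trivIsetP => i1 i2 _ _.
    case: (unliftP ord0 i1) => [j1|] ->; case: (unliftP ord0 i2) => [j2|] ->; rewrite ?A'0 ?A'l//.
    + rewrite (inj_eq lift_inj) => j12; have /trivIsetP/(_ j1 j2 I I j12) AA := tA.
      apply/seteqP; split=> x //= [[A1 _] [A2 _]].
      by have : (A j1 `&` A j2) x by []; rewrite AA.
    + by move=> _; apply/seteqP; split=> x //= [[_ +]].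
    + by move=> _; apply/seteqP; split=> x //= [-> []].
  have cA' : \bigcup_i A' i = setT.
    apply/seteqP; split=> // x _; have [->|xj] := pselect (x = j0).
      by exists ord0; rewrite // A'0.
    have [j _ Ajx] : (\bigcup_j A j) x by rewrite cA.
    by exists (lift ord0 j) => //; rewrite A'l.
  pose X w := [tuple fine (P i0 w (A' i)) | i < n.+1].
  have mX : measurable_fun setT (X : TP -> n.+1.-tuple R).
    by apply: measurable_mktuple => j; exact: mPA.
  have HX B : measurable B -> sigma_couple (X @^-1` B).
    move=> mB; apply: sigma_kernels_couple_P; apply: (@sigma_kernel_sub _ _ _ _ _ _ P i0).
    by have := mX measurableT B mB; rewrite setTI.
  have mX' : measurable_fun setT X.
    move=> _ B mB; rewrite setTI; apply: (@sigma_kernel_measurable _ _ _ _ _ (P i0)).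
    by have := mX measurableT B mB; rewrite setTI.
  have X0 w : tnth (X w) ord0 = g w by rewrite tnth_mktuple A'0.
  have X_ge0 w : (0 <= tnth (X w) ord0)%R by rewrite X0.
  have a_ge0 i : (0 <= fine (m i0 (A' i)))%R by rewrite fine_ge0.
  have Q12X : reweighted Q1 Q2 sigma_couple (fun w => tnth (X w) ord0).
    by under [X in reweighted _ _ _ X]eq_fun do rewrite X0.
  have [_ H2] := reweighted_dirichlet mX' X_ge0 HX a_ge0 Q12X
    (dP i0 n.+1 A' (fun i => E_discrete _) tA' cA').
  have a2_ge0 i : (0 <= fine (m i0 (A' i)) + (i == ord0)%:R)%R by rewrite addr_ge0.
  have := has_dirichlet_law_merge k mX' a2_ge0 H2.
  (* Merging index 0 back into [k] recovers the masses of the original cells, and the extra unit of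
     parameter ends in the cell containing [j0]. *)
  have XE : (fun w => [tuple tnth (X w) (lift ord0 j) +
      (if j == k then tnth (X w) ord0 else 0) | j < n]%R) =
      (fun w => [tuple fine (P i0 w (A j)) | j < n]).
    apply/funext => w; apply: eq_mktuple => j; rewrite X0 tnth_mktuple A'l.
    have [->|jk] := eqVneq j k; last by rewrite addr0 Aj.
    by apply: (@fine_measure_split (P i0 w)) => //; rewrite prob_kernel ltry.
  rewrite XE (_ : (fun j => _) = (fun j => fine (m' i0 (A j))))//.
  apply/funext => j; rewrite A'l A'0 eqxx eq_sym (negbTE (neq_lift _ _)) addr0 m'i0.
  have m_num B : m i0 B \is a fin_num.
    by rewrite ge0_fin_numE// (le_lt_trans _ (m_fin i0))// le_measure ?inE.
  rewrite fineD// diracE/=.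
  have [->|jk] := eqVneq j k; first by rewrite addrA fine_measure_split// mem_set.
  rewrite Aj// memNset//= => Aj0; have /trivIsetP/(_ j k I I jk) AA := tA.
  by have : (A j `&` A k) j0 by []; rewrite AA.
- move=> i; apply: mutually_independent_eq Q12F (ih i); [exact: g_sigmaI|exact: g_sigmaT|].
  move=> k _ _ [B mB <-]; apply: (@sigma_kernel_sub _ _ _ _ _ _ F i).
  exact: sigma_kernel_hazard.
- move=> i k k_gt0 B mB.
  have FB : sigma_kernels F (hazard i k @^-1` B).
    by apply: (@sigma_kernel_sub _ _ _ _ _ _ F i); exact: sigma_kernel_hazard.
  by rewrite -(Q12F _ FB) (lh i k k_gt0).
Qed.

(** Hence almost surely no factor U_k equals 1, no tail of F^i vanishes, and U_k can be recovered
    from F^i as its hazard. *)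
Lemma beta_law_set1 (a b : R) : beta_law a b [set 1%R] = 0.
Proof.
rewrite /beta_law; case: eqP => _; first by rewrite diracE memNset//= => /esym/eqP; rewrite oner_eq0.
rewrite /density_law (_ : [set 1%R] `&` _ = set0) ?Rintegral_set0 ?mul0r//.
by apply/seteqP; split=> x //= [->]; rewrite in_itv/= ltxx andbF.
Qed.

(** The factors in [beta_stacy] are merely asserted to exist. Where the product formula holds and no
    factor is 1, they equal the hazards, which inherit independence and laws. *)
Lemma smbs_conjugate_law Q m c (F0 : E -> probability nat R) :
  smbs Q P F m c F0 ->
  conjugate_law Q m (fun i k => c i k * fine (F0 i [set k]))%R
    (fun i k => c i k * fine (F0 i [set j | (k < j)%N]))%R.
Proof.
move=> [_ iPF iPiF dP bF].
suff hF i : mutually_independent Q [set k | (0 < k)%N] (fun k => sigma_var (hazard i k)) /\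
    forall k, (0 < k)%N -> has_law Q (hazard i k)
      (beta_law (c i k * fine (F0 i [set k])) (c i k * fine (F0 i [set j | (k < j)%N]))).
  by split => // i; have [] := hF i.
have [U [iU lU FU]] := bF i.
have U_neq1 : {ae Q, forall w, forall k, U k.+1 w != 1%R}.
  apply: ae_foralln => k; exists (U k.+1 @^-1` [set 1%R]); split.
  - exact: measurable_funPTI.
  - by have := lU k.+1 isT [set 1%R] (measurable_set1 _); rewrite beta_law_set1.
  - by move=> w /= /negP; rewrite negbK => /eqP.
have [A [mA QA AU]] := filterI FU U_neq1.
have hU k w : (0 < k)%N -> (~` A) w -> U k w = hazard i k w.
  move=> k_gt0 Aw.
  have [FUw U1] : (forall t, F i w [set k | (t < k)%N] = (\prod_(1 <= k < t.+1) (1 - U k w))%:E) /\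
      forall k, U k.+1 w != 1%R by apply: contrapT => /AU.
  have tU j : tail i j w = (\prod_(1 <= k < j.+1) (1 - U k w))%R.
    by apply: (@EFin_inj R); rewrite tailE FUw.
  have t_neq0 j : tail i j w != 0%R.
    rewrite tU; elim: j => [|j IHj]; first by rewrite big_geq// oner_neq0.
    by rewrite big_nat_recr//= mulf_neq0// subr_eq0 eq_sym U1.
  case: k k_gt0 => // k _; rewrite /hazard/= [tail i k.+1 w]tU big_nat_recr//= -tU.
  by rewrite mulrAC mulfV// mul1r subKr.
have QA1 : Q (~` A) = 1 by rewrite probability_setC// QA sube0.
have mA' : measurable (~` A) by exact: measurableC.
split=> [|k k_gt0].
  apply: mutually_independent_ae mA' QA1 hU iU => k //.
  exact: measurable_hazard.
apply: has_law_ae mA' QA1 _ (lU k k_gt0) => //; first exact: measurable_hazard.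
by move=> w; exact: hU.
Qed.

Lemma conjugate_law_smbs Q m c (F0 : E -> probability nat R) al be :
  (forall i k, (0 < k)%N -> al i k = c i k * fine (F0 i [set k]))%R ->
  (forall i k, (0 < k)%N -> be i k = c i k * fine (F0 i [set j | (k < j)%N]))%R ->
  conjugate_law Q m al be -> smbs Q P F m c F0.
Proof.
move=> alE beE [iPF [iP iF] dP ih lh]; split => // i.
exists (fun k => to_RV Q (@measurable_hazard i k)); split.
- exact: ih.
- by move=> k k_gt0; rewrite -alE// -beE//; exact: lh.
- by apply: aeW => w t; rewrite -tailE tail_prod.
Qed.

End couple.

(** * Paths and renewals *)

Section path_statistics.
Local Open Scope nat_scope.
Context (E : eqType).
Implicit Types (l x : nat -> E) (T : nat -> nat).

Lemma sojournP x t k :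
  reflect (k <= t /\ forall h, h <= k -> x (t - h) = x t) (k <= sojourn x t).
Proof.
apply: (iffP idP) => [kx|[kt xk]]; last first.
  apply: (@leq_bigmax_cond _ _ (fun k : 'I_t.+1 => k : nat) (Ordinal (kt : k < t.+1))) => /=.
  apply/forallP => h; apply/implyP => hk; exact/eqP/xk.
have [/= k0 run_k0 soj_k0] : {k0 : 'I_t.+1 |
    [forall h : 'I_t.+1, (h <= k0) ==> (x (t - h) == x t)] & sojourn x t = k0}.
  apply: eq_bigmax_cond; apply/card_gt0P; exists ord0; rewrite unfold_in /=.
  apply/forallP => h; apply/implyP; rewrite leqn0 => /eqP ->.
  by rewrite subn0.
have kt : k <= t by rewrite (leq_trans kx)// soj_k0 -ltnS.
split=> // h hk; have ht : h < t.+1 by rewrite ltnS (leq_trans hk).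
move/forallP/(_ (Ordinal ht)) : run_k0 => /=.
by rewrite -soj_k0 (leq_trans hk kx) => /eqP.
Qed.

Lemma sojourn0 x : sojourn x 0 = 0.
Proof. by apply/eqP; rewrite -leqn0; have /sojournP[] := leqnn (sojourn x 0). Qed.

Lemma sojournS x t :
  sojourn x t.+1 = if x t.+1 == x t then (sojourn x t).+1 else 0.
Proof.
case: eqP => [xt|xt].
  apply/eqP; rewrite eqn_leq; apply/andP; split.
    have := leqnn (sojourn x t.+1); case: {1 3}(sojourn x t.+1) => // k /sojournP[kt xk].
    rewrite ltnS; apply/sojournP; split=> // h hk.
    by rewrite -xt -(xk h.+1).
  have /sojournP[st xs] := leqnn (sojourn x t).
  apply/sojournP; split=> // -[|h]; first by rewrite subn0.
  by rewrite ltnS subSS xt; exact: xs.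
have := leqnn (sojourn x t.+1); case: {1 3}(sojourn x t.+1) => // k /sojournP[kt /(_ 1 isT)].
by rewrite subn1 => /esym.
Qed.

Lemma transitionsS x t i j :
  transitions x t.+1 i j = transitions x t i j + ((x t == i) && (x t.+1 == j)).
Proof. by rewrite /transitions big_nat_recr. Qed.

Lemma completed_visitsS x t i A : completed_visits x t.+1 i A =
  completed_visits x t i A + [&& x t == i, x t.+1 != i & (sojourn x t).+1 \in A].
Proof. by rewrite /completed_visits big_nat_recr. Qed.

Lemma completed_visitsD x t i A B : A `&` B = set0 ->
  completed_visits x t i (A `|` B) = completed_visits x t i A + completed_visits x t i B.
Proof.
move=> AB; rewrite /completed_visits -big_split/=; apply: eq_bigr => s _.
case: eqP => //= _; case: (x s != i) => //=.
rewrite in_setU; set k := _.+1.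
case: (boolP (k \in A)) => //= /set_mem Ak; case: (boolP (k \in B)) => //= /set_mem Bk.
by have : (A `&` B) k by []; rewrite AB.
Qed.

Lemma completed_visits_eq0 x t i A : (forall s, s < t -> ~ A (sojourn x s).+1) ->
  completed_visits x t i A = 0.
Proof.
move=> tA; rewrite /completed_visits big_nat_cond big1// => -[//|s]; rewrite andbT => /andP[_ st].
by rewrite /= (memNset (tA s _))// !andbF.
Qed.

Lemma sojourn_le x t : sojourn x t <= t.
Proof. by have /sojournP[] := leqnn (sojourn x t). Qed.

(** Read off the path alone, this is the index of the sojourn in progress at time [t], hence the
    number of completed ones. *)
Definition jumps x t := \sum_(1 <= k < t.+1) (x k != x k.-1).

Lemma jumpsS x t : jumps x t.+1 = jumps x t + (x t.+1 != x t).
Proof. by rewrite /jumps big_nat_recr. Qed.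

Lemma jumps0 x : jumps x 0 = 0.
Proof. by rewrite /jumps big_geq. Qed.

(* What the path [x 0, ..., x t] reveals about [l] and [T], apart from the
   sojourn in progress at time [t]. *)
Fixpoint renewal_record l T x t : Prop :=
  if t is s.+1 then
    renewal_record l T x s /\
    (x s.+1 != x s -> T (jumps x s) = (sojourn x s).+1 /\ l (jumps x s).+1 = x s.+1)
  else l 0 = x 0.

Lemma renewal_record_time l T x t : renewal_record l T x t ->
  renewal_time T (jumps x t) + sojourn x t = t /\ l (jumps x t) = x t.
Proof.
elim: t => [/= l0|t IHt /= [/IHt[rt lt] xS]].
  by rewrite jumps0 sojourn0 /renewal_time big_ord0.
rewrite jumpsS sojournS; case: eqP xS => [-> _|_ /(_ isT)[Tt lt']] /=.
  by rewrite addn0 addnS rt lt.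
by rewrite addn1 renewal_timeS Tt addnS rt addn0.
Qed.

(** When durations are positive and consecutive states differ, every renewal is visible as a jump of
    the path. A path is then a record of completed sojourns, together with the fact that the current
    one outlasts its present age. *)
Lemma semi_markov_record l T x t :
  (forall n, 0 < T n) -> (forall n, l n.+1 != l n) ->
  (forall s, s <= t -> semi_markov l T s = x s) <->
  renewal_record l T x t /\ sojourn x t < T (jumps x t).
Proof.
move=> T_gt0 l_neq.
have smE s n : renewal_time T n <= s < renewal_time T n.+1 -> semi_markov l T s = l n.
  by move=> /renewal_countE; rewrite /semi_markov => ->.
have ren0 : renewal_time T 0 = 0 by rewrite /renewal_time big_ord0.
elim: t => [|t IHt].
  have sm0 : semi_markov l T 0 = l 0 by apply: smE; rewrite renewal_timeS ren0 T_gt0.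
  rewrite /= sojourn0 jumps0 T_gt0; split=> [/(_ 0 isT)|[l0 _] s]; first by rewrite sm0.
  by rewrite leqn0 => /eqP ->; rewrite sm0.
split=> [xs|[/= [rec_t xS] soj_lt] s].
  have /IHt[rec_t soj_lt] : forall s, s <= t -> semi_markov l T s = x s.
    by move=> s st; apply: xs; rewrite leqW.
  have [rt lt] := renewal_record_time rec_t; have xS := xs t.+1 (leqnn _).
  (* Either the current duration is exactly [(sojourn x t).+1], and a renewal falls at time [t + 1],
     or it is longer and the state persists. *)
  rewrite /= sojournS jumpsS; move: soj_lt; rewrite leq_eqVlt => /predU1P[TE|soj_lt].
    have smS : semi_markov l T t.+1 = l (jumps x t).+1.
      apply: smE; rewrite renewal_timeS -TE addnS rt leqnn/=.
      by rewrite 2!renewal_timeS -TE addnS rt -[X in X < _]addn0 ltn_add2l.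
    by rewrite -xS -lt smS l_neq (negbTE (l_neq _)); split=> //; split=> // _; rewrite -TE.
  have smS : semi_markov l T t.+1 = l (jumps x t).
    have tE : t.+1 = renewal_time T (jumps x t) + (sojourn x t).+1 by rewrite addnS rt.
    by apply: smE; rewrite renewal_timeS tE leq_addr ltn_add2l.
  by rewrite -xS smS lt eqxx addn0.
have [rt lt] := renewal_record_time (conj rec_t xS : renewal_record l T x t.+1).
rewrite leq_eqVlt => /predU1P[->|].
  by rewrite -lt; apply: smE; rewrite renewal_timeS; lia.
rewrite ltnS; move: s; apply/IHt; split=> //.
move: soj_lt xS; rewrite sojournS jumpsS; case: eqP => /= [_|_ _ /(_ isT)[-> _]] //.
by rewrite addn0 => /ltnW.
Qed.

End path_statistics.

Lemma countable_surj (E : Type) (e0 : E) : countable [set: E] ->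
  exists g : nat -> E, forall e, exists n, g n = e.
Proof.
move=> /countable_injP[f f_inj].
exists (fun n => if pselect (exists e, f e = n) is left ex then projT1 (cid ex) else e0) => e.
exists (f e); case: pselect => [ex|]; last by case; exists e.
by apply: f_inj; rewrite ?inE//; case: (cid ex).
Qed.

Lemma adde_finI (R : realType) (x y z : \bar R) :
  x \is a fin_num -> (x + y = x + z)%E -> y = z.
Proof.
move=> x_fin xyz; have : (y + x - x = z + x - x)%E by rewrite ![(_ + x)%E]addeC xyz.
by rewrite !addeK.
Qed.

(** * Likelihood of a path given the characteristic couple *)

Section renewal.
Local Open Scope ereal_scope.
Context (R : realType) dE (E : measurableType dE).
Hypothesis E_countable : countable [set: E].
Hypothesis E_discrete : forall A : set E, measurable A.
Context (l0 : E) d (Omega : measurableType d) (Pr : probability Omega R).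
Variables (P : E -> R.-pker Omega ~> E) (F : E -> R.-pker Omega ~> nat).
Variables (L : nat -> {RV Pr >-> E}) (T : nat -> {RV Pr >-> nat}).
Hypothesis PF : characteristic_couple P F.
Hypothesis LT : markov_renewal Pr P F l0 L T.

Local Notation history := (renewal_history P F L T).

Lemma renewal_history_measurable n : history n `<=` measurable.
Proof.
apply: smallest_sub; first exact: sigma_algebra_measurable.
move=> A [[[k _ [B mB <-]]|[k _ [B mB <-]]]|[|]].
- exact: measurable_funPTI.
- exact: measurable_funPTI.
- exact: sigma_kernels_measurable.
- exact: sigma_kernels_measurable.
Qed.

Lemma renewal_history_L n k A : (k <= n)%N -> history n (L k @^-1` A).
Proof. by move=> kn; apply: sub_sigma_algebra; left; left; exists k => //; exists A. Qed.

Lemma renewal_history_T n k A : (k < n)%N -> history n (T k @^-1` A).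
Proof. by move=> kn; apply: sub_sigma_algebra; left; right; exists k => //; exists A. Qed.

Lemma renewal_history_couple n : sigma_couple P F `<=` history n.
Proof.
apply: smallest_sub; first exact: smallest_sigma_algebra.
by move=> A PFA; apply: sub_sigma_algebra; right.
Qed.

Lemma renewal_historyS n : history n `<=` history n.+1.
Proof.
apply: smallest_sub; first exact: smallest_sigma_algebra.
move=> A [[[k kn [B mB <-]]|[k kn [B mB <-]]]|PFA].
- by apply: renewal_history_L; rewrite leqW.
- by apply: renewal_history_T; rewrite /= in kn *; rewrite ltnW.
- by apply: sub_sigma_algebra; right.
Qed.

(** Extends the defining clause to [u = 0], where both sides are 0: durations are almost surely
    positive and F^i has no mass at 0. *)
Lemma renewal_cdf n u i j D : history n D -> D `<=` [set w | L n w = i] ->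
  Pr (D `&` [set w | L n.+1 w = j /\ (T n w <= u)%N]) =
  \int[Pr]_(w in D) (F i w [set k | (k <= u)%N] * P i w [set j]).
Proof.
move=> hD Di; have [[A [mA PrA A0]] cdf] := LT.
have DiE : D `&` [set w | L n w = i] = D.
  by apply/seteqP; split=> w /= => [[]//|Dw]; split=> //; exact: Di.
case: u => [|u]; last by have := cdf n u.+1 i j D isT hD; rewrite DiE.
rewrite integral0_eq => [|w Dw]; last first.
  rewrite [X in X * _](_ : _ = 0) ?mul0e//; have [_ <-] := PF w i.
  by congr (F i w _); apply/seteqP; split=> k /=; rewrite leqn0 => /eqP.
apply/eqP; rewrite -measure_le0 -PrA; apply: le_measure; rewrite ?inE//.
  apply: measurableI; first exact: renewal_history_measurable hD.
  rewrite [X in measurable X](_ : _ = L n.+1 @^-1` [set j] `&` T n @^-1` [set 0%N]); last first.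
    by apply/seteqP; split=> w /= [-> //]; rewrite leqn0 => /eqP.
  by apply: measurableI; exact: measurable_funPTI.
by move=> w [_ [_ Tw]]; apply: A0 => /= -[_ /(_ n)]; rewrite ltnNge Tw.
Qed.

Lemma measurable_fun_kernel d' (Y : measurableType d') (k : R.-pker Omega ~> Y) (A : set Y) :
  measurable A -> measurable_fun setT (fun w => fine (k w A)).
Proof.
move=> mA; apply: (@measurableT_comp _ _ _ _ _ _ fine); first exact: fine_measurable.
exact: measurable_kernel.
Qed.

(** Difference of [renewal_cdf] at [u + 1] and at [u]; the subtraction is licit because the
    probabilities are finite. *)
Lemma renewal_atom n u i j D : history n D -> D `<=` [set w | L n w = i] ->
  Pr (D `&` [set w | L n.+1 w = j /\ T n w = u.+1]) =
  \int[Pr]_(w in D) (fine (F i w [set u.+1]) * fine (P i w [set j]))%:E.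
Proof.
move=> hD Di; have mD := renewal_history_measurable hD.
have mevent (B : set nat) : measurable [set w | L n.+1 w = j /\ B (T n w)].
  rewrite [X in measurable X](_ : _ = L n.+1 @^-1` [set j] `&` T n @^-1` B)//.
  by apply: measurableI; exact: measurable_funPTI.
have FuS w : F i w [set k | (k <= u.+1)%N] = F i w [set k | (k <= u)%N] + F i w [set u.+1].
  rewrite -(measureU (F i w) (A := [set k | (k <= u)%N]) (B := [set u.+1]))//.
    congr (F i w _); apply/seteqP; split=> k /=.
      by rewrite leq_eqVlt => /predU1P[->|]; [right|left].
    by move=> [/leqW|->].
  by apply/seteqP; split=> k //= [+ kE]; rewrite kE ltnn.
have := renewal_cdf u.+1 j hD Di.
have -> : D `&` [set w | L n.+1 w = j /\ (T n w <= u.+1)%N] =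
    (D `&` [set w | L n.+1 w = j /\ (T n w <= u)%N]) `|`
    (D `&` [set w | L n.+1 w = j /\ T n w = u.+1]).
  apply/seteqP; split=> w /=.
    move=> [Dw [Lw]]; rewrite leq_eqVlt => /predU1P[Tw|Tw]; first by right.
    by left.
  by move=> [|] [Dw [Lw]] => [Tw|->]; do ?split=> //; rewrite leqW.
have mk u' : measurable_fun D (fun w => F i w [set k | (k <= u')%N] * P i w [set j]).
  by apply: emeasurable_funM; apply: measurable_funTS; exact: measurable_kernel.
have mk1 : measurable_fun D (fun w => F i w [set u.+1] * P i w [set j]).
  by apply: emeasurable_funM; apply: measurable_funTS; exact: measurable_kernel.
rewrite measureU; last 3 first.
- by apply: measurableI => //; exact: (mevent [set k | (k <= u)%N]).
- by apply: measurableI => //; exact: (mevent [set k | k = u.+1]).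
- by apply/seteqP; split=> w //= [[_ [_ +]] [_ [_ Tw]]]; rewrite Tw ltnn.
under eq_integral do rewrite FuS ge0_muleDl//.
rewrite ge0_integralD//.
rewrite -(renewal_cdf u j hD Di) => /adde_finI -> //.
  by apply: eq_integral => w _; rewrite EFinM !fineK ?pkernel_fin_num.
apply: fin_num_measure; apply: measurableI => //.
exact: (mevent [set k | (k <= u)%N]).
Qed.

(** The next state is summed out, using that P^i has total mass 1, and then the complement is
    taken. *)
Lemma renewal_survival n u i D : history n D -> D `<=` [set w | L n w = i] ->
  Pr (D `&` [set w | (u < T n w)%N]) = \int[Pr]_(w in D) (tail F i u w)%:E.
Proof.
move=> hD Di; have mD := renewal_history_measurable hD.
have [g g_surj] := countable_surj i E_countable.
(* The enumeration may repeat states, as it must when E is finite; made disjoint, each set is empty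
   or a singleton. *)
pose A k := seqDU (fun k => [set g k]) k.
have A_cover : \bigcup_k A k = setT.
  rewrite -seqDU_bigcup_eq; apply/seteqP; split=> // e _.
  by have [k <-] := g_surj e; exists k.
have tA : trivIset setT A by exact: trivIset_seqDU.
have A01 k : A k = set0 \/ A k = [set g k].
  have Ak : A k `<=` [set g k] by move=> e [].
  have [/eqP->|/set0P[e Ae]] := boolP (A k == set0); [by left|right].
  by apply/seteqP; split=> // _ ->; rewrite -(Ak e Ae).
have mT (B : set nat) : measurable (D `&` [set w | B (T n w)]).
  by apply: measurableI => //; exact: (@measurable_funPTI _ _ _ _ (T n) B).
pose h w k := F i w [set k | (k <= u)%N] * P i w (A k).
have PrA k : Pr (D `&` [set w | (T n w <= u)%N] `&` L n.+1 @^-1` A k) =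
    \int[Pr]_(w in D) h w k.
  rewrite /h; have [->|->] := A01 k.
    rewrite preimage_set0 setI0 measure0 integral0_eq// => w _.
    by rewrite measure0 mule0.
  rewrite -(renewal_cdf u (g k) hD Di); congr (Pr _).
  by apply/seteqP; split=> w /= => [[[]]|[? []]].
have mh k : measurable_fun D (h ^~ k).
  apply: emeasurable_funM; apply: measurable_funTS; exact: measurable_kernel.
have PrD : Pr (D `&` [set w | (T n w <= u)%N]) =
    \int[Pr]_(w in D) F i w [set k | (k <= u)%N].
  rewrite -[X in Pr X]setIT -(preimage_setT (L n.+1)) -A_cover preimage_bigcup setI_bigcupr.
  rewrite measure_semi_bigcup; last 3 first.
  - move=> k; apply: measurableI; first exact: (mT [set k | (k <= u)%N]).
    exact: measurable_funPTI.
  - apply/trivIsetP => k1 k2 _ _ k12; have /trivIsetP/(_ k1 k2 I I k12) AA := tA.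
    apply/seteqP; split=> w //= [[_ A1] [_ A2]].
    by have : (A k1 `&` A k2) (L n.+1 w) by []; rewrite AA.
  - apply: bigcupT_measurable => k; apply: measurableI; first exact: (mT [set k | (k <= u)%N]).
    exact: measurable_funPTI.
  transitivity (\sum_(k <oo) \int[Pr]_(w in D) h w k).
    by apply: eq_eseriesr => k _; exact: PrA.
  rewrite -integral_nneseries//; last by move=> k w _; exact: mule_ge0.
  apply: eq_integral => w _; rewrite /h -[F i w _]fineK ?pkernel_fin_num// nneseriesZl//.
  have PA : P i w (\bigcup_k A k) = \sum_(k <oo) P i w (A k).
    by apply: measure_semi_bigcup; rewrite ?A_cover.
  by rewrite -PA A_cover prob_kernel mule1.
have cdf_tail w : F i w [set k | (k <= u)%N] + (tail F i u w)%:E = 1.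
  rewrite tailE -(measureU (F i w) (A := [set k | (k <= u)%N]))//; last first.
    by apply/seteqP; split=> k //= []; rewrite ltnNge => ->.
  rewrite (_ : _ `|` _ = setT); first exact: prob_kernel.
  by apply/seteqP; split=> k // _; have [?|?] := leqP k u; [left|right].
have mF : measurable_fun D (fun w => F i w [set k | (k <= u)%N]).
  by apply: measurable_funTS; exact: measurable_kernel.
have mtail : measurable_fun D (fun w => (tail F i u w)%:E).
  by apply/measurable_EFinP/measurable_funTS; exact: measurable_fun_kernel.
have : Pr D = \int[Pr]_(w in D) F i w [set k | (k <= u)%N] +
    \int[Pr]_(w in D) (tail F i u w)%:E.
  rewrite -ge0_integralD//; last by move=> w _; rewrite lee_fin tail_ge0.
  under eq_integral do rewrite cdf_tail.
  by rewrite integral1.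
have -> : D = (D `&` [set w | (T n w <= u)%N]) `|` (D `&` [set w | (u < T n w)%N]).
  rewrite -setIUr (_ : _ `|` _ = setT) ?setIT//.
  by apply/seteqP; split=> w // _ /=; have [?|?] := leqP (T n w) u; [left|right].
rewrite measureU; last 3 first.
- exact: (mT [set k | (k <= u)%N]).
- exact: (mT [set k | (u < k)%N]).
- by apply/seteqP; split=> w //= [[_ +] [_]]; rewrite ltnNge => ->.
rewrite -setIUr (_ : _ `|` _ = setT) ?setIT; last first.
  by apply/seteqP; split=> w // _ /=; have [?|?] := leqP (T n w) u; [left|right].
rewrite -PrD => /adde_finI -> //; apply: fin_num_measure.
exact: (mT [set k | (k <= u)%N]).
Qed.

(** A renewal from a state to itself has probability 0 for each state and each positive duration,
    since P^i has no mass at i; countably many such events are discarded. *)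
Lemma renewal_regular : {ae Pr, forall w,
  [/\ L 0%N w = l0, forall n, (0 < T n w)%N & forall n, L n.+1 w != L n w]}.
Proof.
have [g g_surj] := countable_surj l0 E_countable.
have L_neq : {ae Pr, forall w, forall n k u, ~ (L n w = g k /\ (L n.+1 w = g k /\ T n w = u.+1))}.
  apply: ae_foralln => n; apply: ae_foralln => k; apply: ae_foralln => u.
  have h : history n [set w | L n w = g k] by exact: (@renewal_history_L n n [set g k]).
  exists ([set w | L n w = g k] `&` [set w | L n.+1 w = g k /\ T n w = u.+1]); split.
  - apply: measurableI; first exact: renewal_history_measurable h.
    rewrite [X in measurable X](_ : _ = L n.+1 @^-1` [set g k] `&` T n @^-1` [set u.+1])//.
    by apply: measurableI; exact: measurable_funPTI.
  - have := renewal_atom u (g k) h (fun w Lw => Lw); rewrite integral0_eq// => w _.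
    by have [-> _] := PF w (g k); rewrite mulr0.
  - by move=> w /= /contrapT.
have [Lt _] := LT.
apply: filterS (filterI L_neq Lt) => w [LTw [L0 Tw]]; split=> // n.
apply/eqP => Lw; have [k gk] := g_surj (L n w).
by apply: (LTw n k (T n w).-1); rewrite Lw gk prednK.
Qed.

Definition record_event x t : set Omega :=
  [set w | renewal_record (L ^~ w) (T ^~ w) x t].

(** The record mentions only completed durations, not the one of index [jumps x t]; this places it
    in the history on which the law of the current sojourn is conditioned. *)
Lemma record_event_history x t : history (jumps x t) (record_event x t).
Proof.
elim: t => [|t IHt]; first by rewrite jumps0; exact: (@renewal_history_L 0 0 [set x 0%N]).
rewrite jumpsS; have [xt|xt] := eqVneq (x t.+1) (x t).
  rewrite addn0 (_ : record_event x t.+1 = record_event x t)//.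
  by apply/seteqP; split=> w /= => [[]//|rec_t]; split=> //; rewrite xt eqxx.
rewrite addn1 (_ : record_event x t.+1 = record_event x t `&`
  (T (jumps x t) @^-1` [set (sojourn x t).+1] `&` L (jumps x t).+1 @^-1` [set x t.+1])).
  apply: g_sigmaI; first exact: renewal_historyS.
  by apply: g_sigmaI; [exact: renewal_history_T|exact: renewal_history_L].
by apply/seteqP; split=> w /= [rec_t]; [rewrite xt => /(_ isT)|split].
Qed.

Lemma measurable_record_event x t : measurable (record_event x t).
Proof. by apply: renewal_history_measurable; exact: record_event_history. Qed.

Lemma record_event_state x t : record_event x t `<=` [set w | L (jumps x t) w = x t].
Proof. by move=> w /renewal_record_time[]. Qed.

(** The decomposition of [semi_markov_record] requires the regularity of [renewal_regular], which is
    only almost sure; hence an identity of probabilities and not of events. *)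
Lemma probability_path_event x t C : measurable C ->
  Pr (path_event L T t x `&` C) =
  Pr (record_event x t `&` C `&` [set w | (sojourn x t < T (jumps x t) w)%N]).
Proof.
move=> mC; have [A [mA PrA AN]] := renewal_regular.
apply: (@eq_probability_full _ _ _ Pr (~` A)).
- exact: measurableC.
- by apply: measurableI => //; exact: measurable_path_event.
- apply: measurableI; last first.
    exact: (@measurable_funPTI _ _ _ _ (T (jumps x t)) [set k | (sojourn x t < k)%N]).
  by apply: measurableI => //; exact: measurable_record_event.
- by rewrite probability_setC// PrA sube0.
- apply/seteqP; split=> w /= [+ Aw].
    have [_ Tw Lw] : [/\ L 0%N w = l0, forall n, (0 < T n w)%N & forall n, L n.+1 w != L n w].
      by apply: contrapT => /AN.
    by move=> [/(semi_markov_record _ _ Tw Lw)[? ?] ?].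
  have [_ Tw Lw] : [/\ L 0%N w = l0, forall n, (0 < T n w)%N & forall n, L n.+1 w != L n w].
    by apply: contrapT => /AN.
  by move=> [[? ?] ?]; do ?split=> //; exact/(semi_markov_record _ _ Tw Lw).
Qed.

Lemma sigma_couple_measurable : sigma_couple P F `<=` measurable.
Proof. by move=> C /(@renewal_history_couple 0); exact: renewal_history_measurable. Qed.

Lemma path_event_couple x t C : sigma_couple P F C ->
  Pr (path_event L T t x `&` C) =
  \int[Pr]_(w in record_event x t `&` C) (tail F (x t) (sojourn x t) w)%:E.
Proof.
move=> FC; rewrite probability_path_event; last exact: sigma_couple_measurable.
apply: (@renewal_survival (jumps x t)).
  by apply: g_sigmaI; [exact: record_event_history|exact: renewal_history_couple].
by move=> w [/record_event_state].
Qed.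

(* The conditional probability of x_{t+1} given x_0, ..., x_t and (P, F). *)
Definition next_state_weight x t w : R :=
  let i := x t in let l := sojourn x t in
  (if x t.+1 == x t then 1 - hazard F i l.+1 w
   else fine (P i w [set x t.+1]) * hazard F i l.+1 w)%R.

(** If the state persists, the record is unchanged and the tail gains the factor 1 - U. If it jumps,
    the record gains a completed sojourn, whose joint probability with the new state is that of
    [renewal_atom]. *)
Lemma path_eventS_couple x t C : sigma_couple P F C ->
  Pr (path_event L T t.+1 x `&` C) =
  \int[Pr]_(w in record_event x t `&` C)
    (next_state_weight x t w * tail F (x t) (sojourn x t) w)%:E.
Proof.
move=> FC; rewrite path_event_couple// /next_state_weight sojournS.
have [xt|xt] := eqVneq (x t.+1) (x t).
  rewrite (_ : record_event x t.+1 = record_event x t); last first.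
    by apply/seteqP; split=> w /= => [[]//|rec_t]; split=> //; rewrite xt eqxx.
  by rewrite xt; apply: eq_integral => w _; rewrite mulrC tail_pmass.
(* The sojourn that has just begun has age 0, so its survival factor is 1. *)
under eq_integral do rewrite (tail0 PF).
have mC := sigma_couple_measurable FC.
rewrite integral1; last first.
  by apply: measurableI => //; exact: measurable_record_event.
rewrite (_ : record_event x t.+1 `&` C = (record_event x t `&` C) `&`
  [set w | L (jumps x t).+1 w = x t.+1 /\ T (jumps x t) w = (sojourn x t).+1]); last first.
  apply/seteqP; split=> w /=.
    by move=> [[rec_t /(_ xt)[Tw Lw]] Cw].
  by move=> [[rec_t Cw] [Lw Tw]]; do ?split.
rewrite (@renewal_atom (jumps x t) (sojourn x t) (x t)); last 2 first.
- by apply: g_sigmaI; [exact: record_event_history|exact: renewal_history_couple].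
- by move=> w [/record_event_state].
by apply: eq_integral => w _; rewrite pmass_hazard//; congr (_%:E); ring.
Qed.

(** * Successive posteriors as reweightings *)

Lemma cond_probE (B C : set Omega) (mB : measurable B) : (0 < Pr B)%E ->
  Pr B * cond_prob Pr mB C = Pr (B `&` C).
Proof.
move=> B_gt0; have B_fin : Pr B \is a fin_num by exact: fin_num_measure.
rewrite /cond_prob /= /mnormalize /= /mrestr setTI.
have -> : (Pr B == 0) || (Pr B == +oo) = false.
  by rewrite gt_eqF//=; apply/negbTE; case: (Pr B) B_fin.
rewrite -{1}(fineK B_fin) muleCA -EFinM mulfV ?mule1 1?setIC//.
by rewrite gt_eqF// fine_gt0// B_gt0 ltey_eq B_fin.
Qed.

Lemma next_state_weight_ge0 x t w : (0 <= next_state_weight x t w)%R.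
Proof.
rewrite /next_state_weight; have /andP[h0 h1] := @hazard01 _ _ _ _ _ F (x t) (sojourn x t).+1 w isT.
by case: ifP => _; rewrite ?subr_ge0// mulr_ge0.
Qed.

Lemma next_state_weight_couple x t B : measurable B ->
  sigma_couple P F (next_state_weight x t @^-1` B).
Proof.
move=> mB.
pose S := g_sigma_algebraType (sigma_kernels P `|` sigma_kernels F).
have mh k : measurable_fun setT (hazard F (x t) k : S -> R).
  move=> _ A mA; rewrite setTI; apply: sigma_kernels_couple_F.
  by apply: (@sigma_kernel_sub _ _ _ _ _ _ F (x t)); exact: sigma_kernel_hazard.
have mP j : measurable_fun setT ((fun w => fine (P (x t) w [set j])) : S -> R).
  move=> _ A mA; rewrite setTI; apply: sigma_kernels_couple_P.
  apply: (@sigma_kernel_sub _ _ _ _ _ _ P (x t)).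
  by have := @measurable_sigma_kernel _ _ _ _ _ (P (x t)) _ (E_discrete [set j]) measurableT A mA; rewrite setTI.
have mw : measurable_fun setT (next_state_weight x t : S -> R).
  rewrite /next_state_weight; case: (x t.+1 == x t); first exact: measurable_funB.
  exact: measurable_funM.
by have := mw measurableT B mB; rewrite setTI.
Qed.

Lemma measurable_next_state_weight x t : measurable_fun setT (next_state_weight x t).
Proof.
by move=> _ B mB; rewrite setTI; apply: sigma_couple_measurable; exact: next_state_weight_couple.
Qed.

Lemma path_event_sub x t : path_event L T t.+1 x `<=` path_event L T t x.
Proof. by move=> w xw s st; apply: xw; rewrite leqW. Qed.

Local Notation posterior x t :=
  (cond_prob Pr (measurable_path_event E_discrete L T t x)).

Lemma path_event_gt0S x t : (0 < Pr (path_event L T t.+1 x) -> 0 < Pr (path_event L T t x))%E.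
Proof.
move=> /lt_le_trans; apply; apply: le_measure; last exact: path_event_sub.
all: by rewrite inE; exact: measurable_path_event.
Qed.

(** On events about the couple, the posterior is the image of [Pr] restricted to the record, with
    density the current tail divided by [p]; multiplying that density by the weight gives the next
    path event. *)
Lemma reweighted_posterior x t : (0 < Pr (path_event L T t.+1 x))%E ->
  reweighted (posterior x t) (posterior x t.+1) (sigma_couple P F) (next_state_weight x t).
Proof.
move=> pS_gt0; have p_gt0 := path_event_gt0S pS_gt0.
have mpath s : measurable (path_event L T s x) by exact: measurable_path_event.
have p_fin s : Pr (path_event L T s x) \is a fin_num by exact: fin_num_measure.
set p := fine (Pr (path_event L T t x)); set pS := fine (Pr (path_event L T t.+1 x)).
have fp_gt0 : (0 < p)%R by rewrite fine_gt0// p_gt0 ltey_eq p_fin.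
have fpS_gt0 : (0 < pS)%R by rewrite fine_gt0// pS_gt0 ltey_eq p_fin.
have pE C : sigma_couple P F C -> p%:E * posterior x t C =
    \int[Pr]_(w in record_event x t `&` C) (tail F (x t) (sojourn x t) w)%:E.
  by move=> FC; rewrite -path_event_couple// -cond_probE// fineK.
have mrec := measurable_record_event x t.
have mg := measurable_next_state_weight x t.
have mtail : measurable_fun setT (tail F (x t) (sojourn x t)) by exact: measurable_fun_kernel.
(* The constant is the conditional probability of the next state given the path so far. *)
exists (pS / p)%R => [|C FC]; first exact: divr_gt0.
have mC := sigma_couple_measurable FC.
apply: (mule_pinjl fp_gt0).
transitivity (Pr (path_event L T t.+1 x `&` C)).
  rewrite muleA -EFinM mulrCA mulfV ?gt_eqF// mulr1 -(cond_probE _ (mpath t.+1))//.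
  by rewrite fineK.
have mh : measurable_fun setT (fun w => tail F (x t) (sojourn x t) w / p)%R.
  exact: measurable_funM.
rewrite path_eventS_couple//.
rewrite (@transfer_integral _ _ _ _ _ (posterior x t) Pr C (record_event x t `&` C)
  (next_state_weight x t) (next_state_weight x t)
  (fun w => tail F (x t) (sojourn x t) w / p)%R)//.
- rewrite -ge0_integralZl_EFin//.
  + by apply: eq_integral => w _; rewrite -EFinM; congr (_%:E); field; rewrite gt_eqF.
  + exact: measurableI.
  + by move=> w _; rewrite lee_fin mulr_ge0 ?next_state_weight_ge0// divr_ge0 ?tail_ge0// ltW.
  + by apply/measurable_EFinP/measurable_funTS; exact: measurable_funM.
  + exact: ltW.
- exact: measurableI.
- by move=> w _; exact: next_state_weight_ge0.
- by move=> w _; exact: next_state_weight_ge0.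
- by move=> w _; rewrite divr_ge0 ?tail_ge0// ltW.
- move=> B mB; apply: (mule_pinjl fp_gt0).
  have FCB : sigma_couple P F (C `&` next_state_weight x t @^-1` B).
    by apply: g_sigmaI => //; exact: next_state_weight_couple.
  rewrite pE// setIA -ge0_integralZl_EFin//.
  + by apply: eq_integral => w _; rewrite -EFinM; congr (_%:E); field; rewrite gt_eqF.
  + rewrite -setIA; apply: measurableI => //; exact: sigma_couple_measurable.
  + by move=> w _; rewrite lee_fin divr_ge0 ?tail_ge0// ltW.
  + by apply/measurable_EFinP/measurable_funTS; exact: mh.
  + exact: ltW.
Qed.

(** * Update of the parameters *)

Variables (m : E -> {measure set E -> \bar R}) (c : E -> nat -> R)
  (F0 : E -> probability nat R).
Hypothesis mcF0 : smbs_params m c F0.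

(* The beta parameters of the posterior factor U_k of F^i. *)
Definition updated_alpha x t i k : R :=
  (c i k * fine (F0 i [set k]) + (completed_visits x t i [set k])%:R)%R.

Definition updated_beta x t i k : R :=
  (c i k * fine (F0 i [set j | (k < j)%N]) +
   (completed_visits x t i [set j | (k < j)%N])%:R + (censored t x i k)%:R)%R.

Lemma updated_alpha_ge0 x t i k : (0 < k)%N -> (0 <= updated_alpha x t i k)%R.
Proof.
move=> k_gt0; have [_ c_gt0 _ _] := mcF0 i.
by rewrite addr_ge0// mulr_ge0 ?fine_ge0// ltW// c_gt0.
Qed.

Lemma updated_alphaS x t i k : updated_alpha x t.+1 i k = (updated_alpha x t i k +
  [&& x t.+1 != x t, i == x t & k == (sojourn x t).+1]%:R)%R.
Proof.
rewrite /updated_alpha completed_visitsS natrD addrA; congr (_ + _%:R)%R.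
rewrite [i == x t]eq_sym; case: (eqVneq (x t) i) => [->|]; last by rewrite andbF.
case: (x t.+1 != i) => //=; congr nat_of_bool.
by apply/idP/eqP => [/set_mem <-//|->]; exact/mem_set.
Qed.

(** Staying extends the censored sojourn, which adds one at [k = l + 1], where [l] is the current
    sojourn. At a jump the sojourn, of completed length [l + 1], moves from the censored term to the
    visits: [k <= l] becomes [k < l + 1] and nothing changes. *)
Lemma updated_betaS x t i k : (0 < k)%N -> updated_beta x t.+1 i k = (updated_beta x t i k +
  [&& x t.+1 == x t, i == x t & k == (sojourn x t).+1]%:R)%R.
Proof.
move=> k_gt0; rewrite /updated_beta completed_visitsS -!addrA; congr (_ + _)%R.
rewrite -!natrD; congr (_%:R)%R; rewrite -addnA; congr (_ + _)%N.
rewrite (_ : _ \in _ = (k < (sojourn x t).+1)%N); last first.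
  by apply/idP/idP => [/set_mem|/mem_set].
rewrite /censored sojournS.
case: (eqVneq (x t.+1) (x t)) => [->|xt] /=.
  rewrite [i == x t]eq_sym; case: (eqVneq (x t) i) => //= _.
  rewrite add0n leq_eqVlt ltnS addnC; case: eqP => [->|_] //=.
  by rewrite ltnn.
rewrite addn0 [(k <= 0)%N]leqNgt k_gt0 andbF addn0 ltnS.
rewrite [i == x t]eq_sym; case: (eqVneq (x t) i) => [<-|//].
by rewrite xt.
Qed.

Lemma conjugate_law_ext Q ms al be al' be' :
  (forall i k, (0 < k)%N -> al i k = al' i k) -> (forall i k, (0 < k)%N -> be i k = be' i k) ->
  conjugate_law P F Q ms al be -> conjugate_law P F Q ms al' be'.
Proof.
move=> alE beE [iPF iPiF dP ih lh]; split; [exact: iPF|exact: iPiF|exact: dP|exact: ih|].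
by move=> i k k_gt0; rewrite -alE// -beE//; exact: lh.
Qed.

Lemma posteriorS x t (ms : E -> {measure set E -> \bar R}) :
  (0 < Pr (path_event L T t.+1 x))%E ->
  (forall i, 0 < ms i setT < +oo) -> updated_mass m t x ms ->
  conjugate_law P F (posterior x t) ms (updated_alpha x t) (updated_beta x t) ->
  exists ms' : E -> {measure set E -> \bar R},
    [/\ forall i, 0 < ms' i setT < +oo, updated_mass m t.+1 x ms' &
    conjugate_law P F (posterior x t.+1) ms' (updated_alpha x t.+1) (updated_beta x t.+1)].
Proof.
move=> pS_gt0 ms_fin ms_up Qt.
have QS := reweighted_posterior pS_gt0.
set i0 := x t in QS *; set k0 := (sojourn x t).+1.
have h01 w : (0 <= hazard F i0 k0 w <= 1)%R by exact: hazard01.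
have [_ _ _ _ lh] := Qt; have := lh i0 k0 isT => lh0.
have hB B : measurable B -> sigma_couple P F (hazard F i0 k0 @^-1` B).
  move=> mB; apply: sigma_kernels_couple_F.
  by apply: (@sigma_kernel_sub _ _ _ _ _ _ F i0); exact: sigma_kernel_hazard.
have mh : measurable_fun setT (hazard F i0 k0) by exact: measurable_hazard.
have [xt|xt] := eqVneq (x t.+1) (x t).
  have QS1 : reweighted (posterior x t) (posterior x t.+1) (sigma_couple P F)
      (fun w => 1 - hazard F i0 k0 w)%R.
    by move: QS; rewrite /next_state_weight xt eqxx.
  exists ms; split; [exact: ms_fin| |].
    move=> i; have [ms0 msj] := ms_up i; split=> // j ji; rewrite msj// transitionsS.
    rewrite xt [X in (_ + X)%N](_ : _ = 0%N) ?addn0//.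
    by case: eqP => //= ->; rewrite eq_sym (negbTE ji).
  have step := @reweighted_hazard _ _ _ E_discrete _ _ P F (posterior x t) (posterior x t.+1) ms
    (updated_alpha x t) (updated_beta x t) (updated_alpha x t.+1) (updated_beta x t.+1) i0 k0
    (fun u => 1 - u)%R isT.
  apply: (step _ _ QS1 Qt).
  - exact: measurable_funB.
  - by move=> w; rewrite subr_ge0; have /andP[] := h01 w.
  - move=> i k k_gt0 ik; rewrite updated_alphaS updated_betaS// xt eqxx /=.
    by rewrite -[_ && _]negbK negb_and ik !addr0.
  - rewrite updated_alphaS (updated_betaS x t i0 (isT : (0 < k0)%N)) xt !eqxx addr0.
    exact: (reweighted_beta_r mh h01 hB lh0 QS1).
set j0 := x t.+1; pose g w : R := fine (P i0 w [set j0]).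
have mg : measurable_fun setT g by exact: measurable_fun_kernel.
have g01 w : (0 <= g w <= 1)%R.
  rewrite fine_ge0//= -lee_fin fineK ?pkernel_fin_num//.
  have : P i0 w [set j0] <= P i0 w setT by apply: le_measure; rewrite ?inE.
  by rewrite prob_kernel.
have QS1 : reweighted (posterior x t) (posterior x t.+1) (sigma_couple P F)
    (fun w => g w * hazard F i0 k0 w)%R.
  by move: QS; rewrite /next_state_weight (negbTE xt).
(* The hazard alone dominates the product weight because [g <= 1], and the product has positive mean
   as the constant of [QS1]. So reweighting by the hazard is possible. *)
have Ih_gt0 : 0 < \int[posterior x t]_w (hazard F i0 k0 w)%:E < +oo.
  rewrite integral_le1_lty// andbT; have [z z_gt0 Qz] := QS1.
  apply: (@lt_le_trans _ _ (\int[posterior x t]_w (g w * hazard F i0 k0 w)%:E)).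
    rewrite -(Qz setT); last exact: g_sigmaT.
    by rewrite (_ : posterior x t.+1 setT = 1) ?mule1//; exact: probability_setT.
  apply: ge0_le_integral => //.
  - by move=> w _; rewrite lee_fin mulr_ge0//; [have /andP[] := g01 w|have /andP[] := h01 w].
  - by apply/measurable_EFinP; exact: measurable_funM.
  - exact/measurable_EFinP.
  - by move=> w _; rewrite lee_fin ler_piMl//; [have /andP[] := h01 w|have /andP[] := g01 w].
have h_ge0 w : (0 <= hazard F i0 k0 w)%R by have /andP[] := h01 w.
(* [Q'] accounts for the end of the sojourn but not yet for the new state; the next posterior is
   [Q'] reweighted by the transition probability. *)
have [Q' QQ'] := reweighted_exists mh h_ge0 Ih_gt0.
have QQ'c := reweighted_sub sigma_couple_measurable QQ'.
have Q'S : reweighted Q' (posterior x t.+1) (sigma_couple P F) g.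
  apply: (reweighted_divr sigma_couple_measurable mh mg h_ge0 _ QQ' QS1) => w.
  by have /andP[] := g01 w.
pose al' i k := (updated_alpha x t i k + ((i == i0) && (k == k0))%:R)%R.
have Q'law : conjugate_law P F Q' ms al' (updated_beta x t).
  have step := @reweighted_hazard _ _ _ E_discrete _ _ P F (posterior x t) Q' ms
    (updated_alpha x t) (updated_beta x t) al' (updated_beta x t) i0 k0 id isT.
  apply: (step _ h_ge0 QQ'c Qt).
  - exact: measurable_id.
  - move=> i k _ ik; rewrite /al'.
    by rewrite -[_ && _]negbK negb_and ik !addr0.
  - rewrite /al' !eqxx; apply: (reweighted_beta_l mh h01 hB lh0 _ QQ'c).
    exact: updated_alpha_ge0.
(* One transition to [j0] is added to row [i0]; as [j0] differs from [i0], the diagonal stays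
   null. *)
pose ms' i : {measure set E -> \bar R} :=
  if i == i0 then (measure_add (ms i) (dirac j0) : {measure set E -> \bar R}) else ms i.
have ms'i0 A : ms' i0 A = ms i0 A + \d_j0 A by rewrite /ms' eqxx; exact: measure_addE.
have ms'i i : i != i0 -> ms' i = ms i by rewrite /ms' => /negbTE ->.
exists ms'; split.
- move=> i; have [->|/ms'i -> //] := eqVneq i i0.
  rewrite ms'i0 diracT; have /andP[m1 m2] := ms_fin i0.
  by rewrite lte_add_pinfty ?ltry// adde_gt0.
- move=> i; have [ms0 msj] := ms_up i; have [ii0|ii0] := eqVneq i i0.
    rewrite ii0 ms'i0 -ii0 ms0 diracE memNset/=; last by rewrite ii0 => /eqP; rewrite (negbTE xt).
    split=> [|j ji]; first by rewrite addr0.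
    rewrite -ii0 in ms'i0; rewrite ms'i0 msj// diracE transitionsS natrD EFinD addeA; congr (_ + _%:E).
    rewrite -/i0 -ii0 eqxx /=; congr (_%:R)%R; congr nat_of_bool.
    by apply/idP/eqP => [/set_mem //|<-]; exact/mem_set.
  rewrite ms'i//; split=> // j ji; rewrite msj// transitionsS -/i0 [i0 == i]eq_sym.
  by rewrite (negbTE ii0) addn0.
- apply: (@conjugate_law_ext _ _ al' (updated_beta x t)).
  + by move=> i k k_gt0; rewrite updated_alphaS xt.
  + by move=> i k k_gt0; rewrite updated_betaS// (negbTE xt) addr0.
  + have step := @reweighted_transition _ _ _ E_discrete _ _ P F Q' (posterior x t.+1) ms ms'
      al' (updated_beta x t) i0 j0.
    apply: (step _ _ _ Q'S Q'law).
    * by move=> i; have /andP[] := ms_fin i.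
    * by move=> i A /ms'i ->.
    * exact: ms'i0.
Qed.

(** Positive probability forces [x 0 = l0], and then the path event at time 0 is almost sure, so
    conditioning on it changes nothing. *)
Lemma posterior0 x C : (0 < Pr (path_event L T 0 x))%E -> sigma_couple P F C ->
  posterior x 0%N C = Pr C.
Proof.
move=> p_gt0 FC; have [A [mA PrA AN]] := renewal_regular.
have regular w : (~` A) w ->
    [/\ L 0%N w = l0, forall n, (0 < T n w)%N & forall n, L n.+1 w != L n w].
  by move=> Aw; apply: contrapT => /AN.
have PrA1 : Pr (~` A) = 1 by rewrite probability_setC// PrA sube0.
have mA' : measurable (~` A) by exact: measurableC.
have mpath : measurable (path_event L T 0 x) by exact: measurable_path_event.
have path0 w : (~` A) w -> path_event L T 0 x w <-> x 0%N = l0.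
  move=> /regular[L0 Tw Lw].
  have := semi_markov_record x 0 Tw Lw; rewrite /= sojourn0 jumps0 => path0.
  by split=> [/path0[]|x0]; [rewrite L0|apply/path0; rewrite L0 x0].
have x0 : x 0%N = l0.
  apply: contrapT => x0; move: p_gt0.
  rewrite (@eq_probability_full _ _ _ Pr (~` A) (path_event L T 0 x) set0)//.
    by rewrite measure0 ltxx.
  by rewrite set0I; apply/seteqP; split=> w //= [/path0 + Aw]; move=> /(_ Aw).
have mC := sigma_couple_measurable FC.
have Pr_path B : measurable B -> Pr (path_event L T 0 x `&` B) = Pr B.
  move=> mB; apply: (@eq_probability_full _ _ _ Pr (~` A)) => //; first exact: measurableI.
  apply/seteqP; split=> w /= [+ Aw]; first by move=> [].
  by move=> Bw; do ?split=> //; exact/path0.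
have Pr1 : Pr (path_event L T 0 x) = 1.
  by rewrite -[X in Pr X]setIT Pr_path// probability_setT.
by rewrite -(Pr_path C mC) -(cond_probE C (measurable_path_event E_discrete L T 0 x))// Pr1 mul1e.
Qed.

Lemma posterior_conjugate x t :
  (0 < Pr (path_event L T t x))%E ->
  conjugate_law P F Pr m (fun i k => c i k * fine (F0 i [set k]))%R
    (fun i k => c i k * fine (F0 i [set j | (k < j)%N]))%R ->
  exists ms : E -> {measure set E -> \bar R},
    [/\ forall i, 0 < ms i setT < +oo, updated_mass m t x ms &
    conjugate_law P F (posterior x t) ms (updated_alpha x t) (updated_beta x t)].
Proof.
move=> + prior; elim: t => [p_gt0|t IHt pS_gt0].
  exists m; split.
  - by move=> i; have [[]] := mcF0 i.
  - move=> i; have [[_ mi0] _ _ _] := mcF0 i; split=> // j _.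
    by rewrite /transitions big_geq// adde0.
  - apply: (@conjugate_law_ext _ _ (fun i k => c i k * fine (F0 i [set k]))%R
      (fun i k => c i k * fine (F0 i [set j | (k < j)%N]))%R).
    + by move=> i k _; rewrite /updated_alpha /completed_visits big_geq// addr0.
    + move=> i k k_gt0; rewrite /updated_beta /completed_visits big_geq// addr0.
      by rewrite /censored sojourn0 leqNgt k_gt0 andbF addr0.
    + by apply: conjugate_law_eq prior => // A FA; apply/esym; exact: posterior0.
have [ms [ms_fin ms_up ms_law]] := IHt (path_event_gt0S pS_gt0).
exact: posteriorS pS_gt0 ms_fin ms_up ms_law.
Qed.

End renewal.

(** * The posterior parameters *)

Section survival.
Local Open Scope ereal_scope.
Context (R : realType).

Lemma survival_distribution (S : nat -> R) :
  S 0%N = 1%R -> (forall k, S k.+1 <= S k)%R -> S n @[n --> \oo] --> 0%R ->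
  exists mu : probability nat R, forall u, mu [set j | (u < j)%N] = (S u)%:E.
Proof.
move=> S0 S_nincr S_cvg0.
(* The mass at [k] is the drop of the survival function there; since [0.-1] is [0], the point 0
   receives none. *)
have p_ge0 k : (0 <= S k.-1 - S k)%R by rewrite subr_ge0; case: k.
pose p k : {nonneg R} := NngNum (p_ge0 k).
pose delta k : {measure set nat -> \bar R} := mscale (p k) \d_k.
pose mu : {measure set nat -> \bar R} := mseries delta 0.
have deltaE k A : delta k A = (S k.-1 - S k)%:E * \d_k A by [].
(* Telescoping; [maxn] keeps the formula valid when the sum stops before [u], both sides being 0. *)
have sumE u n : \sum_(0 <= k < n.+1) delta k [set j | (u <= j)%N] =
    (S u.-1 - S (maxn u.-1 n))%:E.
  elim: n => [|n IHn].
    by rewrite big_nat1 deltaE/= subrr mul0e maxn0 subrr.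
  rewrite big_nat_recr//= IHn deltaE/= diracE.
  have [un|nu] := leqP u n.+1.
    rewrite mem_set//= mule1 -EFinD; congr (_%:E).
    have -> : maxn u.-1 n = n by lia.
    have -> : maxn u.-1 n.+1 = n.+1 by lia.
    ring.
  rewrite memNset/=; last by apply/negP; rewrite -ltnNge.
  by rewrite mule0 adde0; congr ((_ - S _)%:E); lia.
have muE u : mu [set j | (u <= j)%N] = (S u.-1)%:E.
  apply/cvg_lim => //; rewrite -(cvg_shiftS _).
  apply: (@cvg_trans _ ((S u.-1 - S (maxn u.-1 n))%:E @[n --> \oo])).
    apply: near_eq_cvg; apply: nearW => n.
    by rewrite /= -(sumE u n).
  apply: cvg_EFin; first exact: nearW.
  suff : (S u.-1 - S (maxn u.-1 n))%R @[n --> \oo] --> (S u.-1 - 0)%R by rewrite subr0.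
  apply: cvgB; first exact: cvg_cst.
  apply: cvg_trans S_cvg0; apply: near_eq_cvg; near=> n.
  by rewrite (maxn_idPr _)//; near: n; exact: nbhs_infty_ge.
have muT : mu setT = 1.
  by rewrite -[RHS]/(1%R%:E) -S0 -(muE 0%N); congr (mu _); apply/seteqP; split.
(* The total mass is already 1; normalising only supplies the structure of a probability. *)
exists (mnormalize mu \d_0%N) => u.
by rewrite /= /mnormalize muT/= onee_eq0/= invr1 mule1 -[RHS](muE u.+1).
Unshelve. all: by end_near. Qed.

End survival.

Lemma fine_tail0_cvg (R : realType) (mu : probability nat R) :
  fine (mu [set j | (n < j)%N]) @[n --> \oo] --> (0 : R).
Proof.
have cvg_mu : mu [set j | (n < j)%N] @[n --> \oo] --> (mu (\bigcap_n [set j | (n < j)%N]) : \bar R).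
  apply: nonincreasing_cvg_mu => //.
  - by rewrite (le_lt_trans (probability_le1 _ _))// ltry.
  - by move=> n1 n2 n12; apply/subsetPset => j /=; exact: leq_ltn_trans.
apply: fine_cvg; rewrite (_ : \bigcap_n _ = set0) ?measure0 in cvg_mu; first exact: cvg_mu.
by apply/seteqP; split=> j // /(_ j I) /=; rewrite ltnn.
Qed.

Section posterior_survival.
Context (R : realType) dE (E : measurableType dE).
Variables (m : E -> {measure set E -> \bar R}) (c : E -> nat -> R)
  (F0 : E -> probability nat R) (t : nat) (x : nat -> E).
Hypothesis mcF0 : smbs_params m c F0.

Let G i k : R := fine (F0 i [set j | (k < j)%N]).
Local Notation alpha := (updated_alpha c F0 x t).
Local Notation beta := (updated_beta c F0 x t).
Local Notation h := (updated_hazard c F0 t x).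

Let G_gt0 i k : 0 < G i k.
Proof.
have [_ _ _ F0_gt0] := mcF0 i.
by rewrite fine_gt0// F0_gt0/= ltey_eq fin_num_measure.
Qed.

Let GS i k : G i k = fine (F0 i [set k.+1]) + G i k.+1.
Proof.
rewrite /G -fineD ?fin_num_measure// -measureU//.
  congr (fine (F0 i _)); apply/seteqP; split=> j /=.
    by rewrite leq_eqVlt => /predU1P[<-|]; [left|right].
  by move=> [->//|/ltnW].
by apply/seteqP; split=> j //= [->]; rewrite ltnn.
Qed.

Let c_gt0 i k : (0 < k)%N -> 0 < c i k.
Proof. by have [_ + _ _] := mcF0 i; apply. Qed.

Lemma updated_beta_gt0 i k : (0 < k)%N -> 0 < beta i k.
Proof. by move=> k_gt0; rewrite /updated_beta -addrA ltr_wpDr// ?addr_ge0// mulr_gt0 ?c_gt0// G_gt0. Qed.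

(** Splitting [[k, +oo)] at its first point identifies the updated hazard with the mean of the
    posterior law Beta(alpha, beta). *)
Lemma updated_hazardE i k : (0 < k)%N -> h i k = alpha i k / (alpha i k + beta i k).
Proof.
case: k => // k _; rewrite /updated_hazard -/(alpha i k.+1); congr (_ / _).
have -> : [set j | (k.+1 <= j)%N] = [set k.+1] `|` [set j | (k.+1 < j)%N].
  apply/seteqP; split=> j /=; first by rewrite leq_eqVlt => /predU1P[<-|]; [left|right].
  by move=> [->//|/ltnW].
have disj : [set k.+1] `&` [set j | (k.+1 < j)%N] = set0.
  by apply/seteqP; split=> j //= [->]; rewrite ltnn.
rewrite measureU// fineD ?fin_num_measure// completed_visitsD// natrD /updated_alpha /updated_beta.
ring.
Qed.

Lemma updated_survivalE i k : (0 < k)%N -> 1 - h i k = beta i k / (alpha i k + beta i k).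
Proof.
move=> k_gt0; rewrite updated_hazardE//; field; rewrite gt_eqF//.
by rewrite ltr_wpDl ?updated_beta_gt0// (updated_alpha_ge0 mcF0).
Qed.

Let S i u := \prod_(1 <= s < u.+1) (1 - h i s).

Let SS i u : S i u.+1 = S i u * (1 - h i u.+1).
Proof. by rewrite /S big_nat_recr. Qed.

Let S0 i : S i 0 = 1.
Proof. by rewrite /S big_geq. Qed.

Let S_gt0 i u : 0 < S i u.
Proof.
elim: u => [|u IHu]; rewrite ?S0// SS mulr_gt0// updated_survivalE// divr_gt0 ?updated_beta_gt0//.
by rewrite ltr_wpDl ?updated_beta_gt0// (updated_alpha_ge0 mcF0).
Qed.

Let S_nincr i u : S i u.+1 <= S i u.
Proof.
have a_ge0 := updated_alpha_ge0 mcF0 x t i (isT : (0 < u.+1)%N).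
rewrite SS -[leRHS]mulr1 ler_wpM2l ?(ltW (S_gt0 _ _))// gerBl updated_hazardE//.
by rewrite divr_ge0// addr_ge0// ltW// updated_beta_gt0.
Qed.

(* Beyond the observed lengths, the posterior hazards are those of F_0. *)
Let S_after i n : S i (t + n)%N = S i t / G i t * G i (t + n)%N.
Proof.
elim: n => [|n IHn]; first by rewrite addn0 mulfVK// gt_eqF.
rewrite addnS SS IHn updated_survivalE//.
have visits0 A : (forall k, A k -> (t < k)%N) -> completed_visits x t i A = 0%N.
  move=> tA; apply: completed_visits_eq0 => s st /tA; apply/negP; rewrite -leqNgt.
  by rewrite (leq_trans _ st)// ltnS sojourn_le.
have alphaE : alpha i (t + n).+1 = c i (t + n).+1 * fine (F0 i [set (t + n).+1]).
  rewrite /updated_alpha visits0 ?addr0// => _ ->.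
  by rewrite ltnS leq_addr.
have betaE : beta i (t + n).+1 = c i (t + n).+1 * G i (t + n).+1.
  rewrite /updated_beta visits0 ?addr0; last first.
    by move=> k /=; apply: leq_trans; rewrite ltnS (leq_trans (leq_addr n t)).
  rewrite /censored leqNgt ltnS (leq_trans (sojourn_le x t)) ?leq_addr// andbF addr0.
  by [].
rewrite alphaE betaE -mulrDr -GS -mulf_div divff ?mul1r ?gt_eqF ?c_gt0//.
by rewrite -[LHS]mulrA [_ * (_ / _)]mulrC mulfVK// gt_eqF.
Qed.

Let S_cvg0 i : S i n @[n --> \oo] --> 0.
Proof.
have G_cvg : G i (n + t)%N @[n --> \oo] --> (0 : R).
  by have := @fine_tail0_cvg _ (F0 i); rewrite -(cvg_shiftn t).
have GM_cvg : S i t / G i t * G i (n + t)%N @[n --> \oo] --> S i t / G i t * 0.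
  by apply: cvgM; first exact: cvg_cst.
rewrite mulr0 in GM_cvg; rewrite -(cvg_shiftn t); apply: cvg_trans GM_cvg.
by apply: near_eq_cvg; apply: nearW => n /=; rewrite [(n + t)%N]addnC S_after.
Qed.

(** Recovers a precision and a centring distribution from the beta parameters. With [cs = beta / S],
    the identity [S k / S (k - 1) = beta / (alpha + beta)] gives
    [cs * (S (k - 1) - S k) = alpha]. *)
Lemma updated_distribution_exists : exists (cs : E -> nat -> R) (Fs : E -> probability nat R),
  [/\ updated_distribution c F0 t x Fs, updated_precision c F0 t x Fs cs,
    forall i, [/\ forall k, (0 < k)%N -> 0 < cs i k, Fs i [set 0%N] = 0%E &
      forall k, (0 < Fs i [set j | (k < j)%N])%E] &
    forall i k, (0 < k)%N -> alpha i k = cs i k * fine (Fs i [set k]) /\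
      beta i k = cs i k * fine (Fs i [set j | (k < j)%N])].
Proof.
have [Fs FsE] : exists Fs : E -> probability nat R,
    forall i u, Fs i [set j | (u < j)%N] = (S i u)%:E.
  have /boolp.choice[Fs FsE] : forall i, exists mu : probability nat R,
      forall u, mu [set j | (u < j)%N] = (S i u)%:E.
    by move=> i; apply: survival_distribution; [exact: S0|exact: S_nincr|exact: S_cvg0].
  by exists Fs.
exists (fun i k => beta i k / S i k), Fs.
have FsS i k : fine (Fs i [set k.+1]) = S i k - S i k.+1.
  have := FsE i k.
  rewrite (_ : [set j | (k < j)%N] = [set k.+1] `|` [set j | (k.+1 < j)%N]); last first.
    apply/seteqP; split=> j /=; first by rewrite leq_eqVlt => /predU1P[<-|]; [left|right].
    by move=> [->//|/ltnW].
  rewrite measureU//; last by apply/seteqP; split=> j //= [->]; rewrite ltnn.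
  move=> /(congr1 fine); rewrite fineD ?fin_num_measure// => FsU.
  have FsSk : fine (Fs i [set j | (k.+1 < j)%N]) = S i k.+1 by rewrite FsE.
  by apply/eqP; rewrite eq_sym subr_eq -FsSk; apply/eqP; exact/esym/FsU.
split.
- by move=> i u _; exact: FsE.
- by move=> i u _; rewrite FsE.
- move=> i; split=> [k k_gt0| |k]; last by rewrite FsE lte_fin.
    by rewrite divr_gt0// updated_beta_gt0.
  have := probability_setC (Fs i) (_ : measurable [set j | (0 < j)%N]).
  rewrite FsE S0 subee// => /(_ I) <-; congr (Fs i _).
  by apply/seteqP; split=> j /= => [->|/negP]; rewrite -?leqNgt ?leqn0// => /eqP.
- move=> i [//|k] _; rewrite FsE FsS; split; last by rewrite mulfVK// gt_eqF.
  have b_gt0 := updated_beta_gt0 i (isT : (0 < k.+1)%N).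
  have a_ge0 := updated_alpha_ge0 mcF0 x t i (isT : (0 < k.+1)%N).
  have Sk := SS i k; rewrite updated_survivalE// in Sk; rewrite Sk; field.
  by rewrite !gt_eqF// ltr_wpDl.
Qed.

End posterior_survival.

Theorem theorem4p1 (R : realType)
    (dE : measure_display) (E : measurableType dE)
    (E_countable : countable [set: E])
    (E_discrete : forall A : set E, measurable A)
    (l0 : E)
    (d : measure_display) (Omega : measurableType d) (Pr : probability Omega R)
    (m : E -> {measure set E -> \bar R}) (c : E -> nat -> R)
    (F0 : E -> probability nat R)
    (P : E -> R.-pker Omega ~> E) (F : E -> R.-pker Omega ~> nat)
    (L : nat -> {RV Pr >-> E}) (T : nat -> {RV Pr >-> nat})
    (t : nat) (x : nat -> E) :
  smbs_params m c F0 ->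
  smbs Pr P F m c F0 ->
  markov_renewal Pr P F l0 L T ->
  (0 < t)%N ->
  (0 < Pr (path_event L T t x))%E ->
  exists (ms : E -> {measure set E -> \bar R}) (cs : E -> nat -> R)
         (Fs : E -> probability nat R),
    [/\ smbs_params ms cs Fs,
        updated_mass m t x ms,
        updated_distribution c F0 t x Fs,
        updated_precision c F0 t x Fs cs &
        smbs (cond_prob Pr (measurable_path_event E_discrete L T t x))
          P F ms cs Fs].
Proof.
move=> mcF0 PF_smbs LT _ p_gt0; have [PF _ _ _ _] := PF_smbs.
have prior := smbs_conjugate_law PF_smbs.
have [ms [ms_fin ms_up ms_law]] := posterior_conjugate E_countable E_discrete PF LT mcF0 p_gt0 prior.
have [cs [Fs [Fs_up cs_up csFs_params csFsE]]] := updated_distribution_exists t x mcF0.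
exists ms, cs, Fs; split=> //.
- by move=> i; have [ms0 _] := ms_up i; have [? ? ?] := csFs_params i.
- by apply: conjugate_law_smbs ms_law => // i k k_gt0; have [] := csFsE i k k_gt0.
Qed.
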